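(* Let $k$ be an algebraically closed field of characteristic $0$, let $p,q$ be prime numbers with $p^4<q$, and let $H$ be a semisimple Hopf algebra over $k$ of dimension $p^2q^2$. If $|G(H^* )|=q^2$, then $H$ is upper semisolvable.
   Context: $G(H^* )$ is the group of group-like elements of the dual Hopf algebra $H^*$. A Hopf algebra is called trivial if it is isomorphic to a group algebra or to the dual of a group algebra (of a finite group). For a Hopf algebra map $\pi:H\to B$ put $H^{co\pi}=\{h\in H: (\mathrm{id}\otimes\pi)\Delta(h)=h\otimes 1\}$ and ${}^{co\pi}H=\{h\in H:(\pi\otimes \mathrm{id})\Delta(h)=1\otimes h\}$; $\pi$ is called normal if $H^{co\pi}={}^{co\pi}H$ (equivalently $H^{co\pi}$ is a Hopf subalgebra of $H$). A finite-dimensional Hopf algebra $H$ is upper semisolvable if there is a chain of quotient Hopf algebras $H_{(0)}=H\xrightarrow{\pi_1}H_{(1)}\xrightarrow{\pi_2}\cdots\xrightarrow{\pi_n}H_{(n)}=k$ with each $\pi_i$ normal and all $H_{(i-1)}^{co\pi_i}$ trivial. *)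

(* Defs.v *)
From HB Require Import structures.
From mathcomp Require Import all_boot all_order all_algebra all_fingroup.
From mathcomp Require Import all_field.

Set Implicit Arguments.
Unset Strict Implicit.
Unset Printing Implicit Defensive.

Import GRing.Theory.
Local Open Scope ring_scope.

(* [tens U V] holds the coordinates of a tensor with respect to the products
    [e_i ⊗ e_j] of the library's chosen bases; it is an alias of a matrix type
    so that the matrix product is not available on it.  [tlift b] is the linear
    map induced by a bilinear map [b] (see [tliftE]), so
    [tlift (fun a b => E a b) (comul h)] is the Sweedler sum
    [\sum E(h_(1), h_(2))]. *)

Definition tens (k : fieldType) (U V : vectType k) : Type :=
  'M[k]_(\dim {:U}, \dim {:V}).

HB.instance Definition _ (k : fieldType) (U V : vectType k) :=
  Vector.on (tens U V).

Definition tpure (k : fieldType) (U V : vectType k) (u : U) (v : V) : tens U V :=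
  (\matrix_(i, j) (coord (vbasis {:U}) i u * coord (vbasis {:V}) j v))%R.

Definition tlift (k : fieldType) (U V W : vectType k) (b : U -> V -> W)
    (t : tens U V) : W :=
  \sum_i \sum_j (t : 'M[k]_(_, _)) i j *: b (vbasis {:U})`_i (vbasis {:V})`_j.

Definition tmap (k : fieldType) (U V U' V' : vectType k)
    (f : U -> U') (g : V -> V') : tens U V -> tens U' V' :=
  tlift (fun u v => tpure (f u) (g v)).

Definition tassoc (k : fieldType) (U V W : vectType k) :
    tens (tens U V) W -> tens U (tens V W) :=
  tlift (fun t w => tlift (fun u v => tpure u (tpure v w)) t).

Definition tmul (k : fieldType) (A B : falgType k) (s t : tens A B) : tens A B :=
  tlift (fun a b => tlift (fun c d => tpure (a * c) (b * d)) t) s.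

Definition bilin (k : fieldType) (U V W : vectType k) (b : U -> V -> W) : Prop :=
  (forall v, linear (b^~ v)) /\ (forall u, linear (b u)).

Section TensTheory.
Variable k : fieldType.
Implicit Types U V W : vectType k.

Lemma tpure_bilin U V : bilin (@tpure k U V).
Proof.
split=> [v a x y|u a x y]; apply/matrixP=> i j; rewrite !mxE linearP /=.
  by rewrite mulrDl mulrA.
by rewrite mulrDr mulrCA.
Qed.

Lemma linear0' U V (f : U -> V) : linear f -> f 0 = 0.
Proof. by move=> lf; have := lf (-1) 0 0; rewrite scaler0 addr0 scaleN1r addNr. Qed.

Lemma linearZ' U V (f : U -> V) : linear f -> forall a u, f (a *: u) = a *: f u.
Proof. by move=> lf a u; rewrite -[a *: u]addr0 lf (linear0' lf) addr0. Qed.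

Lemma linearD' U V (f : U -> V) : linear f -> {morph f : u v / u + v}.
Proof. by move=> lf u v; rewrite -[u in LHS]scale1r lf scale1r. Qed.

Lemma linear_sum' U V (f : U -> V) : linear f ->
  forall (I : finType) (F : I -> U), f (\sum_i F i) = \sum_i f (F i).
Proof.
move=> lf I F; elim/big_rec2: _ => [|i u v _ <-]; first exact: linear0'.
exact: linearD'.
Qed.

Lemma vbasisE U (u : U) :
  u = \sum_i coord (vbasis {:U}) i u *: (vbasis {:U})`_i.
Proof. by apply: coord_vbasis; rewrite memvf. Qed.

Lemma coord_vbasis_delta U (i j : 'I_(\dim {:U})) :
  coord (vbasis {:U}) i (vbasis {:U})`_j = (i == j)%:R.
Proof. by rewrite coord_free ?(basis_free (vbasisP _)) // eq_sym. Qed.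

Lemma tliftE U V W (b : U -> V -> W) : bilin b ->
  forall u v, tlift b (tpure u v) = b u v.
Proof.
case=> bl br u v; rewrite [u in RHS]vbasisE [v in RHS]vbasisE /tlift.
rewrite (linear_sum' (bl _)); apply: eq_bigr => i _.
rewrite (linear_sum' (br _)); apply: eq_bigr => j _.
by rewrite (linearZ' (bl _)) (linearZ' (br _)) mxE scalerA.
Qed.

Lemma tlift_linear U V W (b : U -> V -> W) : linear (tlift b).
Proof.
move=> a s t; rewrite /tlift scaler_sumr -big_split; apply: eq_bigr => i _ /=.
rewrite scaler_sumr -big_split; apply: eq_bigr => j _ /=.
by rewrite !mxE scalerDl scalerA.
Qed.

Lemma tens_basisE U V (t : tens U V) : tlift (@tpure k U V) t = t.
Proof.
apply/matrixP=> i j; rewrite /tlift summxE (bigD1 i) //= summxE (bigD1 j) //=.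
rewrite !mxE !coord_vbasis_delta !eqxx !mulr1 !big1 ?addr0 // => [i' ni|j' nj].
  rewrite summxE big1 // => j' _; rewrite !mxE !coord_vbasis_delta eq_sym.
  by rewrite (negPf ni) mul0r mulr0.
by rewrite !mxE !coord_vbasis_delta [j == _]eq_sym (negPf nj) !mulr0.
Qed.

Lemma eq_tlift U V W (b c : U -> V -> W) :
  (forall u v, b u v = c u v) -> tlift b =1 tlift c.
Proof.
by move=> bc t; apply: eq_bigr => i _; apply: eq_bigr => j _; rewrite bc.
Qed.

Lemma tlift_comp U V W W' (f : W -> W') (b : U -> V -> W) : linear f ->
  forall t, f (tlift b t) = tlift (fun u v => f (b u v)) t.
Proof.
move=> lf t; rewrite /tlift (linear_sum' lf); apply: eq_bigr => i _.
rewrite (linear_sum' lf); apply: eq_bigr => j _; exact: linearZ'.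
Qed.

Lemma tens_ext U V W (f g : tens U V -> W) : linear f -> linear g ->
  (forall u v, f (tpure u v) = g (tpure u v)) -> f =1 g.
Proof.
move=> lf lg fg t; rewrite -(tens_basisE t) (tlift_comp _ lf) (tlift_comp _ lg).
exact: eq_tlift.
Qed.

Lemma exchange_tlift U V U' V' W (F : U -> V -> U' -> V' -> W) s t :
  tlift (fun u v => tlift (F u v) t) s =
  tlift (fun u' v' => tlift (fun u v => F u v u' v') s) t.
Proof.
rewrite /tlift; pose T i j i' j' : W :=
  ((s : 'M[k]_(_, _)) i j * (t : 'M[k]_(_, _)) i' j') *:
  F (vbasis {:U})`_i (vbasis {:V})`_j (vbasis {:U'})`_i' (vbasis {:V'})`_j'.
transitivity (\sum_i \sum_j \sum_i' \sum_j' T i j i' j').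
  apply: eq_bigr => i _; apply: eq_bigr => j _; rewrite scaler_sumr.
  apply: eq_bigr => i' _; rewrite scaler_sumr; apply: eq_bigr => j' _.
  by rewrite scalerA.
transitivity (\sum_i' \sum_j' \sum_i \sum_j T i j i' j'); last first.
  apply: eq_bigr => i' _; apply: eq_bigr => j' _; rewrite scaler_sumr.
  apply: eq_bigr => i _; rewrite scaler_sumr; apply: eq_bigr => j _.
  by rewrite scalerA mulrC.
under eq_bigr => i _ do rewrite exchange_big /=.
rewrite exchange_big /=; apply: eq_bigr => i' _.
under eq_bigr => i _ do rewrite exchange_big /=.
by rewrite exchange_big.
Qed.

Lemma tlift_fun U V W W' (c : W' -> U -> V -> W) t :
  (forall u v, linear (c^~ u ^~ v)) -> linear (fun w => tlift (c w) t).
Proof.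
move=> lc a x y; rewrite /tlift scaler_sumr -big_split; apply: eq_bigr => i _ /=.
rewrite scaler_sumr -big_split; apply: eq_bigr => j _ /=.
by rewrite lc scalerDr !scalerA mulrC.
Qed.

Lemma tlift_tmap U V U' V' W (b : U' -> V' -> W) (f : U -> U') (g : V -> V') t :
  bilin b -> tlift b (tmap f g t) = tlift (fun u v => b (f u) (g v)) t.
Proof.
move=> bb; rewrite (tlift_comp _ (@tlift_linear _ _ _ b)).
by apply: eq_tlift => u v; rewrite tliftE.
Qed.

Lemma tmapE U V U' V' (f : U -> U') (g : V -> V') u v :
  linear f -> linear g -> tmap f g (tpure u v) = tpure (f u) (g v).
Proof.
move=> lf lg; have [pl pr] := tpure_bilin U' V'.
by rewrite /tmap tliftE //; split=> [w|w] a x y; rewrite ?lf ?lg ?pl ?pr.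
Qed.

Lemma tmap_linear U V U' V' (f : U -> U') (g : V -> V') : linear (tmap f g).
Proof. exact: tlift_linear. Qed.

Lemma tassoc_linear U V W : linear (@tassoc k U V W).
Proof. exact: tlift_linear. Qed.

Lemma tassocE U V W (u : U) (v : V) (w : W) :
  tassoc (tpure (tpure u v) w) = tpure u (tpure v w).
Proof.
have [pl pr] := tpure_bilin V W; have [ql qr] := tpure_bilin U (tens V W).
rewrite /tassoc tliftE; last first.
  split=> [y|t]; first exact: tlift_linear.
  by apply: tlift_fun => x y a z z'; rewrite pr qr.
by rewrite tliftE //; split=> [y|x] a z z'; rewrite ?pl ?pr ?ql ?qr.
Qed.

Lemma tens_sep U V (I J : Type) (f : I -> U -> k^o) (g : J -> V -> k^o) :
    (forall i, linear (f i)) -> (forall j, linear (g j)) ->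
    (forall u, (forall i, f i u = 0) -> u = 0) ->
    (forall v, (forall j, g j v = 0) -> v = 0) ->
  forall s t : tens U V,
  (forall i j, tlift (fun u v => f i u * g j v : k^o) s =
               tlift (fun u v => f i u * g j v : k^o) t) -> s = t.
Proof.
move=> lf lg sf sg s t st; apply/eqP; rewrite -subr_eq0; set d := s - t.
have dE i j : tlift (fun u v => f i u * g j v : k^o) d = 0.
  by rewrite /d addrC -scaleN1r tlift_linear st scaleN1r addNr.
suff d0 i j : (d : 'M[k]_(_, _)) i j = 0.
  by apply/eqP/matrixP=> i j; rewrite d0 mxE.
have fU := basis_free (vbasisP {:U}); have fV := basis_free (vbasisP {:V}).
have dV i' : \sum_j' (d : 'M[k]_(_, _)) i' j' *: (vbasis {:V})`_j' = 0.
  apply: sg => y; move: i'.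
  pose c i : k := g y (\sum_j' (d : 'M[k]_(_, _)) i j' *: (vbasis {:V})`_j').
  suff: \sum_i' c i' *: (vbasis {:U})`_i' = 0 by move/freeP: fU; apply.
  apply: sf => x; rewrite {}/c.
  rewrite -[RHS](dE x y) (linear_sum' (lf x)); apply: eq_bigr => i' _.
  rewrite (linearZ' (lf x)) (linear_sum' (lg y)) [_ *: _]mulrC mulr_sumr.
  apply: eq_bigr => j' _.
  by rewrite (linearZ' (lg y)) ![_ *: _]/(_ * _) mulrCA.
by move/freeP: fV => /(_ _ (dV i)).
Qed.

End TensTheory.

HB.mixin Record Falgebra_isHopf (k : fieldType) H of Falgebra k H := {
  comul : 'Hom(H, tens H H);
  counit : 'Hom(H, k^o);
  antipode : 'Hom(H, H);
  comulA : forall h : H,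
    tassoc (tmap comul idfun (comul h)) = tmap idfun comul (comul h);
  counitl : forall h : H, tlift (fun a b : H => counit a *: b) (comul h) = h;
  counitr : forall h : H, tlift (fun a b : H => counit b *: a) (comul h) = h;
  comul1 : comul 1 = tpure 1 1;
  comulM : forall g h : H, comul (g * h) = tmul (comul g) (comul h);
  counit1 : counit 1 = 1;
  counitM : forall g h : H, counit (g * h) = counit g * counit h;
  antipodel : forall h : H,
    tlift (fun a b : H => antipode a * b) (comul h) = counit h *: 1;
  antipoder : forall h : H,
    tlift (fun a b : H => a * antipode b) (comul h) = counit h *: 1 }.

#[short(type="hopfType")]
HB.structure Definition Hopf (k : fieldType) :=
  { H of Falgebra k H & Falgebra_isHopf k H }.

Section AlgebraTheory.
Variable k : fieldType.

Lemma mul_bilin (A : falgType k) : bilin (fun a b : A => a * b).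
Proof.
split=> [v a x y|u a x y]; first by rewrite mulrDl scalerAl.
by rewrite mulrDr scalerAr.
Qed.

Lemma tmulE (A B : falgType k) (a c : A) (b d : B) :
  tmul (tpure a b) (tpure c d) = tpure (a * c) (b * d).
Proof.
have [pl pr] := @tpure_bilin k A B; have [ml mr] := mul_bilin A.
have [nl nr] := mul_bilin B.
rewrite /tmul tliftE; last first.
  split=> [v|u]; apply: tlift_fun => x y e s t /=.
    by rewrite mulrDl -scalerAl pl.
  by rewrite mulrDl -scalerAl pr.
rewrite tliftE //; split=> [v|u] e s t; first by rewrite mulrDr -scalerAr pl.
by rewrite mulrDr -scalerAr pr.
Qed.

Lemma tmul_bilin (A B : falgType k) : bilin (@tmul k A B).
Proof.
split=> [t|s]; first exact: tlift_linear.
by apply: tlift_fun => a b; exact: tlift_linear.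
Qed.

End AlgebraTheory.

Section GroundField.
Variable k : fieldType.

Definition ground_comul (c : k^o) : tens k^o k^o := c *: tpure (1 : k^o) (1 : k^o).

Fact ground_comul_linear : linear ground_comul.
Proof. by move=> a x y; rewrite /ground_comul scalerDl scalerA. Qed.
HB.instance Definition _ :=
  GRing.isLinear.Build k k^o (tens k^o k^o) _ ground_comul ground_comul_linear.

Let D := linfun ground_comul.
Let E : 'Hom(k^o, k^o) := \1%VF.

Let DE c : D c = c *: tpure (1 : k^o) (1 : k^o).
Proof. by rewrite lfunE. Qed.
Let D1 : D 1 = tpure (1 : k^o) (1 : k^o).
Proof. by rewrite DE scale1r. Qed.
Let EE c : E c = c.
Proof. by rewrite lfunE. Qed.

Let lin1 (W : vectType k) (f g : k^o -> W) :
  linear f -> linear g -> f 1 = g 1 -> f =1 g.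
Proof.
by move=> lf lg e x; rewrite -[x]mulr1 (linearZ' lf) (linearZ' lg) e.
Qed.

Fact ground_comulA c : tassoc (tmap D idfun (D c)) = tmap idfun D (D c).
Proof.
rewrite DE !(linearZ' (@tmap_linear _ _ _ _ _ _ _)) !tmapE ?D1;
  rewrite ?(linearZ' (@tassoc_linear _ _ _ _)) ?tassocE //; exact: linearP.
Qed.

Let tlift1 (W : vectType k) (b : k^o -> k^o -> W) c :
  bilin b -> tlift b (D c) = c *: b 1 1.
Proof. by move=> bb; rewrite DE (linearZ' (tlift_linear _)) tliftE. Qed.

Fact ground_counitl (c : k^o) : tlift (fun a b : k^o => E a *: b) (D c) = c.
Proof.
rewrite tlift1 ?EE ?scale1r; first by rewrite [_ *: _]mulr1.
by split=> [v|u] a x y; rewrite ?EE ?linearP // scalerDl scalerA.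
Qed.

Fact ground_counitr (c : k^o) : tlift (fun a b : k^o => E b *: a) (D c) = c.
Proof.
rewrite tlift1 ?EE ?scale1r; first by rewrite [_ *: _]mulr1.
by split=> [v|u] a x y; rewrite ?EE ?linearP // scalerDl scalerA.
Qed.

Fact ground_comul1 : D 1 = tpure (1 : k^o) (1 : k^o).
Proof. exact: D1. Qed.

Fact ground_comulM (c d : k^o) : D (c * d) = tmul (D c) (D d).
Proof.
have [tl tr] := @tmul_bilin k k^o k^o.
by rewrite !DE (linearZ' (tl _)) (linearZ' (tr _)) tmulE !mulr1 scalerA.
Qed.

Fact ground_counit1 : E 1 = 1.
Proof. exact: EE. Qed.

Fact ground_counitM (c d : k^o) : E (c * d) = E c * E d.
Proof. by rewrite !EE. Qed.

Fact ground_antipodel (c : k^o) :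
  tlift (fun a b : k^o => E a * b) (D c) = E c *: (1 : k^o).
Proof.
rewrite tlift1 ?EE ?mulr1 //; have [ml mr] := @mul_bilin k k^o.
by split=> [v|u] a x y; rewrite ?EE ?ml ?mr.
Qed.

Fact ground_antipoder (c : k^o) :
  tlift (fun a b : k^o => a * E b) (D c) = E c *: (1 : k^o).
Proof.
rewrite tlift1 ?EE ?mulr1 //; have [ml mr] := @mul_bilin k k^o.
by split=> [v|u] a x y; rewrite ?EE ?ml ?mr.
Qed.

HB.instance Definition _ := Falgebra_isHopf.Build k k^o
  ground_comulA ground_counitl ground_counitr ground_comul1 ground_comulM
  ground_counit1 ground_counitM ground_antipodel ground_antipoder.

End GroundField.

Definition hdual (k : fieldType) (H : hopfType k) : Type := 'Hom(H, k^o).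

HB.instance Definition _ (k : fieldType) (H : hopfType k) :=
  Vector.on (hdual H).

Section Dual.
Variables (k : fieldType) (H : hopfType k).
Local Notation "H ^*" := (hdual H).
Implicit Types (f g : H^*) (a b h : H).

Let ev f a : k^o := (f : 'Hom(H, k^o)) a.

Let evl f : linear (ev f). Proof. exact: linearP. Qed.
Let evr a : linear (ev^~ a).
Proof. by move=> c f g; rewrite /ev add_lfunE scale_lfunE. Qed.
Let evP f g : (forall a, ev f a = ev g a) -> f = g.
Proof. by move=> fg; apply/lfunP. Qed.

Definition dual_mul_fun f g (h : H) : k^o :=
  tlift (fun a b => (f : 'Hom(H, k^o)) a * (g : 'Hom(H, k^o)) b : k^o) (comul h).

Fact dual_mul_fun_linear f g : linear (dual_mul_fun f g).
Proof. by move=> a x y; rewrite /dual_mul_fun linearP tlift_linear. Qed.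

HB.instance Definition _ f g :=
  GRing.isLinear.Build k H k^o _ (dual_mul_fun f g) (dual_mul_fun_linear f g).

Definition dual_mul f g : H^* := linfun (dual_mul_fun f g).
Definition dual_one : H^* := @counit k H.

Let mulb f g : bilin (fun a b => ev f a * ev g b : k^o).
Proof.
split=> [v|u] a x y; rewrite evl; first by rewrite mulrDl -mulrA.
by rewrite mulrDr mulrCA.
Qed.

Let mulE f g h : ev (dual_mul f g) h = 
  tlift (fun a b => ev f a * ev g b : k^o) (comul h).
Proof. by rewrite /ev lfunE. Qed.

Fact dual_mulA : associative dual_mul.
Proof.
move=> f g h; apply: evP => x; rewrite !mulE.
have mb := @mul_bilin k k^o; have [ml mr] := mb.
transitivity (tlift (fun a t => ev f a *
    tlift (fun b c => ev g b * ev h c : k^o) t : k^o)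
    (tmap idfun comul (comul x))).
  rewrite tlift_tmap; first by apply: eq_tlift => a b; rewrite mulE.
  split=> [v|u] a s t; first by rewrite evl ml.
  by rewrite tlift_linear mr.
rewrite -comulA.
transitivity (tlift (fun t c =>
    tlift (fun a b => ev f a * ev g b : k^o) t * ev h c : k^o)
    (tmap comul idfun (comul x))); last first.
  rewrite tlift_tmap; first by apply: eq_tlift => a b; rewrite mulE.
  split=> [v|u] a s t; last by rewrite evl mr.
  by rewrite tlift_linear ml.
move: (tmap _ _ _); apply: tens_ext.
- by move=> a s t; rewrite tassoc_linear tlift_linear.
- exact: tlift_linear.
move=> t c; move: t; apply: tens_ext.
- by move=> a s t; rewrite (tpure_bilin _ _).1 tassoc_linear tlift_linear.
- by move=> a s t; rewrite (tpure_bilin _ _).1 tlift_linear.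
move=> a b; rewrite tassocE !tliftE ?mulrA //.
- by split=> [v|u] e s t; rewrite ?evl ?tlift_linear ?ml ?mr.
- by split=> [v|u] e s t; rewrite ?evl ?tlift_linear ?ml ?mr.
Qed.

Fact dual_mul1f : left_id dual_one dual_mul.
Proof.
move=> f; apply: evP => h; rewrite mulE -[h in RHS]counitl.
rewrite (tlift_comp _ (evl f)); apply: eq_tlift => a b.
by rewrite (linearZ' (evl f)).
Qed.

Fact dual_mulf1 : right_id dual_one dual_mul.
Proof.
move=> f; apply: evP => h; rewrite mulE -[h in RHS]counitr.
rewrite (tlift_comp _ (evl f)); apply: eq_tlift => a b.
by rewrite (linearZ' (evl f)) mulrC.
Qed.

Fact dual_mulDl : left_distributive dual_mul +%R.
Proof.
move=> f g h; apply: evP => x; rewrite mulE (linearD' (evr x)) !mulE.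
have [ml mr] := @mul_bilin k k^o.
have l : linear (fun f => tlift (fun a b => ev f a * ev h b : k^o) (comul x)).
  by apply: tlift_fun => a b e s t; rewrite evr ml.
exact: (linearD' l).
Qed.

Fact dual_mulDr : right_distributive dual_mul +%R.
Proof.
move=> h f g; apply: evP => x; rewrite mulE (linearD' (evr x)) !mulE.
have [ml mr] := @mul_bilin k k^o.
have l : linear (fun f => tlift (fun a b => ev h a * ev f b : k^o) (comul x)).
  by apply: tlift_fun => a b e s t; rewrite evr mr.
exact: (linearD' l).
Qed.

Fact dual_oner_neq0 : dual_one != 0.
Proof.
apply/eqP=> /lfunP/(_ 1); rewrite counit1 lfunE /= => /eqP.
by rewrite oner_eq0.
Qed.

HB.instance Definition _ := GRing.Zmodule_isNzRing.Build H^*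
  dual_mulA dual_mul1f dual_mulf1 dual_mulDl dual_mulDr dual_oner_neq0.

Fact dual_scaleAl (c : k) (f g : H^*) : c *: (f * g) = (c *: f) * g.
Proof.
apply: evP => x; rewrite (linearZ' (evr x)) !mulE.
have [ml mr] := @mul_bilin k k^o.
have l : linear (fun f => tlift (fun a b => ev f a * ev g b : k^o) (comul x)).
  by apply: tlift_fun => a b e s t; rewrite evr ml.
by rewrite (linearZ' l).
Qed.

HB.instance Definition _ := GRing.Lmodule_isLalgebra.Build k H^* dual_scaleAl.

Fact dual_scaleAr (c : k) (f g : H^*) : c *: (f * g) = f * (c *: g).
Proof.
apply: evP => x; rewrite (linearZ' (evr x)) !mulE.
have [ml mr] := @mul_bilin k k^o.
have l : linear (fun g => tlift (fun a b => ev f a * ev g b : k^o) (comul x)).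
  by apply: tlift_fun => a b e s t; rewrite evr mr.
by rewrite (linearZ' l).
Qed.

HB.instance Definition _ := GRing.Lalgebra_isAlgebra.Build k H^* dual_scaleAr.
HB.instance Definition _ := Algebra_isFalgebra.Build k H^*.

Let mulE' f g h : ev (f * g) h =
  tlift (fun a b => ev f a * ev g b : k^o) (comul h).
Proof. exact: mulE. Qed.

(* [dual_basis i] is the [i]-th coordinate form, so that [dual_comul f] is the
   tensor with value [f (a * b)] at [a ⊗ b]; see [dual_comulE]. *)
Definition dual_basis (i : 'I_(\dim {:H})) : H^* :=
  linfun (coord (vbasis {:H}) i : H -> k^o).

Definition dual_comul_fun (f : H^*) : tens H^* H^* :=
  \sum_(i < \dim {:H}) \sum_(j < \dim {:H})
    (f : 'Hom(H, k^o)) ((vbasis {:H})`_i * (vbasis {:H})`_j) *: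
    tpure (dual_basis i) (dual_basis j).

Fact dual_comul_fun_linear : linear dual_comul_fun.
Proof.
move=> a f g; rewrite /dual_comul_fun scaler_sumr -big_split.
apply: eq_bigr => i _ /=; rewrite scaler_sumr -big_split.
by apply: eq_bigr => j _ /=; rewrite [fun_of_lfun _ _]evr scalerDl scalerA.
Qed.
HB.instance Definition _ :=
  GRing.isLinear.Build k H^* (tens H^* H^*) _ dual_comul_fun dual_comul_fun_linear.

Definition dual_comul : 'Hom(H^*, tens H^* H^*) := linfun dual_comul_fun.

Definition dual_counit_fun (f : H^*) : k^o := (f : 'Hom(H, k^o)) 1.

Fact dual_counit_fun_linear : linear dual_counit_fun.
Proof. exact: evr. Qed.
HB.instance Definition _ :=
  GRing.isLinear.Build k H^* k^o _ dual_counit_fun dual_counit_fun_linear.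

Definition dual_counit : 'Hom(H^*, k^o) := linfun dual_counit_fun.

Definition dual_antipode_fun (f : H^*) : H^* :=
  ((f : 'Hom(H, k^o)) \o antipode)%VF.

Let antE f a : ev (dual_antipode_fun f) a = ev f (antipode a).
Proof. by rewrite /ev /dual_antipode_fun comp_lfunE. Qed.

Fact dual_antipode_fun_linear : linear dual_antipode_fun.
Proof. by move=> c f g; apply: evP => a; rewrite evr !antE evr. Qed.
HB.instance Definition _ :=
  GRing.isLinear.Build k H^* H^* _ dual_antipode_fun dual_antipode_fun_linear.

Definition dual_antipode : 'Hom(H^*, H^*) := linfun dual_antipode_fun.

Let pair (t : tens H^* H^*) a b : k^o := tlift (fun f g => ev f a * ev g b : k^o) t.

Let pair_linear a b : linear (fun t => pair t a b).
Proof. exact: tlift_linear. Qed.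

Let evb a b : bilin (fun f g => ev f a * ev g b : k^o).
Proof. by have [ml mr] := @mul_bilin k k^o; split=> [v|u] e s t; rewrite evr ?ml ?mr. Qed.

Let pair_pure f g a b : pair (tpure f g) a b = ev f a * ev g b.
Proof. by rewrite /pair tliftE //; exact: evb. Qed.

Let ev_mulb f : bilin (fun a b => ev f (a * b)).
Proof.
by have [ml mr] := @mul_bilin k H; split=> [v|u] e s t; rewrite ?ml ?mr evl.
Qed.

Lemma dual_comulE (f : H^*) (a b : H) :
  tlift (fun g h : H^* => (g : 'Hom(H, k^o)) a * (h : 'Hom(H, k^o)) b : k^o)
    (dual_comul f) = (f : 'Hom(H, k^o)) (a * b).
Proof.
rewrite -[LHS]/(pair _ a b) -[RHS]/(ev f _) -(tliftE (ev_mulb f)).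
rewrite lfunE /= /dual_comul_fun (linear_sum' (pair_linear a b)).
apply: eq_bigr => i _; rewrite (linear_sum' (pair_linear a b)).
apply: eq_bigr => j _; rewrite (linearZ' (pair_linear a b)) pair_pure.
by rewrite mxE [RHS]mulrC /ev /dual_basis !lfunE.
Qed.

Let comulE f a b : pair (dual_comul f) a b = ev f (a * b).
Proof. exact: dual_comulE. Qed.

Let ev_sep f : (forall a, ev f a = 0) -> f = 0.
Proof. by move=> f0; apply: evP => a; rewrite f0 (linear0' (evr a)). Qed.

Let pairP s t : (forall a b, pair s a b = pair t a b) -> s = t.
Proof.
move=> st; exact: (@tens_sep _ _ _ _ _ (fun a f => ev f a)
  (fun a f => ev f a) evr evr ev_sep ev_sep).
Qed.

Fact dual_comulA (f : H^*) : tassoc (tmap dual_comul idfun (dual_comul f)) =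
  tmap idfun dual_comul (dual_comul f).
Proof.
have [ml mr] := @mul_bilin k k^o.
apply: (@tens_sep _ _ _ _ _ (fun a f => ev f a)
  (fun ab t => pair t ab.1 ab.2) evr _ ev_sep).
- by move=> ab; exact: pair_linear.
- by move=> t t0; apply: pairP => a b; rewrite (t0 (a, b)) (linear0' (pair_linear a b)).
move=> a [b c] /=.
transitivity (tlift (fun t (h' : H^*) => pair t a b * ev h' c : k^o)
   (tmap dual_comul idfun (dual_comul f))).
  move: (tmap _ _ _); apply: tens_ext.
  - by move=> e s t; rewrite tassoc_linear tlift_linear.
  - exact: tlift_linear.
  move=> t g''; move: t; apply: tens_ext.
  - by move=> e s t; rewrite (tpure_bilin _ _).1 tassoc_linear tlift_linear.
  - by move=> e s t; rewrite (tpure_bilin _ _).1 tlift_linear.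
  move=> g g'; rewrite tassocE !tliftE ?pair_pure ?mulrA //.
  - by split=> [v|u] e s t; rewrite ?evr ?pair_linear ?ml ?mr.
  - by split=> [v|u] e s t; rewrite ?evr ?pair_linear ?ml ?mr.
rewrite !tlift_tmap; last 2 first.
- by split=> [v|u] e s t; rewrite ?evr ?pair_linear ?ml ?mr.
- by split=> [v|u] e s t; rewrite ?evr ?pair_linear ?ml ?mr.
under eq_tlift => g g' do rewrite comulE.
under [RHS]eq_tlift => g g' do rewrite comulE.
by rewrite -!/(pair _ _ _) !comulE mulrA.
Qed.

Let counitE f : dual_counit f = ev f 1.
Proof. by rewrite lfunE. Qed.

Fact dual_counitl (f : H^*) :
  tlift (fun g h : H^* => dual_counit g *: h) (dual_comul f) = f.
Proof.
apply: evP => a; rewrite (tlift_comp _ (evr a)) -[in RHS](mul1r a) -comulE.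
by apply: eq_tlift => g h; rewrite (linearZ' (evr a)) counitE.
Qed.

Fact dual_counitr (f : H^*) :
  tlift (fun g h : H^* => dual_counit h *: g) (dual_comul f) = f.
Proof.
apply: evP => a; rewrite (tlift_comp _ (evr a)) -[in RHS](mulr1 a) -comulE.
by apply: eq_tlift => g h; rewrite (linearZ' (evr a)) counitE mulrC.
Qed.

Fact dual_comul1 : dual_comul 1 = tpure (1 : H^*) (1 : H^*).
Proof. by apply: pairP => a b; rewrite comulE pair_pure; exact: counitM. Qed.

Fact dual_comulM (f g : H^*) : dual_comul (f * g) = tmul (dual_comul f) (dual_comul g).
Proof.
have [ml mr] := @mul_bilin k k^o.
apply: pairP => a b; rewrite comulE mulE' comulM.
transitivity (tlift (fun x x' => tlift (fun y y' =>
    pair (dual_comul f) x y * pair (dual_comul g) x' y' : k^o) (comul b)) (comul a)).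
  rewrite /tmul (tlift_comp _ (@tlift_linear _ _ _ _ _)); apply: eq_tlift => x x'.
  rewrite (tlift_comp _ (@tlift_linear _ _ _ _ _)); apply: eq_tlift => y y'.
  by rewrite tliftE ?comulE //; exact: mulb.
move: (dual_comul f) (dual_comul g) => s t.
move: s; apply: tens_ext.
- apply: tlift_fun => x x'; apply: tlift_fun => y y' e s s'.
  by rewrite pair_linear ml.
- by move=> e s s'; rewrite (tmul_bilin _ _).1 pair_linear.
move=> f1 f2; move: t; apply: tens_ext.
- apply: tlift_fun => x x'; apply: tlift_fun => y y' e s s'.
  by rewrite pair_linear mr.
- by move=> e s s'; rewrite (tmul_bilin _ _).2 pair_linear.
move=> g1 g2; rewrite tmulE pair_pure !mulE'.
rewrite [RHS](tlift_comp _ (ml _)); apply: eq_tlift => x x'.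
rewrite [RHS](tlift_comp _ (mr _)); apply: eq_tlift => y y'.
by rewrite !pair_pure mulrACA.
Qed.

Fact dual_counit1 : dual_counit 1 = 1.
Proof. by rewrite counitE; exact: counit1. Qed.

Fact dual_counitM (f g : H^*) : dual_counit (f * g) = dual_counit f * dual_counit g.
Proof. by rewrite !counitE mulE' comul1 tliftE //; exact: mulb. Qed.

Fact dual_antipodel (f : H^*) :
  tlift (fun g h : H^* => dual_antipode g * h) (dual_comul f) = dual_counit f *: 1.
Proof.
apply: evP => a; rewrite (tlift_comp _ (evr a)) (linearZ' (evr a)).
have -> : ev 1 a = counit a by [].
under eq_tlift => g h do rewrite mulE' lfunE.
rewrite exchange_tlift.
under eq_tlift => b c do under eq_tlift => g h do rewrite antE.
under eq_tlift => b c do rewrite -/(pair _ _ _) comulE.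
rewrite -(tlift_comp _ (evl f)) antipodel (linearZ' (evl f)) counitE.
by rewrite [RHS]mulrC.
Qed.

Fact dual_antipoder (f : H^*) :
  tlift (fun g h : H^* => g * dual_antipode h) (dual_comul f) = dual_counit f *: 1.
Proof.
apply: evP => a; rewrite (tlift_comp _ (evr a)) (linearZ' (evr a)).
have -> : ev 1 a = counit a by [].
under eq_tlift => g h do rewrite mulE' lfunE.
rewrite exchange_tlift.
under eq_tlift => b c do under eq_tlift => g h do rewrite antE.
under eq_tlift => b c do rewrite -/(pair _ _ _) comulE.
rewrite -(tlift_comp _ (evl f)) antipoder (linearZ' (evl f)) counitE.
by rewrite [RHS]mulrC.
Qed.

HB.instance Definition _ := Falgebra_isHopf.Build k H^*
  dual_comulA dual_counitl dual_counitr dual_comul1 dual_comulM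
  dual_counit1 dual_counitM dual_antipodel dual_antipoder.

End Dual.

Definition galg (k : fieldType) (gT : finGroupType) : Type := {ffun gT -> k^o}.

HB.instance Definition _ (k : fieldType) (gT : finGroupType) :=
  Vector.on (galg k gT).

Section GroupAlgebra.
Variables (k : fieldType) (gT : finGroupType).
Local Notation kG := (galg k gT).
Implicit Types (a b c : kG) (g h : gT).

Let ev a g : k^o := (a : {ffun gT -> k^o}) g.
Let evl g : linear (ev^~ g).
Proof. by move=> e a b; rewrite /ev !ffunE. Qed.
Let evP a b : (forall g, ev a g = ev b g) -> a = b.
Proof. by move=> ab; apply/ffunP. Qed.

Definition gdelta (g : gT) : kG := [ffun h : gT => (h == g)%:R : k^o].

Definition galg_mul a b : kG :=
  [ffun g : gT => \sum_(h : gT) ev a h * ev b (h^-1 * g)%g : k^o].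

Let deltaE g h : ev (gdelta g) h = (h == g)%:R.
Proof. by rewrite /ev ffunE. Qed.

Let galg_sum a : a = \sum_g ev a g *: gdelta g.
Proof.
apply: evP => h; rewrite (linear_sum' (evl h)) (bigD1 h) //=.
rewrite (linearZ' (evl h)) deltaE eqxx [_ *: _]mulr1 big1 ?addr0 // => g ng.
by rewrite (linearZ' (evl h)) deltaE eq_sym (negPf ng) scaler0.
Qed.

Let galg_ext (W : vectType k) (f1 f2 : kG -> W) :
  linear f1 -> linear f2 -> (forall g, f1 (gdelta g) = f2 (gdelta g)) ->
  f1 =1 f2.
Proof.
move=> l1 l2 e a; rewrite (galg_sum a) (linear_sum' l1) (linear_sum' l2).
by apply: eq_bigr => g _; rewrite (linearZ' l1) (linearZ' l2) e.
Qed.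

Let mul_bil : bilin galg_mul.
Proof.
split=> [b|a] e x y; apply: evP => g; rewrite evl /ev !ffunE.
  rewrite scaler_sumr -big_split; apply: eq_bigr => h _ /=.
  by rewrite [_ h]evl mulrDl scalerAl.
rewrite scaler_sumr -big_split; apply: eq_bigr => h _ /=.
by rewrite [_ (_ * _)%g in LHS]evl mulrDr scalerAr.
Qed.

Lemma galg_mul_delta g h : galg_mul (gdelta g) (gdelta h) = gdelta (g * h)%g.
Proof.
apply: evP => x; rewrite deltaE /ev ffunE (bigD1 g) //= !deltaE eqxx mul1r.
rewrite big1 ?addr0 => [|y /negPf ny]; last by rewrite deltaE ny mul0r.
by rewrite -(inj_eq (mulgI g)) mulKVg.
Qed.

Let ml b : linear (galg_mul^~ b). Proof. exact: mul_bil.1. Qed.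
Let mr a : linear (galg_mul a). Proof. exact: mul_bil.2. Qed.

Fact galg_mulA : associative galg_mul.
Proof.
move=> a b c; move: a; apply: galg_ext => [||x]; first exact: ml.
  by move=> e s t; rewrite !ml.
move: b; apply: galg_ext => [e s t|e s t|y]; rewrite ?ml ?mr ?ml //.
move: c; apply: galg_ext => [e s t|e s t|z]; rewrite ?mr //.
by rewrite !galg_mul_delta mulgA.
Qed.

Fact galg_mul1 : left_id (gdelta 1%g) galg_mul.
Proof.
by apply: galg_ext => [||x]; [exact: mr|move=> ?|rewrite galg_mul_delta mul1g].
Qed.

Fact galg_mulr1 : right_id (gdelta 1%g) galg_mul.
Proof.
by apply: galg_ext => [||x]; [exact: ml|move=> ?|rewrite galg_mul_delta mulg1].
Qed.

Fact galg_mulDl : left_distributive galg_mul +%R.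
Proof. by move=> a b c; exact: linearD' (ml c) a b. Qed.

Fact galg_mulDr : right_distributive galg_mul +%R.
Proof. by move=> a b c; exact: linearD' (mr a) b c. Qed.

Fact galg_oner_neq0 : gdelta 1%g != 0.
Proof.
apply/eqP=> /(congr1 (ev^~ 1%g)); rewrite /= deltaE eqxx (linear0' (evl _)).
by move/eqP; rewrite oner_eq0.
Qed.

HB.instance Definition _ := GRing.Zmodule_isNzRing.Build kG
  galg_mulA galg_mul1 galg_mulr1 galg_mulDl galg_mulDr galg_oner_neq0.

Fact galg_scaleAl (e : k) (a b : kG) : e *: (a * b) = (e *: a) * b.
Proof. by rewrite [RHS](linearZ' (ml b)). Qed.
HB.instance Definition _ := GRing.Lmodule_isLalgebra.Build k kG galg_scaleAl.

Fact galg_scaleAr (e : k) (a b : kG) : e *: (a * b) = a * (e *: b).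
Proof. by rewrite [RHS](linearZ' (mr a)). Qed.
HB.instance Definition _ := GRing.Lalgebra_isAlgebra.Build k kG galg_scaleAr.
HB.instance Definition _ := Algebra_isFalgebra.Build k kG.

Definition galg_comul_fun (a : kG) : tens kG kG :=
  \sum_(g : gT) (a : {ffun gT -> k^o}) g *: tpure (gdelta g) (gdelta g).
Definition galg_counit_fun (a : kG) : k^o :=
  \sum_(g : gT) (a : {ffun gT -> k^o}) g.
Definition galg_antipode_fun (a : kG) : kG :=
  [ffun g : gT => (a : {ffun gT -> k^o}) g^-1%g].

Fact galg_comul_linear : linear galg_comul_fun.
Proof.
move=> e a b; rewrite /galg_comul_fun scaler_sumr -big_split.
by apply: eq_bigr => g _ /=; rewrite [_ g]evl scalerDl scalerA.
Qed.
HB.instance Definition _ := GRing.isLinear.Build k kG (tens kG kG) _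
  galg_comul_fun galg_comul_linear.

Fact galg_counit_linear : linear galg_counit_fun.
Proof.
move=> e a b; rewrite /galg_counit_fun scaler_sumr -big_split.
by apply: eq_bigr => g _ /=; rewrite [_ g]evl.
Qed.
HB.instance Definition _ := GRing.isLinear.Build k kG k^o _
  galg_counit_fun galg_counit_linear.

Fact galg_antipode_linear : linear galg_antipode_fun.
Proof. by move=> e a b; apply: evP => g; rewrite /ev !ffunE. Qed.
HB.instance Definition _ := GRing.isLinear.Build k kG kG _
  galg_antipode_fun galg_antipode_linear.

Definition galg_comul : 'Hom(kG, tens kG kG) := linfun galg_comul_fun.
Definition galg_counit : 'Hom(kG, k^o) := linfun galg_counit_fun.
Definition galg_antipode : 'Hom(kG, kG) := linfun galg_antipode_fun.

Lemma galg_comul_delta g : galg_comul (gdelta g) = tpure (gdelta g) (gdelta g).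
Proof.
rewrite lfunE /= /galg_comul_fun (bigD1 g) //= [_ g]deltaE eqxx scale1r.
by rewrite big1 ?addr0 // => h /negPf nh; rewrite [_ h]deltaE nh scale0r.
Qed.

Lemma galg_counit_delta g : galg_counit (gdelta g) = 1.
Proof.
rewrite lfunE /= /galg_counit_fun (bigD1 g) //= [_ g]deltaE eqxx.
by rewrite big1 ?addr0 // => h /negPf nh; rewrite [_ h]deltaE nh.
Qed.

Lemma galg_antipode_delta g : galg_antipode (gdelta g) = gdelta g^-1%g.
Proof.
by apply: evP => h; rewrite deltaE lfunE /ev !ffunE (canF_eq invgK).
Qed.

Let mulE g h : gdelta g * gdelta h = gdelta (g * h)%g.
Proof. exact: galg_mul_delta. Qed.

Let Ml b : linear (fun a => a * b). Proof. exact: ml. Qed.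
Let Mr a : linear (fun b => a * b). Proof. exact: mr. Qed.
Let pl b : linear (fun a => tpure a b). Proof. exact: (tpure_bilin _ _).1. Qed.
Let pr a : linear (fun b => tpure a b). Proof. exact: (tpure_bilin _ _).2. Qed.

Fact galg_comulA (a : kG) : tassoc (tmap galg_comul idfun (galg_comul a)) =
  tmap idfun galg_comul (galg_comul a).
Proof.
move: a; apply: galg_ext => [e a b|e a b|g].
- by rewrite linearP tmap_linear tassoc_linear.
- by rewrite linearP tmap_linear.
by rewrite galg_comul_delta !tmapE ?galg_comul_delta ?tassocE //; exact: linearP.
Qed.

Fact galg_counitl (a : kG) :
  tlift (fun b c : kG => galg_counit b *: c) (galg_comul a) = a.
Proof.
move: a; apply: galg_ext => [e a b|e a b|g] //.
  by rewrite linearP tlift_linear.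
rewrite galg_comul_delta tliftE ?galg_counit_delta ?scale1r //.
split=> [v|u] e a b; first by rewrite linearP scalerDl scalerA.
by rewrite scalerDr !scalerA mulrC.
Qed.

Fact galg_counitr (a : kG) :
  tlift (fun b c : kG => galg_counit c *: b) (galg_comul a) = a.
Proof.
move: a; apply: galg_ext => [e a b|e a b|g] //.
  by rewrite linearP tlift_linear.
rewrite galg_comul_delta tliftE ?galg_counit_delta ?scale1r //.
split=> [v|u] e a b; last by rewrite linearP scalerDl scalerA.
by rewrite scalerDr !scalerA mulrC.
Qed.

Fact galg_comul1 : galg_comul 1 = tpure (1 : kG) (1 : kG).
Proof. exact: galg_comul_delta. Qed.

Fact galg_comulM (a b : kG) :
  galg_comul (a * b) = tmul (galg_comul a) (galg_comul b).
Proof.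
have [tl tr] := @tmul_bilin k kG kG.
move: a; apply: galg_ext => [e s t|e s t|g]; rewrite ?Ml ?linearP ?tl //.
move: b; apply: galg_ext => [e s t|e s t|h]; rewrite ?Mr ?linearP ?tr //.
by rewrite mulE !galg_comul_delta tmulE mulE.
Qed.

Fact galg_counit1 : galg_counit 1 = 1.
Proof. exact: galg_counit_delta. Qed.

Fact galg_counitM (a b : kG) :
  galg_counit (a * b) = galg_counit a * galg_counit b.
Proof.
have [nl nr] := @mul_bilin k k^o.
move: a; apply: galg_ext => [e s t|e s t|g]; rewrite ?Ml ?linearP ?nl //.
move: b; apply: galg_ext => [e s t|e s t|h]; rewrite ?Mr ?linearP ?nr //.
by rewrite mulE !galg_counit_delta mulr1.
Qed.

Fact galg_antipodel (a : kG) :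
  tlift (fun b c : kG => galg_antipode b * c) (galg_comul a) =
  galg_counit a *: 1.
Proof.
move: a; apply: galg_ext => [e a b|e a b|g].
- by rewrite linearP tlift_linear.
- by rewrite linearP scalerDl scalerA.
rewrite galg_comul_delta tliftE; last first.
  by split=> [v|u] e a b; rewrite ?linearP ?Ml ?Mr.
by rewrite galg_antipode_delta mulE mulVg galg_counit_delta scale1r.
Qed.

Fact galg_antipoder (a : kG) :
  tlift (fun b c : kG => b * galg_antipode c) (galg_comul a) =
  galg_counit a *: 1.
Proof.
move: a; apply: galg_ext => [e a b|e a b|g].
- by rewrite linearP tlift_linear.
- by rewrite linearP scalerDl scalerA.
rewrite galg_comul_delta tliftE; last first.
  by split=> [v|u] e a b; rewrite ?linearP ?Ml ?Mr.
by rewrite galg_antipode_delta mulE mulgV galg_counit_delta scale1r.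
Qed.

HB.instance Definition _ := Falgebra_isHopf.Build k kG
  galg_comulA galg_counitl galg_counitr galg_comul1 galg_comulM
  galg_counit1 galg_counitM galg_antipodel galg_antipoder.

End GroupAlgebra.

Definition grouplike (k : fieldType) (H : hopfType k) : pred H :=
  fun g => (comul g == tpure g g) && (counit g == 1).

Definition card_grouplike (k : fieldType) (H : hopfType k) (n : nat) : Prop :=
  exists s : seq H, [/\ uniq s, s =i @grouplike k H & size s = n].

(* Every left ideal has a complementary left ideal, i.e. the left regular
   module is semisimple. *)
Definition semisimple_alg (k : fieldType) (A : falgType k) : Prop :=
  forall I : {vspace A}, (({:A} * I)%VS <= I)%VS ->
  exists J : {vspace A},
    [/\ ({:A} * J <= J)%VS, (I + J)%VS = fullv & (I :&: J)%VS = 0%VS].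

(* An element of ['AHom(H, B)] is already a unital algebra morphism. *)
Definition hopf_hom (k : fieldType) (H B : hopfType k) (f : 'AHom(H, B)) : Prop :=
  [/\ forall h : H, comul (f h) = tmap f f (comul h),
      forall h : H, counit (f h) = counit h
    & forall h : H, antipode (f h) = f (antipode h)].

Definition hopf_iso (k : fieldType) (H B : hopfType k) : Prop :=
  exists f : 'AHom(H, B), hopf_hom f /\ bijective f.

Definition trivial_hopf (k : fieldType) (H : hopfType k) : Prop :=
  exists gT : finGroupType,
    hopf_iso H (galg k gT) \/ hopf_iso H (hdual (galg k gT)).

Section Coinvariants.
Variables (k : fieldType) (H B : hopfType k) (pi : 'AHom(H, B)).

Definition rcoinv (h : H) : Prop :=
  tmap idfun pi (comul h) = tpure h (1 : B).

Definition lcoinv (h : H) : Prop :=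
  tmap pi idfun (comul h) = tpure (1 : B) h.

Definition hopf_normal : Prop := forall h : H, rcoinv h <-> lcoinv h.

(* [rcoinv] is a Hopf subalgebra of [H], presented as an embedded Hopf algebra
   [K], and [K] is trivial. *)
Definition trivial_coinv : Prop :=
  exists (K : hopfType k) (iota : 'AHom(K, H)),
    [/\ hopf_hom iota, injective iota,
        forall h : H, rcoinv h <-> exists x : K, iota x = h
      & trivial_hopf K].

End Coinvariants.

(* Both ends of the chain are taken up to isomorphism; the terms [C i] with
   [n < i] are irrelevant padding. *)
Definition upper_semisolvable (k : fieldType) (H : hopfType k) : Prop :=
  exists (n : nat) (C : nat -> hopfType k) (pi : forall i, 'AHom(C i, C i.+1)),
    [/\ hopf_iso H (C 0%N), hopf_iso (C n) k^o
      & forall i, (i < n)%N ->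
          [/\ hopf_hom (pi i), limg (pi i) = fullv, hopf_normal (pi i)
            & trivial_coinv (pi i)]].

(* Main.v *)
(* Write [A] for the dual of [H], [n] for the dimension and [G(A)] for the group-like
   elements of [A]. The proof only uses that every [a] in [H] has a [b] with [a b a = a]
   and that there is an integral [Lam] with [eps Lam = 1]; both follow from semisimplicity
   and pass to quotients.
   The trace of [S^2] is a sum of quotients of roots of unity over the matrix blocks, one
   of which is 1-dimensional, and is nonzero by positivity; hence [S^2 = id] (Larson and
   Radford), and [h |-> h_(1) f(h_(2))] has trace [n f(Lam)]. For a primitive idempotent
   [e] of the character algebra of [H], the number [1 / e(Lam)] is then an eigenvalue of
   an integer matrix, so the dimension [n e(Lam)] of [e A] divides [n] (class equation).
   Let [n = p^a q^c] with [a > 0], [p^a < q] and [|G(A)| = q^c], and decompose the mean of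
   [G(A)] in the character algebra: the summands have dimensions adding up to [p^a] and
   dividing [n], and the integral of [A] is one of them, of dimension 1. So there is
   another summand of dimension 1, which gives a central group-like [x != 1] of [H] on
   which all of [G(A)] takes the value 1. The quotient of [H] by [k<x>] has dimension
   [p^a' q^c] with [a' < a], and its dual has the same group-likes; one concludes by
   induction on [a]. For [a = 0], [H] is the dual of the group algebra of [G(A)]. *)
Require Import Defs.
From HB Require Import structures.
From mathcomp Require Import all_boot all_order all_algebra all_fingroup.
From mathcomp Require Import all_field.
From mathcomp Require Import cyclic separable.

Set Implicit Arguments.
Unset Strict Implicit.
Unset Printing Implicit Defensive.

Import Order.TTheory GRing.Theory Num.Theory.
Local Open Scope ring_scope.

(** * Trace and rank of linear maps *)

(** Radford's formula makes S^4 conjugation by a group-like element, so S^2 has finite order and its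
    trace is a sum of roots of unity. The vanishing of that sum is a polynomial relation with
    integer coefficients in one root of unity, and a resultant with ['X^M - 1] carries it from [k]
    to [algC], where absolute values exist. The class equation makes a similar passage: a rational
    eigenvalue of an integer matrix is an integer.

    Sweedler sums are replaced by comatrices, matrices over [H] that are inverted by applying the
    antipode to their entries; most identities become cancellations of such matrices.

    The element [x] is central because the idempotent that produces it is a class function. The
    group-likes of [A] are the algebra maps from [H] to [k]; as they are 1 on [x] they factor
    through the quotient, and none is lost. Their number divides the dimension, since their mean is
    an idempotent of rank n / |G(A)|; hence only the power of [p] drops in the quotient. *)

Section Traces.
Variables (k : fieldType) (V : vectType k).
Implicit Types f g : V -> V.
Local Notation n := (\dim {:V}).

Definition bas (i : 'I_n) : V := (vbasis {:V})`_i.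
Definition crd (i : 'I_n) : V -> k := coord (vbasis {:V}) i.

Lemma crd_linear i : linear (crd i : V -> k^o).
Proof. exact: linearP. Qed.

Lemma crdZ i (c : k) v : crd i (c *: v) = c * crd i v.
Proof. exact: (linearZ' (@crd_linear i)). Qed.

Lemma crd_sum i (I : finType) (F : I -> V) :
  crd i (\sum_j F j) = \sum_j crd i (F j).
Proof. exact: (linear_sum' (@crd_linear i)). Qed.

Lemma basE v : v = \sum_i crd i v *: bas i.
Proof. exact: vbasisE. Qed.

Lemma crd_bas i j : crd i (bas j) = (i == j)%:R.
Proof. by rewrite /crd /bas [LHS](coord_vbasis_delta i j). Qed.

Lemma crdP u v : (forall i, crd i u = crd i v) -> u = v.
Proof. by move=> uv; rewrite (basE u) (basE v); apply: eq_bigr => i _; rewrite uv. Qed.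

Lemma bas_ext (W : vectType k) (f g : V -> W) : linear f -> linear g ->
  (forall i, f (bas i) = g (bas i)) -> f =1 g.
Proof.
move=> lf lg fg v; rewrite (basE v) (linear_sum' lf) (linear_sum' lg).
by apply: eq_bigr => i _; rewrite (linearZ' lf) (linearZ' lg) fg.
Qed.

Definition mxf f : 'M[k]_n := \matrix_(i, j) crd j (f (bas i)).
Definition lintr f : k := \tr (mxf f).
Definition rk f : nat := \rank (mxf f).

Lemma lintrE f : lintr f = \sum_i crd i (f (bas i)).
Proof. by apply: eq_bigr => i _; rewrite mxE. Qed.

Lemma eq_mxf f g : f =1 g -> mxf f = mxf g.
Proof. by move=> fg; apply/matrixP=> i j; rewrite !mxE fg. Qed.

Lemma eq_lintr f g : f =1 g -> lintr f = lintr g.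
Proof. by move=> fg; rewrite /lintr (eq_mxf fg). Qed.

Lemma mxf_inj f g : linear f -> linear g -> mxf f = mxf g -> f =1 g.
Proof.
move=> lf lg /matrixP fg; apply: bas_ext => // i; apply: crdP => j.
by have := fg i j; rewrite !mxE.
Qed.

Lemma mxf_comp f g : linear g -> mxf (g \o f) = mxf f *m mxf g.
Proof.
move=> lg; apply/matrixP=> i j; rewrite !mxE /= [f _]basE (linear_sum' lg).
rewrite (linear_sum' (@crd_linear j)); apply: eq_bigr => l _.
by rewrite (linearZ' lg) (linearZ' (@crd_linear j)) !mxE.
Qed.

Lemma mxf_id : mxf id = 1%:M.
Proof. by apply/matrixP=> i j; rewrite !mxE crd_bas eq_sym. Qed.

Lemma lintr_id : lintr id = n%:R.
Proof. by rewrite /lintr mxf_id mxtrace1. Qed.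

Lemma lintr_linear (c : k) f g : lintr (fun v => c *: f v + g v) = c * lintr f + lintr g.
Proof.
rewrite !lintrE mulr_sumr -big_split; apply: eq_bigr => i _.
by rewrite crd_linear.
Qed.

Lemma lintrZ (c : k) f : lintr (fun v => c *: f v) = c * lintr f.
Proof.
rewrite !lintrE mulr_sumr; apply: eq_bigr => i _.
by rewrite (linearZ' (@crd_linear i)).
Qed.

Lemma lintr_sum (I : finType) (P : pred I) (F : I -> V -> V) :
  lintr (fun v => \sum_(i | P i) F i v) = \sum_(i | P i) lintr (F i).
Proof.
under [RHS]eq_bigr => i _ do rewrite lintrE.
rewrite lintrE [RHS]exchange_big; apply: eq_bigr => j _.
by rewrite [LHS](linear_sum (coord (vbasis {:V}) j)).
Qed.

Lemma lintr_rank1 (phi : V -> k) v : linear (phi : V -> k^o) -> lintr (fun u => phi u *: v) = phi v.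
Proof.
move=> lp; rewrite lintrE [v in RHS]basE (linear_sum' lp); apply: eq_bigr => i _.
by rewrite (linearZ' (@crd_linear i)) (linearZ' lp) [LHS]mulrC.
Qed.

Lemma mxf_idem f : linear f -> (forall v, f (f v) = f v) -> mxf f *m mxf f = mxf f.
Proof. by move=> lf ff; rewrite -(mxf_comp f lf); apply: eq_mxf => v; rewrite /= ff. Qed.

(** Writing M = C R with full-rank factors, cancel C on the left and R on the right in C R C R = C
    R. *)
Lemma idem_base (m : nat) (M : 'M[k]_m) : M *m M = M -> row_base M *m col_base M = 1%:M.
Proof.
move=> MM; apply: (row_full_inj (col_base_full M)).
apply: (row_free_inj (row_base_free M)) => /=.
by rewrite mulmx1 mulmxA -mulmxA !mulmx_base.
Qed.

Lemma mxtrace_idem (m : nat) (M : 'M[k]_m) : M *m M = M -> \tr M = (\rank M)%:R.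
Proof.
move=> MM; rewrite -[M in LHS](mulmx_base M) mxtrace_mulC idem_base //.
by rewrite mxtrace1.
Qed.

Lemma lintr_idem f : linear f -> (forall v, f (f v) = f v) -> lintr f = (rk f)%:R.
Proof. by move=> lf ff; rewrite /lintr mxtrace_idem // mxf_idem. Qed.

Lemma rk_le f : (rk f <= n)%N.
Proof. exact: rank_leq_row. Qed.

Lemma rk_full f : linear f -> (forall v, f (f v) = f v) -> rk f = n -> f =1 id.
Proof.
move=> lf ff rf; apply: mxf_inj => //; rewrite mxf_id.
have fr: row_free (mxf f) by rewrite -row_leq_rank -/(rk f) rf.
by apply: (row_free_inj fr); rewrite mxf_idem // mul1mx.
Qed.

Lemma rk0 f : linear f -> rk f = 0%N -> forall v, f v = 0.
Proof.
move=> lf /eqP; rewrite mxrank_eq0 => /eqP f0.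
apply: mxf_inj => // [a x y|]; rewrite ?scaler0 ?addr0 // f0.
by apply/matrixP=> i j; rewrite !mxE (linear0' (@crd_linear j)).
Qed.

Lemma rk1P f : linear f -> rk f = 1%N ->
  exists (phi : V -> k) (v : V), linear (phi : V -> k^o) /\ forall u, f u = phi u *: v.
Proof.
move=> lf rf.
have [x [y xy]] : exists (x : 'cV[k]_n) (y : 'rV[k]_n), mxf f = x *m y.
  have := mulmx_base (mxf f); move: (col_base _) (row_base _).
  by rewrite -/(rk f) rf => x y <-; exists x, y.
exists (fun u => \sum_i crd i u * x i ord0), (\sum_j y ord0 j *: bas j); split.
  move=> a u v; rewrite scaler_sumr -big_split; apply: eq_bigr => i _ /=.
  by rewrite crd_linear mulrDl scalerAl.
apply: bas_ext => // [a u v|i].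
  rewrite scalerA -scalerDl; congr (_ *: _); rewrite mulr_sumr -big_split.
  by apply: eq_bigr => i _ /=; rewrite crd_linear mulrDl [_ *: _]mulrC mulrA mulrAC mulrC mulrA.
apply: crdP => j; rewrite (linearZ' (@crd_linear j)) (linear_sum' (@crd_linear j)).
have /matrixP/(_ i j) := xy; rewrite !mxE big_ord1 => ->.
rewrite (bigD1 i) //= crd_bas eqxx mul1r big1 ?addr0; last first.
  by move=> l ni; rewrite crd_bas (negPf ni) mul0r.
congr (_ * _); rewrite (bigD1 j) //= (linearZ' (@crd_linear j)) crd_bas eqxx.
rewrite [_ *: _]mulr1 big1 ?addr0 // => l nj.
by rewrite (linearZ' (@crd_linear j)) crd_bas eq_sym (negPf nj) [_ *: _]mulr0.
Qed.

(** Nondegeneracy on the left makes the Gram matrix [M] invertible; both conclusions are read off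
    from its inverse. *)
Lemma bil_rep (B : V -> V -> k) :
    (forall v, linear (B^~ v : V -> k^o)) -> (forall u, linear (B u : V -> k^o)) ->
    (forall u, (forall v, B u v = 0) -> u = 0) ->
  (forall v, (forall u, B u v = 0) -> v = 0) /\
  (forall phi : V -> k, linear (phi : V -> k^o) -> exists u, forall v, B u v = phi v).
Proof.
move=> Bl Br nd; pose M : 'M[k]_n := \matrix_(i, j) B (bas i) (bas j).
pose vec (x : 'rV[k]_n) := \sum_i x ord0 i *: bas i.
have crd_vec x i : crd i (vec x) = x ord0 i.
  rewrite crd_sum (bigD1 i) //= crdZ crd_bas eqxx mulr1 big1 ?addr0 // => j /negPf nj.
  by rewrite crdZ crd_bas eq_sym nj mulr0.
have Bvec x j : B (vec x) (bas j) = (x *m M) ord0 j.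
  rewrite (linear_sum' (Bl _)) mxE; apply: eq_bigr => i _.
  by rewrite (linearZ' (Bl _)) mxE.
have uM : M \in unitmx.
  rewrite -row_free_unit; apply: inj_row_free => x xM.
  have v0 : vec x = 0.
    apply: nd; apply: (@bas_ext k^o) => //.
      by move=> c u v; rewrite scaler0 addr0.
    by move=> j; rewrite Bvec xM mxE.
  apply/rowP=> i; rewrite -crd_vec v0 mxE.
  exact: (linear0' (@crd_linear i)).
split=> [v Bv|phi lp].
  pose y : 'cV[k]_n := \col_j crd j v.
  have: M *m y = 0.
    apply/colP=> i; rewrite [RHS]mxE -[RHS](Bv (bas i)) [v in RHS]basE.
    rewrite (linear_sum' (Br _)) mxE; apply: eq_bigr => j _.
    by rewrite (linearZ' (Br _)) !mxE [RHS]mulrC.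
  move/(congr1 (mulmx (invmx M))); rewrite mulmx0 mulKmx // => y0.
  apply: crdP => j; have /colP/(_ j) := y0; rewrite !mxE => ->.
  by rewrite (linear0' (@crd_linear j)).
exists (vec ((\row_j phi (bas j)) *m invmx M)); apply: (@bas_ext k^o) => // j.
by rewrite Bvec mulmxKV // mxE.
Qed.

End Traces.

Lemma lintrC (k : fieldType) (V W : vectType k) (f : V -> W) (g : W -> V) :
  linear f -> linear g -> lintr (f \o g) = lintr (g \o f).
Proof.
move=> lf lg; apply: esym; rewrite !lintrE /=.
transitivity (\sum_i \sum_j crd j (f (bas i)) * crd i (g (bas j))).
  apply: eq_bigr => i _; rewrite {1}(basE (f _)) (linear_sum' lg) crd_sum.
  by apply: eq_bigr => j _; rewrite (linearZ' lg) crdZ.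
rewrite exchange_big; apply: eq_bigr => j _ /=.
rewrite [in RHS](basE (g _)) (linear_sum' lf) crd_sum.
by apply: eq_bigr => i _; rewrite (linearZ' lf) crdZ mulrC.
Qed.

Definition mkhom (k : fieldType) (U V : vectType k) (f : U -> V) (lf : linear f) :
    'Hom(U, V) :=
  let F : {linear U -> V} := HB.pack f (GRing.isLinear.Build k U V _ f lf) in linfun F.

Lemma mkhomE (k : fieldType) (U V : vectType k) (f : U -> V) (lf : linear f) :
  mkhom lf =1 f.
Proof. by move=> u; rewrite lfunE. Qed.

(** The characteristic polynomial splits and nilpotency forces all its roots to be 0, so it is a
    power of ['X]; its subleading coefficient is minus the trace. *)
Lemma mxtrace_nilp (k : closedFieldType) (m d : nat) (M : 'M[k]_m) :
  (iter d (mulmx M) 1%:M = 0) -> \tr M = 0.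
Proof.
case: m M => [|m] M Md; first by rewrite /mxtrace big_ord0.
have Mn0 a : eigenvalue M a -> a = 0.
  case/eigenvalueP=> v vM v0; apply/eqP; apply: contraT => a0.
  have: v *m iter d (mulmx M) 1%:M = a ^+ d *: v.
    elim: d {Md} => [|d IH] /=; first by rewrite mulmx1 expr0 scale1r.
    by rewrite mulmxA vM -scalemxAl IH scalerA exprS.
  rewrite Md mulmx0 => /esym/eqP; rewrite scaler_eq0 expf_eq0 (negPf a0) andbF.
  by rewrite (negPf v0).
have [r Er] := closed_field_poly_normal (char_poly M).
move: Er; rewrite (monicP (char_poly_monic M)) scale1r => Er.
have r0 : r = nseq (size r) 0.
  apply/all_pred1P/allP=> a ar; apply/eqP/Mn0.
  by rewrite eigenvalue_root_char Er root_prod_XsubC.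
have : size (char_poly M) = m.+2 by rewrite size_char_poly.
rewrite {1}Er size_prod_XsubC => -[sr]; rewrite sr in r0.
have /eqP := @char_poly_trace _ _ M (ltn0Sn m).
rewrite Er r0 big_nseq iter_mulr_1 subr0 coefXn /=.
by rewrite ltn_eqF // eq_sym oppr_eq0 => /eqP.
Qed.

Lemma lintr_nilp (k : closedFieldType) (V : vectType k) (f : V -> V) d :
  linear f -> (forall v, iter d f v = 0) -> lintr f = 0.
Proof.
move=> lf fd; apply: (@mxtrace_nilp _ _ d); apply/matrixP=> i j.
have -> : iter d (mulmx (mxf f)) 1%:M = mxf (iter d f); last first.
  by rewrite !mxE fd (linear0' (@crd_linear _ _ j)).
elim: d {fd} => [|d IH] /=; first by rewrite mxf_id.
rewrite IH -(mxf_comp f); last by elim: d {IH} => [|d IH] a x y //=; rewrite IH lf.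
by apply: eq_mxf => v /=; rewrite -iterSr.
Qed.

(** * Hopf algebras in coordinates *)

Section HopfBasics.
Variables (k : fieldType) (H : hopfType k).
Local Notation n := (\dim {:H}).
Local Notation b := (@bas k H).
Local Notation A := (hdual H).
Implicit Types (f : A) (a g h : H).

Definition ev f h : k := (f : 'Hom(H, k^o)) h.

Lemma evl f : linear (ev f : H -> k^o). Proof. exact: linearP. Qed.

Lemma evr a : linear (ev^~ a : A -> k^o).
Proof. by move=> c f g; rewrite /ev add_lfunE scale_lfunE. Qed.

Lemma evlZ f (c : k) a : ev f (c *: a) = c * ev f a.
Proof. exact: (linearZ' (@evl f)). Qed.

Lemma evlD f a h : ev f (a + h) = ev f a + ev f h.
Proof. exact: (linearD' (@evl f)). Qed.

Lemma evl_sum f (I : finType) (F : I -> H) :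
  ev f (\sum_j F j) = \sum_j ev f (F j).
Proof. exact: (linear_sum' (@evl f)). Qed.

Lemma evrZ (c : k) f a : ev (c *: f) a = c * ev f a.
Proof. exact: (linearZ' (@evr a)). Qed.

Lemma evrD f (g : A) a : ev (f + g) a = ev f a + ev g a.
Proof. exact: (linearD' (@evr a)). Qed.

Lemma evr_sum (I : finType) (F : I -> A) a :
  ev (\sum_j F j) a = \sum_j ev (F j) a.
Proof. exact: (linear_sum' (@evr a)). Qed.

Lemma evP f (g : A) : ev f =1 ev g -> f = g.
Proof. by move=> fg; apply/lfunP. Qed.

Lemma ev1 h : ev 1 h = counit h. Proof. by []. Qed.

(** Defined for an arbitrary function from its values on the basis; the linearity of [phi] is only
    asked for in [dualfE]. *)
Definition dualf (phi : H -> k) : A := \sum_i phi (b i) *: dual_basis i.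

Lemma ev_dual_basis i h : ev (dual_basis i) h = crd i h.
Proof. by rewrite /ev lfunE. Qed.

Lemma dualfE (phi : H -> k) : linear (phi : H -> k^o) -> ev (dualf phi) =1 phi.
Proof.
move=> lp h; rewrite evr_sum [h in RHS]basE (linear_sum' lp).
by apply: eq_bigr => i _; rewrite evrZ (linearZ' lp) ev_dual_basis [RHS]mulrC.
Qed.

Lemma dual_basE f : f = \sum_i ev f (b i) *: dual_basis i.
Proof. by apply: evP => h; rewrite -/(dualf (ev f)) dualfE //; exact: evl. Qed.

Lemma ev_sep a h : (forall f, ev f a = ev f h) -> a = h.
Proof. by move=> e; apply: crdP => i; rewrite -!ev_dual_basis. Qed.

(** The inverse of the evaluation map from [H] to its double dual. *)
Definition predual (om : A -> k) : H := \sum_i om (dual_basis i) *: b i.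

Lemma predualE (om : A -> k) f : linear (om : A -> k^o) ->
  ev f (predual om) = om f.
Proof.
move=> lo; rewrite [in RHS](dual_basE f) (linear_sum' lo) evl_sum.
by apply: eq_bigr => i _; rewrite (linearZ' lo) evlZ [LHS]mulrC.
Qed.

(** The second factor that accompanies [b i] in [comul h] ([comul_cp]), so that a Sweedler sum
    becomes a sum over basis indices. The lock keeps the matrix of coordinates from being
    exposed. *)
Definition cp h i : H := locked (\sum_j (comul h : 'M[k]_(_, _)) i j *: b j).

Lemma cp_linear i : linear (cp^~ i).
Proof.
move=> c x y; rewrite /cp -!lock scaler_sumr -big_split; apply: eq_bigr => j _ /=.
by rewrite linearP !mxE scalerDl scalerA.
Qed.

Lemma comul_cp h : comul h = \sum_i tpure (b i) (cp h i).
Proof.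
rewrite -[LHS]tens_basisE /tlift; apply: eq_bigr => i _.
rewrite /cp -lock [RHS](linear_sum' ((@tpure_bilin _ _ _).2 _)); apply: eq_bigr => j _.
by rewrite (linearZ' ((@tpure_bilin _ _ _).2 _)).
Qed.

Lemma tpure_sum_inj (V W : vectType k) (u v : 'I_(\dim {:V}) -> W) :
  \sum_i tpure (bas i) (u i) = \sum_i tpure (bas i) (v i) -> u =1 v.
Proof.
move=> uv m; have bm : bilin (fun (x : V) (y : W) => crd m x *: y).
  split=> [y|x] c s t; first by rewrite crd_linear scalerDl scalerA.
  by rewrite scalerDr !scalerA mulrC.
suff E (w : 'I_(\dim {:V}) -> W) :
    tlift (fun (x : V) (y : W) => crd m x *: y) (\sum_i tpure (bas i) (w i)) = w m.
  by rewrite -(E u) uv.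
rewrite (linear_sum' (tlift_linear _)) (bigD1 m) //= tliftE // crd_bas eqxx.
rewrite scale1r big1 ?addr0 // => i /negPf ni.
by rewrite tliftE // crd_bas eq_sym ni scale0r.
Qed.

Lemma cpP h (u : 'I_n -> H) : comul h = \sum_i tpure (b i) (u i) -> cp h =1 u.
Proof. by rewrite comul_cp; apply: tpure_sum_inj. Qed.

Lemma tlift_cp (W : vectType k) (B : H -> H -> W) h : bilin B ->
  tlift B (comul h) = \sum_i B (b i) (cp h i).
Proof.
move=> bB; rewrite comul_cp (linear_sum' (tlift_linear _)).
by apply: eq_bigr => i _; rewrite tliftE.
Qed.

Lemma evM f (g : A) h : ev (f * g) h = \sum_i ev f (b i) * ev g (cp h i).
Proof.
have [ml mr] := @mul_bilin k k^o.
rewrite /ev lfunE /= /dual_mul_fun tlift_cp //.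
by split=> [y|x] c s t; rewrite linearP ?ml ?mr.
Qed.

Definition eps h : k := counit h.

Lemma counit_cp h : h = \sum_i eps (b i) *: cp h i.
Proof.
rewrite -[LHS]counitl tlift_cp //; split=> [y|x] c s t.
  by rewrite linearP scalerDl scalerA.
by rewrite scalerDr !scalerA mulrC.
Qed.

Lemma cp_counit h i : eps (cp h i) = crd i h.
Proof.
rewrite -[in RHS](counitr h) tlift_cp; last first.
  split=> [y|x] c s t; last by rewrite linearP scalerDl scalerA.
  by rewrite scalerDr !scalerA mulrC.
rewrite crd_sum (bigD1 i) //= crdZ crd_bas eqxx mulr1 big1 ?addr0 //.
by move=> j /negPf nj; rewrite crdZ crd_bas eq_sym nj mulr0.
Qed.

(* The comatrix of the regular comodule: [comul (b j) = \sum_i tpure (b i) (regX i j)]. *)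
Definition regX i j : H := cp (b j) i.

(** The matrix of coefficients of a comodule. When its counit is the identity matrix, the antipode
    inverts it ([cmat_Sl], [cmat_Sr]). *)
Definition cmat (I : finType) (Z : I -> I -> H) :=
  forall i j, comul (Z i j) = \sum_l tpure (Z i l) (Z l j).

Lemma cp_regX h i : cp h i = \sum_j crd j h *: regX i j.
Proof.
by rewrite {1}(basE h) (linear_sum' (@cp_linear i)); apply: eq_bigr => j _;
  rewrite (linearZ' (@cp_linear i)).
Qed.

(** Coassociativity, compared in the coordinates of the first tensor factor. *)
Lemma comul_cpcp h i : comul (cp h i) = \sum_l tpure (regX i l) (cp h l).
Proof.
have [pl pr] := @tpure_bilin k (tens H H) H; have [ql qr] := @tpure_bilin k H (tens H H).
suff E : \sum_i tpure (b i) (comul (cp h i)) =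
    \sum_m tpure (b m) (\sum_l tpure (regX m l) (cp h l)).
  exact: (tpure_sum_inj E).
transitivity (tmap idfun comul (comul h)).
  rewrite [in RHS]comul_cp (linear_sum' (tmap_linear _ _)); apply: eq_bigr => l _.
  by rewrite tmapE //; exact: linearP.
rewrite -comulA comul_cp (linear_sum' (tmap_linear _ _)).
rewrite (linear_sum' (@tassoc_linear _ _ _ _)).
under [RHS]eq_bigr => m _ do rewrite (linear_sum' (qr _)).
rewrite [RHS]exchange_big; apply: eq_bigr => l _ /=.
rewrite tmapE //; last exact: linearP.
rewrite comul_cp (linear_sum' (pl _)) (linear_sum' (@tassoc_linear _ _ _ _)).
by apply: eq_bigr => m _; rewrite tassocE.
Qed.

Lemma regX_cmat : cmat regX.
Proof. by move=> i j; rewrite comul_cpcp. Qed.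

Lemma regX_counit i j : eps (regX i j) = (i == j)%:R.
Proof. by rewrite cp_counit crd_bas. Qed.

Lemma eps_linear : linear (eps : H -> k^o). Proof. exact: linearP. Qed.

Lemma cmat_Sl (I : finType) (Z : I -> I -> H) : cmat Z ->
  forall i j, \sum_l antipode (Z i l) * Z l j = eps (Z i j) *: 1.
Proof.
move=> cZ i j; rewrite -antipodel cZ (linear_sum' (tlift_linear _)).
apply: eq_bigr => l _; rewrite tliftE //; have [ml mr] := @mul_bilin k H.
by split=> [y|x] c s t; rewrite ?linearP ?ml ?mr.
Qed.

Lemma cmat_Sr (I : finType) (Z : I -> I -> H) : cmat Z ->
  forall i j, \sum_l Z i l * antipode (Z l j) = eps (Z i j) *: 1.
Proof.
move=> cZ i j; rewrite -antipoder cZ (linear_sum' (tlift_linear _)).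
apply: eq_bigr => l _; rewrite tliftE //; have [ml mr] := @mul_bilin k H.
by split=> [y|x] c s t; rewrite ?linearP ?ml ?mr.
Qed.

Lemma tmul_sum (I J : finType) (u v : I -> H) (u' v' : J -> H) :
  tmul (\sum_i tpure (u i) (v i)) (\sum_j tpure (u' j) (v' j)) =
  \sum_i \sum_j tpure (u i * u' j) (v i * v' j).
Proof.
have [tl tr] := @tmul_bilin k H H.
rewrite (linear_sum' (tl _)); apply: eq_bigr => i _.
by rewrite (linear_sum' (tr _)); apply: eq_bigr => j _; rewrite tmulE.
Qed.

Lemma cmat_mul (I J : finType) (Z : I -> I -> H) (W : J -> J -> H) :
  cmat Z -> cmat W ->
  cmat (fun p q : I * J => Z p.1 q.1 * W p.2 q.2).
Proof.
move=> cZ cW [i j] [i' j'] /=; rewrite comulM cZ cW tmul_sum.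
by rewrite pair_big.
Qed.

Lemma epsM g h : eps (g * h) = eps g * eps h. Proof. exact: counitM. Qed.

Lemma antipode1 : antipode (1 : H) = 1.
Proof.
have [ml mr] := @mul_bilin k H.
have := antipodel (1 : H); rewrite comul1 tliftE ?mulr1 ?counit1 ?scale1r //.
by split=> [y|x] c s t; rewrite ?linearP ?ml ?mr.
Qed.

(* Both [S(X_ij X_kl)] and [S(X_kl) S(X_ij)] are inverse to the comatrix
   [X_ij X_kl]. *)
Lemma antipodeM g h : antipode (g * h) = antipode h * antipode g.
Proof.
have [ml mr] := @mul_bilin k H.
suff XX i j p q : antipode (regX i j * regX p q) =
    antipode (regX p q) * antipode (regX i j).
  (* By the counit axiom the entries of [regX] span [H], so products of such entries suffice. *)
  have bX l : b l = \sum_i eps (b i) *: regX i l by exact: counit_cp.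
  move: g; apply: bas_ext => [c s t|c s t|l]; rewrite ?ml ?linearP ?mr //.
  move: h; apply: bas_ext => [c s t|c s t|m]; rewrite ?mr ?linearP ?ml //.
  rewrite !bX; under eq_bigr => i _ do rewrite -[_ *: _]addr0.
  rewrite mulr_suml !linear_sum mulr_sumr; apply: eq_bigr => i _.
  rewrite addr0 -scalerAl !linearZ -scalerAr /=; congr (_ *: _).
  rewrite mulr_sumr linear_sum mulr_suml; apply: eq_bigr => j _.
  by rewrite -scalerAr !linearZ -scalerAl /= XX.
pose Z (u v : 'I_n * 'I_n) := regX u.1 v.1 * regX u.2 v.2.
have cZ : cmat Z by exact: cmat_mul regX_cmat regX_cmat.
have eZ u v : eps (Z u v) = (u == v)%:R.
  by rewrite epsM !regX_counit -natrM mulnb.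
pose W (u v : 'I_n * 'I_n) := antipode (regX u.2 v.2) * antipode (regX u.1 v.1).
have ZW u v : \sum_l Z u l * W l v = (u == v)%:R *: 1.
  rewrite -(pair_bigA _ (fun l m => Z u (l, m) * W (l, m) v)) /=.
  transitivity (\sum_l (u.2 == v.2)%:R *: (regX u.1 l * antipode (regX l v.1))).
    apply: eq_bigr => l _; rewrite -[antipode _ in RHS]mul1r scalerAr scalerAl.
    rewrite -regX_counit -(cmat_Sr regX_cmat) mulr_suml mulr_sumr.
    by apply: eq_bigr => m _; rewrite /Z /W /= !mulrA.
  rewrite -scaler_sumr (cmat_Sr regX_cmat) regX_counit scalerA -natrM mulnb.
  by rewrite andbC.
suff SW u v : antipode (Z u v) = W u v by exact: (SW (i, p) (j, q)).
transitivity (\sum_l antipode (Z u l) * ((l == v)%:R *: 1)).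
  rewrite (bigD1 v) //= eqxx scale1r mulr1 big1 ?addr0 // => l /negPf ->.
  by rewrite scale0r mulr0.
under eq_bigr => l _ do rewrite -ZW mulr_sumr.
rewrite exchange_big /= (bigD1 u) //= [X in _ + X]big1 => [|m /negPf nm].
  under eq_bigr => l _ do rewrite mulrA.
  by rewrite -mulr_suml cmat_Sl // eZ eqxx scale1r mul1r addr0.
under eq_bigr => l _ do rewrite mulrA.
by rewrite -mulr_suml cmat_Sl // eZ eq_sym nm scale0r mul0r.
Qed.

(* [h_(1) f(h_(2))] *)
Definition hitR f h := \sum_i ev f (cp h i) *: b i.

Lemma hitR_linear f : linear (hitR f).
Proof.
move=> c x y; rewrite /hitR scaler_sumr -big_split; apply: eq_bigr => i _ /=.
by rewrite cp_linear evlD evlZ scalerDl scalerA.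
Qed.

Lemma ev_hitR f (g : A) h : ev g (hitR f h) = ev (g * f) h.
Proof.
by rewrite evM evl_sum; apply: eq_bigr => i _; rewrite evlZ mulrC.
Qed.

Lemma hitRM f (g : A) h : hitR (f * g) h = hitR f (hitR g h).
Proof. by apply: ev_sep => u; rewrite !ev_hitR mulrA. Qed.

(** The character of the regular comodule: evaluating [f] at it gives the trace of [hitR f]
    ([lintr_hitR]). *)
Definition regx : H := \sum_i regX i i.

Lemma lintr_hitR f : lintr (hitR f) = ev f regx.
Proof.
rewrite lintrE evl_sum; apply: eq_bigr => i _; rewrite /hitR crd_sum (bigD1 i) //=.
rewrite crdZ crd_bas eqxx mulr1 big1 ?addr0 // => j /negPf nj.
by rewrite crdZ crd_bas eq_sym nj mulr0.
Qed.

Lemma cp_tpure h (I : finType) (u v : I -> H) :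
  comul h = \sum_p tpure (u p) (v p) ->
  forall m, cp h m = \sum_p crd m (u p) *: v p.
Proof.
move=> hE; apply: (cpP (u := fun m => \sum_p crd m (u p) *: v p)); rewrite hE.
under [RHS]eq_bigr => i _ do rewrite (linear_sum' ((@tpure_bilin _ _ _).2 _)).
rewrite [RHS]exchange_big; apply: eq_bigr => p _ /=.
rewrite {1}(basE (u p)) (linear_sum' ((@tpure_bilin _ _ _).1 _)).
apply: eq_bigr => i _; rewrite (linearZ' ((@tpure_bilin _ _ _).1 _)).
by rewrite (linearZ' ((@tpure_bilin _ _ _).2 _)).
Qed.

Lemma crd_mulr s u h : \sum_i crd i u * crd s (h * b i) = crd s (h * u).
Proof.
rewrite [u in RHS]basE mulr_sumr crd_sum; apply: eq_bigr => i _.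
by rewrite -scalerAr crdZ.
Qed.

(* Multiplication by [X] intertwines the tensor square of the regular comatrix
   with [n] copies of it, so the two have the same trace. *)
Lemma regx_sqr : regx * regx = n%:R *: regx.
Proof.
have cpX p l i m : cp (regX p l * b i) m =
    \sum_s \sum_r crd m (regX p s * b r) *: (regX s l * regX r i).
  rewrite pair_bigA; apply: cp_tpure.
  by rewrite comulM regX_cmat comul_cp tmul_sum pair_bigA.
(* The intertwining matrix in [cpX] has entries [crd m (regX p s * b r)]; its inverse has entries
   [crd a (antipode (regX t p) * b m)]. *)
have XX t l (a i : 'I_n) : regX t l * regX a i = \sum_p \sum_m
    crd a (antipode (regX t p) * b m) *: cp (regX p l * b i) m.
  under eq_bigr => p _.
    under eq_bigr => m _ do rewrite cpX scaler_sumr.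
    rewrite exchange_big /=.
    under eq_bigr => s _.
      under eq_bigr => m _ do rewrite scaler_sumr.
      rewrite exchange_big /=.
      under eq_bigr => r _.
        under eq_bigr => m _ do rewrite scalerA mulrC.
        rewrite -scaler_suml crd_mulr mulrA; over.
      over.
    over.
  rewrite exchange_big /= (bigD1 t) //= exchange_big /= [X in _ + X]big1; last first.
    move=> s /negPf nst; rewrite exchange_big big1 // => r _ /=.
    rewrite -scaler_suml -crd_sum -mulr_suml cmat_Sl ?regX_cmat //; last exact: regX_cmat.
    by rewrite regX_counit eq_sym nst scale0r mul0r (linear0' (@crd_linear _ _ a)) scale0r.
  rewrite addr0 (bigD1 a) //= [X in _ + X]big1 => [|r /negPf nra].
    rewrite -scaler_suml -crd_sum -mulr_suml cmat_Sl; last exact: regX_cmat.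
    by rewrite regX_counit eqxx scale1r mul1r crd_bas eqxx scale1r addr0.
  rewrite -scaler_suml -crd_sum -mulr_suml cmat_Sl; last exact: regX_cmat.
  by rewrite regX_counit eqxx scale1r mul1r crd_bas eq_sym nra scale0r.
rewrite {1}/regx mulr_suml.
transitivity (\sum_(p < n) \sum_m \sum_s
    (\sum_l crd s (regX p l * antipode (regX l p) * b m)) *: regX m s).
  under eq_bigr => l _.
    rewrite mulr_sumr; under eq_bigr => i _ do rewrite XX.
    rewrite exchange_big /=.
    under eq_bigr => p _.
      rewrite exchange_big /=.
      under eq_bigr => m _.
        under eq_bigr => i _ do rewrite cp_regX scaler_sumr.
        rewrite exchange_big /=.
        under eq_bigr => s _.
          under eq_bigr => i _ do rewrite scalerA.
          rewrite -scaler_suml crd_mulr mulrA; over.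
        over.
      over.
    over.
  rewrite exchange_big; apply: eq_bigr => p _ /=.
  rewrite exchange_big; apply: eq_bigr => m _ /=.
  rewrite exchange_big; apply: eq_bigr => s _ /=.
  by rewrite scaler_suml.
rewrite scaler_nat -[n in RHS]card_ord -sumr_const; apply: eq_bigr => p _.
apply: eq_bigr => m _; rewrite (bigD1 m) //= [X in _ + X]big1 => [|s /negPf nsm].
  rewrite -crd_sum -mulr_suml cmat_Sr; last exact: regX_cmat.
  by rewrite regX_counit eqxx scale1r mul1r crd_bas eqxx scale1r addr0.
rewrite -crd_sum -mulr_suml cmat_Sr; last exact: regX_cmat.
by rewrite regX_counit eqxx scale1r mul1r crd_bas nsm scale0r.
Qed.

Lemma ev_antipode f h : ev (antipode f) h = ev f (antipode h).
Proof. by rewrite /ev /= lfunE /= /dual_antipode_fun comp_lfunE. Qed.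

End HopfBasics.

Lemma natr_inj0 (k : fieldType) (m n : nat) : [pchar k] =i pred0 ->
  m%:R = n%:R :> k -> m = n.
Proof.
move=> /pcharf0P ch; wlog le_mn : m n / (m <= n)%N => [W|].
  have [/W//|/ltnW/W W' /esym /W' //] := leqP m n.
move/eqP; rewrite eq_sym -subr_eq0 -natrB // ch subn_eq0 => le_nm.
by apply/eqP; rewrite eqn_leq le_mn.
Qed.

Lemma eps_antipode (k : fieldType) (H : hopfType k) (h : H) : eps (antipode h) = eps h.
Proof.
have -> : eps (antipode h) = ev 1 (antipode h) by [].
by rewrite -ev_antipode antipode1.
Qed.

(** * Integrals and the square of the antipode *)

Section Larson.
Variables (k : fieldType) (H : hopfType k).
Local Notation n := (\dim {:H}).
Local Notation b := (@bas k H).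
Local Notation A := (hdual H).
Implicit Types (f g : A) (a h : H).

Definition pr f g (t : tens H H) : k := tlift (fun u v => ev f u * ev g v : k^o) t.

Lemma pr_linear f g : linear (pr f g : tens H H -> k^o).
Proof. exact: tlift_linear. Qed.

Lemma pr_tpure f g a h : pr f g (tpure a h) = ev f a * ev g h.
Proof.
have [ml mr] := @mul_bilin k k^o.
by rewrite /pr tliftE //; split=> [v|u] c s t; rewrite evl ?ml ?mr.
Qed.

Lemma pr_comul f g h : pr f g (comul h) = ev (f * g) h.
Proof.
rewrite evM comul_cp (linear_sum' (@pr_linear f g)).
by apply: eq_bigr => i _; rewrite pr_tpure.
Qed.

Lemma prP (s t : tens H H) : (forall f g, pr f g s = pr f g t) -> s = t.
Proof.
move=> st.
have sep (u : H) : (forall f : A, ev f u = 0) -> u = 0.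
  by move=> u0; apply: ev_sep => f; rewrite u0 (linear0' (@evl _ _ f)).
exact: (@tens_sep _ _ _ _ _ (fun f u => ev f u) (fun f u => ev f u)
  (@evl _ _) (@evl _ _) sep sep).
Qed.

Definition sg h : H := antipode (antipode h).

Lemma sg_linear : linear sg.
Proof. by move=> c x y; rewrite /sg !linearP. Qed.

Lemma sgM a h : sg (a * h) = sg a * sg h.
Proof. by rewrite /sg !antipodeM. Qed.

Lemma sg1 : sg 1 = 1.
Proof. by rewrite /sg !antipode1. Qed.

Lemma eps_sg h : eps (sg h) = eps h.
Proof. by rewrite /sg !eps_antipode. Qed.

Lemma ev_sg f h : ev f (sg h) = ev (antipode (antipode f)) h.
Proof. by rewrite !ev_antipode. Qed.

(** Tested against pairs of linear forms, this is the multiplicativity of the squared antipode of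
    the dual, which [antipodeM] gives. *)
Lemma comul_sg h : comul (sg h) = \sum_i tpure (sg (b i)) (sg (cp h i)).
Proof.
apply: prP => f g; rewrite pr_comul ev_sg !antipodeM evM.
rewrite (linear_sum' (@pr_linear f g)); apply: eq_bigr => i _.
by rewrite pr_tpure !ev_antipode.
Qed.

(* [lam 1] is the trace of the square of the antipode. *)
Definition lam a : k := lintr (fun y => sg y * a).

Lemma lam_linear : linear (lam : H -> k^o).
Proof.
move=> c x y; transitivity (lintr (fun z => c *: (sg z * x) + sg z * y)).
  by apply: (@eq_lintr _ H) => z; rewrite mulrDr scalerAr.
exact: (@lintr_linear _ H c (fun z => sg z * x) (fun z => sg z * y)).
Qed.

Lemma lamZ (c : k) h : lam (c *: h) = c * lam h.
Proof. exact: (linearZ' lam_linear). Qed.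

Lemma lam_sum (I : finType) (F : I -> H) : lam (\sum_i F i) = \sum_i lam (F i).
Proof. exact: (linear_sum' lam_linear). Qed.

(** Both sides equal the sum of [antipode (regX j l) * cp (sg (b j) * a) l]. Expanding [cp] along
    [regX] cancels the antipode and leaves a trace; expanding it as a product of coproducts, the
    antipode cancels against [sg (regX i j)], and this is why the trace is twisted by [sg]. *)
Lemma lam_int a : \sum_i lam (b i) *: cp a i = lam a *: 1.
Proof.
have cpsg j l : cp (sg (b j) * a) l =
    \sum_i \sum_s crd l (sg (b i) * b s) *: (sg (regX i j) * cp a s).
  rewrite pair_bigA; apply: cp_tpure.
  by rewrite comulM comul_sg [comul a]comul_cp tmul_sum pair_bigA.
transitivity (\sum_j \sum_l antipode (regX j l) * cp (sg (b j) * a) l); last first.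
  rewrite /lam lintrE scaler_suml; apply: eq_bigr => j _.
  under eq_bigr => l _ do rewrite cp_regX mulr_sumr.
  rewrite exchange_big /= (bigD1 j) //= [X in _ + X]big1 => [|i /negPf nij].
    under eq_bigr => l _ do rewrite -scalerAr.
    rewrite -scaler_sumr cmat_Sl; last exact: regX_cmat.
    by rewrite regX_counit eqxx scale1r addr0.
  under eq_bigr => l _ do rewrite -scalerAr.
  rewrite -scaler_sumr cmat_Sl; last exact: regX_cmat.
  by rewrite regX_counit eq_sym nij scale0r scaler0.
have SX i l : \sum_j antipode (regX j l) * sg (regX i j) = (i == l)%:R *: 1.
  under eq_bigr => j _ do rewrite /sg -antipodeM.
  rewrite -linear_sum cmat_Sl; last exact: regX_cmat.
  by rewrite regX_counit linearZ /= antipode1.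
transitivity (\sum_l \sum_i \sum_s
    crd l (sg (b i) * b s) *: ((\sum_j antipode (regX j l) * sg (regX i j)) * cp a s)).
  rewrite exchange_big /=; under [RHS]eq_bigr => i _.
    rewrite (bigD1 i) //= [X in _ + X]big1 ?addr0 => [|l /negPf nl].
      under eq_bigr => s _ do rewrite SX eqxx scale1r mul1r.
      over.
    by rewrite big1 // => s _; rewrite SX eq_sym nl scale0r mul0r scaler0.
  rewrite exchange_big; apply: eq_bigr => s _ /=.
  by rewrite -scaler_suml /lam lintrE.
rewrite [RHS]exchange_big; apply: eq_bigr => l _ /=.
under [RHS]eq_bigr => j _ do rewrite cpsg mulr_sumr.
rewrite [RHS]exchange_big; apply: eq_bigr => i _ /=.
under [RHS]eq_bigr => j _ do rewrite mulr_sumr.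
rewrite [RHS]exchange_big; apply: eq_bigr => s _ /=.
rewrite mulr_suml scaler_sumr; apply: eq_bigr => j _.
by rewrite -scalerAr mulrA.
Qed.

(** Cyclicity of the trace for right multiplication by [h], which becomes right multiplication by
    [sg h] after [sg]: the Nakayama automorphism of [lam] is [sg]. *)
Lemma lam_cyc a h : lam (a * h) = lam (sg h * a).
Proof.
have := @lintrC _ H H (fun y => y * h) (fun y => sg y * a).
rewrite /lam (@eq_lintr _ H _ (fun y => sg y * (a * h))) => [->|y] /=; last first.
- by rewrite mulrA.
- by move=> c x y; rewrite sg_linear mulrDl scalerAl.
- by move=> c x y; rewrite mulrDl scalerAl.
by apply: (@eq_lintr _ H) => y /=; rewrite sgM mulrA.
Qed.

Lemma lam_sg a : lam (sg a) = lam a.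
Proof.
have := @lintrC _ H H sg (fun y => y * a).
rewrite (@eq_lintr _ H (sg \o _) (fun y => sg y * sg a)) => [|y] /=; last by rewrite sgM.
by apply; [exact: sg_linear | move=> c x y; rewrite mulrDl scalerAl].
Qed.

(* [f] is a right integral of [A]. *)
Definition rint f := forall a, \sum_i ev f (b i) *: cp a i = ev f a *: 1.

Lemma rintP f : rint f <-> forall g, f * g = ev g 1 *: f.
Proof.
split=> [fi g|fi a].
  apply: evP => a; rewrite evM evrZ -[RHS]mulrC -evlZ -fi evl_sum.
  by apply: eq_bigr => i _; rewrite evlZ.
apply: ev_sep => g; rewrite evl_sum evlZ mulrC -evrZ -fi evM.
by apply: eq_bigr => i _; rewrite evlZ.
Qed.

Definition lamA : A := dualf lam.

Lemma ev_lamA h : ev lamA h = lam h.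
Proof. by rewrite dualfE //; exact: lam_linear. Qed.

Lemma lamA_rint : rint lamA.
Proof.
by move=> a; rewrite ev_lamA -lam_int; apply: eq_bigr => i _; rewrite ev_lamA.
Qed.

Lemma lamA_mul f : lamA * f = ev f 1 *: lamA.
Proof. by move/rintP: lamA_rint; apply. Qed.

Section Integral.
Variable Lam : H.
Hypothesis LamP : forall h, h * Lam = eps h *: Lam.
Hypothesis eps_Lam : eps Lam = 1.

Lemma lam_Lam : lam Lam = 1.
Proof.
rewrite -[RHS]eps_Lam -(@lintr_rank1 _ H (@eps k H) Lam (@eps_linear _ H)).
by apply: (@eq_lintr _ H) => y; rewrite LamP eps_sg.
Qed.

(** The Fourier transform of [f]; it inverts the map sending [h] to the form [lam (h * _)]
    ([Theta_lam]). *)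
Definition Theta f : H := \sum_i ev f (b i) *: antipode (cp Lam i).

(** In Sweedler notation, the tensor $h_1\Lambda_1 \otimes S(h_2\Lambda_2)h_3$ collapses to the left
    side by the antipode axiom and to the right side by [LamP]. *)
Lemma Casimir (phi : H -> k) h : linear (phi : H -> k^o) ->
  \sum_i phi (h * b i) *: antipode (cp Lam i) =
  \sum_i phi (b i) *: (antipode (cp Lam i) * h).
Proof.
move=> lp; have [ml mr] := @mul_bilin k H.
move: h; apply: bas_ext => [c s t|c s t|j].
- rewrite scaler_sumr -big_split; apply: eq_bigr => i _ /=.
  by rewrite ml lp scalerDl scalerA.
- rewrite scaler_sumr -big_split; apply: eq_bigr => i _ /=.
  by rewrite mr scalerDr !scalerA mulrC.
have cpL p m : eps (b p) *: cp Lam m =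
    \sum_l \sum_s crd m (b l * b s) *: (regX l p * cp Lam s).
  rewrite -(linearZ' (@cp_linear _ _ m)) -LamP pair_bigA; apply: cp_tpure.
  by rewrite comulM comul_cp [comul Lam]comul_cp tmul_sum pair_bigA.
transitivity (\sum_m phi (b m) *: \sum_p (antipode (eps (b p) *: cp Lam m) * regX p j)).
  transitivity (\sum_l \sum_s phi (b l * b s) *:
      \sum_p (antipode (cp Lam s) * antipode (regX l p) * regX p j)).
    rewrite [RHS](bigD1 j) //= [X in _ + X]big1 ?addr0 => [|l /negPf nl].
      apply: eq_bigr => s _; congr (_ *: _).
      under eq_bigr => p _ do rewrite -mulrA.
      rewrite -mulr_sumr cmat_Sl; last exact: regX_cmat.
      by rewrite regX_counit eqxx scale1r mulr1.
    rewrite big1 // => s _; under eq_bigr => p _ do rewrite -mulrA.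
    rewrite -mulr_sumr cmat_Sl; last exact: regX_cmat.
    by rewrite regX_counit nl scale0r mulr0 scaler0.
  under [RHS]eq_bigr => m _.
    under eq_bigr => p _.
      rewrite cpL linear_sum mulr_suml.
      under eq_bigr => l _.
        rewrite linear_sum mulr_suml.
        under eq_bigr => s _ do rewrite linearZ /= antipodeM -scalerAl.
        over.
      over.
    rewrite exchange_big scaler_sumr /=.
    under eq_bigr => l _.
      rewrite exchange_big scaler_sumr /=.
      under eq_bigr => s _ do rewrite -scaler_sumr scalerA.
      over.
    over.
  rewrite [RHS]exchange_big; apply: eq_bigr => l _ /=.
  rewrite [RHS]exchange_big; apply: eq_bigr => s _ /=.
  rewrite -scaler_suml; congr (_ *: _).
  rewrite [b l * b s in LHS]basE (linear_sum' lp); apply: eq_bigr => m _.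
  by rewrite (linearZ' lp) [LHS]mulrC.
apply: eq_bigr => m _; rewrite [b j in RHS]counit_cp mulr_sumr; congr (_ *: _).
by apply: eq_bigr => p _; rewrite linearZ -scalerAl -scalerAr.
Qed.

Lemma Theta_lam h : Theta (dualf (fun y => lam (h * y))) = h.
Proof.
have lp : linear ((fun y => lam (h * y)) : H -> k^o).
  by move=> c x y; rewrite mulrDr -scalerAr lam_linear.
rewrite /Theta; under eq_bigr => i _ do rewrite dualfE //.
rewrite Casimir; last exact: lam_linear.
under eq_bigr => i _ do rewrite scalerAl -linearZ.
by rewrite -mulr_suml -linear_sum lam_int lam_Lam linearZ /= antipode1 scale1r mul1r.
Qed.

Lemma lam_nondegl h : (forall y, lam (h * y) = 0) -> h = 0.
Proof.
move=> h0; rewrite -(Theta_lam h); apply: big1 => i _; rewrite dualfE ?h0 ?scale0r //.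
by move=> c x y; rewrite !h0 scaler0 addr0.
Qed.

Let lam_mul_l v : linear ((fun u => lam (u * v)) : H -> k^o).
Proof. by move=> c x y; rewrite mulrDl -scalerAl lam_linear. Qed.
Let lam_mul_r u : linear ((fun v => lam (u * v)) : H -> k^o).
Proof. by move=> c x y; rewrite mulrDr -scalerAr lam_linear. Qed.

Lemma lam_nondegr h : (forall y, lam (y * h) = 0) -> h = 0.
Proof. exact: (bil_rep lam_mul_l lam_mul_r lam_nondegl).1. Qed.

Lemma lam_rep (phi : H -> k) : linear (phi : H -> k^o) ->
  exists u, forall v, lam (u * v) = phi v.
Proof. exact: (bil_rep lam_mul_l lam_mul_r lam_nondegl).2. Qed.

Lemma sg_inj h : sg h = 0 -> h = 0.
Proof. by move=> h0; apply: lam_nondegr => y; rewrite lam_cyc h0 mul0r (linear0' lam_linear). Qed.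

Lemma antipode_inj h : antipode h = 0 -> h = 0.
Proof. by move=> h0; apply: sg_inj; rewrite /sg h0 linear0. Qed.

(** Nondegeneracy gives f = lam(u _) with u = [Theta f], and the integral property of [f] turns
    [Theta f] into the scalar [ev f Lam]. *)
Lemma rint_uniq f : rint f -> f = ev f Lam *: lamA.
Proof.
move=> fi; have [u uE] := lam_rep (@evl _ _ f).
have fE : f = dualf (fun y => lam (u * y)).
  by apply: evP => y; rewrite dualfE // uE.
have : u = ev f Lam *: 1.
  rewrite -[LHS]Theta_lam -fE /Theta.
  under eq_bigr => i _ do rewrite -linearZ.
  by rewrite -linear_sum fi linearZ /= antipode1.
move=> u1; apply: evP => y; rewrite -uE u1 evrZ ev_lamA.
by rewrite -scalerAl mul1r lamZ.
Qed.

Lemma Lam_neq0 : Lam != 0.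
Proof.
by apply: contra_eq_neq eps_Lam => ->; rewrite (linear0' (@eps_linear _ H)) eq_sym oner_eq0.
Qed.

Lemma antipode_surj h : exists y, h = antipode y.
Proof.
have kS : lker (@antipode k H) == 0%VS.
  apply/lker0P => x y xy; apply/eqP; rewrite -subr_eq0; apply/eqP.
  by apply: antipode_inj; rewrite linearB /= xy subrr.
have : h \in limg (@antipode k H) by rewrite (lker0_limgf kS) memvf.
by case/memv_imgP=> y _ ->; exists y.
Qed.

Lemma dual_antipode_surj f : exists g, f = antipode g.
Proof.
have kS : lker (@antipode k H) == 0%VS.
  apply/lker0P => x y xy; apply/eqP; rewrite -subr_eq0; apply/eqP.
  by apply: antipode_inj; rewrite linearB /= xy subrr.
exists (dualf (fun y => ev f ((@antipode k H)^-1%VF y))); apply: evP => h.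
rewrite ev_antipode dualfE ?lker0_lfunK // => c x y.
by rewrite linearP evl.
Qed.

(** [antipode Lam] is a right integral; compare the two values of its product with the left integral
    [Lam]. *)
Lemma antipode_Lam : antipode Lam = Lam.
Proof.
have R h : antipode Lam * h = eps h *: antipode Lam.
  have [y ->] := antipode_surj h.
  by rewrite -antipodeM LamP linearZ eps_antipode.
have := R Lam; by rewrite LamP eps_antipode eps_Lam !scale1r.
Qed.

Lemma LamPr h : Lam * h = eps h *: Lam.
Proof.
have [y ->] := antipode_surj h.
by rewrite -{1}antipode_Lam -antipodeM LamP linearZ eps_antipode /= antipode_Lam.
Qed.

(** The distinguished group-like element: by [mul_lamA] it measures how far the right integral
    [lamA] is from being a left one. *)
Definition g0 : H := hitR lamA Lam.

Lemma mul_lamA f : f * lamA = ev f g0 *: lamA.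
Proof.
rewrite ev_hitR; apply: rint_uniq; apply/rintP => g.
by rewrite -mulrA lamA_mul scalerAr.
Qed.

Lemma ev_g0M f g : ev (f * g) g0 = ev f g0 * ev g g0.
Proof.
have lL : ev lamA Lam = 1 by rewrite ev_lamA lam_Lam.
have := congr1 (fun u : A => ev u Lam) (mul_lamA (f * g)).
rewrite /= evrZ lL mulr1 => <-.
by rewrite -mulrA !mul_lamA -scalerAr mul_lamA scalerA evrZ lL mulr1 mulrC.
Qed.

Definition glike h := comul h = tpure h h /\ eps h = 1.

Lemma glikeP h : (forall f g, ev (f * g) h = ev f h * ev g h) -> eps h = 1 -> glike h.
Proof.
by move=> hM h1; split=> //; apply: prP => f g; rewrite pr_comul pr_tpure hM.
Qed.

Lemma ev_glikeM f g h : glike h -> ev (f * g) h = ev f h * ev g h.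
Proof. by case=> hh _; rewrite -pr_comul hh pr_tpure. Qed.

Lemma glike_mulS h : glike h -> h * antipode h = 1.
Proof.
have [ml mr] := @mul_bilin k H.
case=> hh h1; have := antipoder h; rewrite hh -/(eps h) h1 scale1r tliftE //.
by split=> [y|x] c s t; rewrite ?linearP ?ml ?mr.
Qed.

Lemma glike_Smul h : glike h -> antipode h * h = 1.
Proof.
have [ml mr] := @mul_bilin k H.
case=> hh h1; have := antipodel h; rewrite hh -/(eps h) h1 scale1r tliftE //.
by split=> [y|x] c s t; rewrite ?linearP ?ml ?mr.
Qed.

Lemma glike1 : glike 1.
Proof. by split; [exact: comul1|exact: counit1]. Qed.

Lemma glikeM (g h : H) : glike g -> glike h -> glike (g * h).
Proof.
case=> gg g1 [hh h1]; split; last by rewrite epsM g1 h1 mulr1.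
by rewrite comulM gg hh tmulE.
Qed.

Lemma glike_sg h : glike h -> sg h = h.
Proof.
move=> gh; rewrite -[RHS]mul1r -[in RHS]antipode1 -(glike_mulS gh) antipodeM.
by rewrite -/(sg h) -mulrA glike_Smul // mulr1.
Qed.

(** The transpose of right multiplication by [g]; for group-like [g] it is multiplicative in [f]
    ([ev_shiftM]). *)
Definition shift f (g : H) : A := dualf (fun y => ev f (y * g)).

Lemma shiftE f (g h : H) : ev (shift f g) h = ev f (h * g).
Proof.
by rewrite dualfE // => c x y; rewrite mulrDl -scalerAl evl.
Qed.

Lemma ev_shiftM f1 f2 (g h : H) : glike g ->
  ev (f1 * f2) (h * g) = ev (shift f1 g * shift f2 g) h.
Proof.
case=> gg _; rewrite -pr_comul comulM gg comul_cp evM.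
have [tl tr] := @tmul_bilin k H H.
rewrite (linear_sum' (tl _)) (linear_sum' (@pr_linear f1 f2)); apply: eq_bigr => i _.
by rewrite tmulE pr_tpure !shiftE.
Qed.

Lemma g0_glike : glike g0.
Proof.
have lL : ev lamA Lam = 1 by rewrite ev_lamA lam_Lam.
apply: glikeP => [f g|]; first exact: ev_g0M.
by rewrite -[eps _]/(ev 1 _) ev_hitR mul1r.
Qed.

(** Translation by [g0] makes [lamA] a left integral, which the antipode turns back into a right
    one; by uniqueness this is a multiple of [lamA]. *)
Lemma lam_g0 : exists2 c : k, c != 0 & forall a, lam (a * g0) = c * lam (antipode a).
Proof.
have gl := g0_glike; pose l := shift lamA g0.
have lE a : ev l a = lam (a * g0) by rewrite shiftE ev_lamA.
have lint f : f * l = ev f 1 *: l.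
  apply: evP => a; pose f' := shift f (antipode g0).
  have -> : f = shift f' g0.
    by apply: evP => y; rewrite !shiftE -mulrA glike_mulS // mulr1.
  rewrite -ev_shiftM // mul_lamA !evrZ !shiftE ev_lamA.
  by rewrite mul1r.
have Sl : rint (antipode l).
  apply/rintP => g; have [f ->] := dual_antipode_surj g.
  by rewrite -antipodeM lint linearZ ev_antipode antipode1.
have := rint_uniq Sl; move: (ev _ Lam) => c Sc.
have E a : lam (a * g0) = c * lam (antipode a).
  have [y ->] := antipode_surj a.
  by rewrite -lE -ev_antipode Sc evrZ ev_lamA -/(sg y) lam_sg.
exists c => //; apply/eqP=> c0.
have := lam_Lam; rewrite -[Lam]mulr1 -(glike_Smul gl) mulrA E c0 mul0r => /eqP.
by rewrite eq_sym oner_eq0.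
Qed.

(* Radford's formula for the fourth power of the antipode of a unimodular Hopf
   algebra. *)
Lemma sg_sg a : sg (sg a) * g0 = g0 * a.
Proof.
have [c c0 E] := lam_g0; have gg := glike_sg g0_glike.
(* Cycle [g0] to the right, pass to [lam (antipode _)] by [E], cycle there and come back; [a] is
   moved round twice and picks up one [sg] each time. *)
have E1 h : lam (g0 * a * h) = lam (sg (sg a) * g0 * h).
  rewrite -mulrA -{1}gg -lam_cyc E antipodeM [in LHS]lam_cyc.
  rewrite -[sg (antipode a)]/(antipode (sg a)) -antipodeM -E -mulrA [in LHS]lam_cyc.
  by rewrite sgM gg.
apply/eqP; rewrite -subr_eq0; apply/eqP; apply: lam_nondegl => h.
by rewrite mulrBl -scaleN1r addrC lam_linear E1 scaleN1r addNr.
Qed.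

(** Associativity of [lamA * f * lamA] compares [ev f g0] with [ev f 1], and the square of [lamA] is
    [lam 1] times [lamA], hence nonzero. *)
Lemma unimodular : lam 1 != 0 -> g0 = 1.
Proof.
move=> D0; apply: ev_sep => f.
have LL : lamA * lamA = lam 1 *: lamA by rewrite lamA_mul ev_lamA.
have := mulrA lamA f lamA; rewrite mul_lamA -scalerAr.
rewrite lamA_mul -scalerAl LL !scalerA => /(congr1 (fun u : A => ev u Lam)).
by rewrite /= !evrZ ev_lamA lam_Lam !mulr1; apply: mulIf.
Qed.

Hypothesis charH : [pchar k] =i pred0.
Hypothesis D0 : lam 1 != 0.

Lemma sgK a : sg (sg a) = a.
Proof. by have := sg_sg a; rewrite unimodular // mulr1 mul1r. Qed.

(** The left side is the trace of [hitR lamA], a map of rank one because [lamA] is now a two-sided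
    integral. *)
Lemma lam_regx : lam (regx H) = lam 1.
Proof.
rewrite -ev_lamA -lintr_hitR.
have E h : hitR lamA h = lam h *: 1.
  apply: ev_sep => g; rewrite ev_hitR mul_lamA unimodular // evrZ ev_lamA.
  by rewrite evlZ mulrC.
by rewrite (eq_lintr E) lintr_rank1 //; exact: lam_linear.
Qed.

Lemma sg_regx : sg (regx H) = regx H.
Proof.
apply: ev_sep => f; rewrite ev_sg -!lintr_hitR.
have E : hitR (antipode (antipode f)) =1 sg \o (hitR f \o sg).
  move=> h; apply: ev_sep => g; rewrite /= ev_sg !ev_hitR ev_sg !antipodeM.
  suff -> : antipode (antipode (antipode (antipode g))) = g by [].
  by apply: evP => y; rewrite !ev_antipode -/(sg y) -/(sg (sg y)) sgK.
rewrite (eq_lintr E) lintrC; last 2 first.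
- exact: sg_linear.
- by move=> c x y /=; rewrite sg_linear hitR_linear.
by apply: (@eq_lintr _ H) => h /=; rewrite sgK.
Qed.

Let xi : H := n%:R^-1 *: regx H.

Let n_neq0 : n%:R != 0 :> k.
Proof.
by move/pcharf0P: charH => ->; rewrite -lt0n; exact: (adim_gt0 {:H}%AS).
Qed.

Let xiK : xi * xi = xi.
Proof.
rewrite /xi -scalerAl -scalerAr regx_sqr !scalerA; congr (_ *: _).
by rewrite -mulrA mulVf ?mulr1.
Qed.

Let eps_xi : eps xi = 1.
Proof.
rewrite /xi (linearZ' (@eps_linear _ H)) /regx (linear_sum' (@eps_linear _ H)).
under eq_bigr => i _ do rewrite regX_counit eqxx.
by rewrite sumr_const card_ord [LHS]mulVf.
Qed.

Let sg_xi : sg xi = xi.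
Proof. by rewrite /xi (linearZ' sg_linear) sg_regx. Qed.

(* The trace of [sg] is [2 * rk Q - n], hence at most [n] in absolute value, and it
   is also [n] times an integer. As it is not [0], and [Q 1 != 0], it is [n]. *)
Lemma sg_id a : sg a = a.
Proof.
pose Q := fun y => 2%:R^-1 *: (y + sg y).
pose P y := y * xi.
have two0 : 2%:R != 0 :> k by move/pcharf0P: charH => ->.
have lQ : linear Q.
  move=> c x y; rewrite /Q sg_linear scalerA mulrC -scalerA -scalerDr.
  by congr (_ *: _); rewrite scalerDr addrACA.
have lP : linear P by move=> c x y; rewrite /P mulrDl scalerAl.
have sgQ y : sg (Q y) = Q y.
  by rewrite /Q (linearZ' sg_linear) (linearD' sg_linear) sgK addrC.
have QQ y : Q (Q y) = Q y.
  by rewrite {1}/Q sgQ -mulr2n -scaler_nat scalerA mulVf // scale1r.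
pose QP y := Q (P y).
have cQP y : Q (P y) = P (Q y).
  by rewrite /Q /P sgM sg_xi -scalerAl mulrDl.
have PP y : P (P y) = P y by rewrite /P -mulrA xiK.
have lintrsg : lintr sg = 2%:R * (rk Q)%:R - n%:R :> k.
  rewrite -(lintr_idem lQ QQ) -(@lintr_id _ H) -lintrZ -mulN1r addrC -lintr_linear.
  apply: (@eq_lintr _ H) => y; rewrite /Q scalerA mulfV // scale1r scaleN1r.
  by rewrite addKr.
have D1 : lam 1 = lintr sg by apply: (@eq_lintr _ H) => y; rewrite mulr1.
have QPl : linear QP by move=> c x y; rewrite /QP lP lQ.
have QPi y : QP (QP y) = QP y by rewrite /QP -cQP PP QQ.
(* By [lam_regx], [lam 1] is [n * lam xi], and [lam xi] is the trace of [sg] composed with the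
   projection [P]. *)
have D2 : lam 1 = n%:R * (2%:R * (rk QP)%:R - (rk P)%:R).
  have -> : lam 1 = n%:R * lam xi by rewrite -lam_regx /xi lamZ mulVKf.
  congr (_ * _); rewrite -(lintr_idem QPl QPi) -(lintr_idem lP PP) -lintrZ.
  rewrite -mulN1r addrC -lintr_linear; apply: (@eq_lintr _ H) => y /=.
  by rewrite /QP /Q scalerA mulfV // scale1r scaleN1r addKr /P sgM sg_xi.
have rkQ : rk Q = n.
  have Q0 : (0 < rk Q)%N.
    rewrite lt0n; apply/eqP => /(rk0 lQ) /(_ 1) /eqP.
    rewrite /Q sg1 -mulr2n -scaler_nat scalerA mulVf // scale1r.
    by rewrite oner_eq0.
  have Qn := rk_le Q.
  have E : (2 * rk Q + n * rk P = n + n * (2 * rk QP))%N.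
    apply: (natr_inj0 charH); rewrite [LHS]natrD [RHS]natrD !natrM.
    move: lintrsg; rewrite -D1 D2 => /eqP; rewrite eq_sym subr_eq => /eqP ->.
    by rewrite mulrBr addrAC subrK addrC.
  have D' : (2 * rk Q != n)%N.
    apply/eqP=> Qn'; case/eqP: D0; rewrite D1 lintrsg -natrM Qn' subrr.
    by [].
  (* By [E], 2 rk Q = n m with m = 1 + 2 rk QP - rk P. Here m = 0 contradicts [Q0], m = 1
     contradicts [D'], and m >= 3 contradicts [Qn]. *)
  have [le|lt] := leqP (rk P) (1 + 2 * rk QP).
    have : (2 * rk Q = n * (1 + 2 * rk QP - rk P))%N.
      by rewrite mulnBr mulnDr muln1 -E addnK.
    case: (_ - _)%N => [|[|[|m]]].
    - by rewrite muln0 => /eqP; rewrite muln_eq0 /= => /eqP r0; rewrite r0 in Q0.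
    - by rewrite muln1 => e; rewrite e eqxx in D'.
    - by rewrite mulnC => /eqP; rewrite eqn_pmul2r // => /eqP.
    move=> e; have: (n * m.+3 <= n * 2)%N by rewrite -e mulnC leq_mul2r Qn orbT.
    by rewrite leq_pmul2l // (leq_trans Q0 Qn).
  have : (n * rk P <= n * (1 + 2 * rk QP))%N.
    by rewrite [leqRHS]mulnDr muln1 -E leq_addl.
  by rewrite leq_pmul2l ?(leq_trans Q0 Qn) // leqNgt lt.
have := rk_full lQ QQ rkQ a => E.
by rewrite -[in LHS]E sgQ.
Qed.

Lemma lamE a : lam a = lintr (fun y => y * a).
Proof. by apply: (@eq_lintr _ H) => y; rewrite sg_id. Qed.

Lemma lam1 : lam 1 = n%:R.
Proof.
by rewrite lamE -(@lintr_id _ H); apply: (@eq_lintr _ H) => y; rewrite mulr1.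
Qed.

Lemma lamC a h : lam (a * h) = lam (h * a).
Proof. by rewrite lam_cyc sg_id. Qed.

(** Right multiplication by the idempotent [xi] has trace 1, hence rank 1, and fixes [Lam]. So [xi]
    lies on the line of [Lam], and the counit normalises it. *)
Lemma regxE : regx H = n%:R *: Lam.
Proof.
pose P y := y * xi.
have lP : linear P by move=> c x y; rewrite /P mulrDl scalerAl.
have PP y : P (P y) = P y by rewrite /P -mulrA xiK.
suff xiL : xi = Lam by rewrite -xiL /xi scalerA mulfV // scale1r.
have rP : rk P = 1%N.
  apply: (natr_inj0 charH); rewrite -(lintr_idem lP PP) -lamE.
  by rewrite /xi lamZ lam_regx lam1 mulVf.
have [phi [v [_ Pv]]] := rk1P lP rP.
have PL : P Lam = Lam by rewrite /P LamPr eps_xi scale1r.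
have v0 : phi Lam != 0.
  apply/eqP=> e; have := Lam_neq0; rewrite -PL Pv e scale0r.
  by rewrite eqxx.
have E : xi = (phi 1 / phi Lam) *: Lam.
  rewrite -{2}PL [in RHS]Pv scalerA divfK // -Pv /P mul1r.
  by [].
have := eps_xi; rewrite E (linearZ' (@eps_linear _ H)) eps_Lam.
by rewrite [_ *: _]mulr1 => ->; rewrite scale1r.
Qed.

Lemma lintr_hitR_Lam f : lintr (hitR f) = n%:R * ev f Lam.
Proof. by rewrite lintr_hitR regxE evlZ. Qed.

End Integral.
End Larson.

(** * Primitive idempotents *)

Section Idempotents.
Variables (k : closedFieldType) (B : falgType k).
Implicit Types (a y u v f : B) (U : {vspace B}).
Local Notation ha := (@horner_alg k B).

Lemma ann_poly y : exists2 p : {poly k}, p != 0 & ha y p = 0.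
Proof.
pose n := \dim {:B}; pose M : 'M[k]_(n.+1, n) := \matrix_(i, j) crd j (y ^+ i).
have : kermx M != 0.
  by rewrite kermx_eq0 /row_free neq_ltn ltnS rank_leq_col.
case/rowV0Pn=> v /sub_kermxP vM v0; exists (rVpoly v).
  by apply: contraNneq v0 => v0; rewrite -[v]rVpolyK v0 linear0.
rewrite /rVpoly poly_def raddf_sum /=; apply: crdP => j.
rewrite crd_sum (linear0' (@crd_linear _ _ j)).
transitivity ((v *m M) ord0 j); last by rewrite vM mxE.
rewrite mxE; apply: eq_bigr => i _.
rewrite valK -mul_polyC rmorphM rmorphXn /= horner_algC horner_algX.
by rewrite -scalerAl mul1r crdZ mxE.
Qed.

Lemma ha_eigen f a v (s : seq k) : f * a = a -> v != 0 -> f * v = v ->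
    ha a (\prod_(c <- s) ('X - c%:P)) * v = 0 ->
  exists (c : k) w, [/\ w != 0, f * w = w & a * w = c *: w].
Proof.
move=> fa; elim: s v => [|c s IH] v v0 fv.
  by rewrite big_nil rmorph1 mul1r => v1; rewrite v1 eqxx in v0.
rewrite big_cons mulrC rmorphM rmorphB /= horner_algX horner_algC -mulrA.
have [w0 _|w0] := eqVneq ((a - c%:A) * v) 0; last apply: IH => //.
  exists c, v; split=> //; apply/eqP; rewrite -subr_eq0 -w0 mulrBl.
  by rewrite -scalerAl mul1r.
by rewrite mulrA mulrBr fa -scalerAr mulr1 mulrBl -scalerAl fv mulrBl -scalerAl mul1r.
Qed.

(** The extra factor [y] is there because [U] may lack the unit of [B]. *)
Lemma memv_ha U y p : (forall u v, u \in U -> v \in U -> u * v \in U) ->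
  y \in U -> y * ha y p \in U.
Proof.
move=> UM Uy; elim/poly_ind: p => [|p c IH]; first by rewrite rmorph0 mulr0 mem0v.
rewrite rmorphD rmorphM /= horner_algX horner_algC mulrDr mulrA -scalerAr mulr1.
by apply: memvD; [exact: UM|exact: memvZ].
Qed.

(* Fitting's lemma: the idempotent comes from a Bezout relation between the factors
   ['X^m.+1] and [q] of a polynomial annihilating [y]. *)
Lemma nonnil_idem U y : (forall u v, u \in U -> v \in U -> u * v \in U) ->
    y \in U -> (forall d, y ^+ d != 0) ->
  exists u w, [/\ u \in U, u != 0, u * u = u, u = y * w & u = w * y].
Proof.
move=> UM Uy ynil; have [p p0 py] := ann_poly y.
have [m [q]] := multiplicity_XsubC p 0; rewrite p0 /= subr0 => q0 pE.
have cop : coprimep q ('X^(m.+1)).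
  by rewrite coprimep_expr // -['X]subr0 coprimep_XsubC.
have /Bezout_coprimepP[[r s] /=] := cop.
case/eqpP=> -[c d] /= /andP[c0 d0]; rewrite -[d *: 1]mul_polyC mulr1 => rs.
pose s' := (d^-1 * c) *: s; pose r' := (d^-1 * c) *: r.
have rs1 : r' * q + s' * 'X^(m.+1) = 1.
  rewrite -!scalerAl -scalerDr -scalerA rs -mul_polyC -polyCM mulVf //.
have qX : ha y (q * 'X^(m.+1)) = 0.
  by rewrite exprSr mulrA -pE rmorphM /= py mul0r.
pose u := ha y (s' * 'X^(m.+1)); exists u, (ha y (s' * 'X^m)).
have uE : u = y * ha y (s' * 'X^m).
  by rewrite /u exprS mulrCA rmorphM /= horner_algX.
split=> //.
- by rewrite uE; exact: memv_ha.
- apply: contraNneq (ynil m.+1) => u0.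
  have : ha y (r' * q) = 1.
    by rewrite -[RHS](rmorph1 (ha y)) -rs1 rmorphD /= -/u u0 addr0.
  move=> rq; rewrite -[X in X == 0]mul1r -rq -[y in y ^+ _](horner_algX y).
  by rewrite -rmorphXn -rmorphM -mulrA rmorphM /= qX mulr0.
- suff E : s' * 'X^(m.+1) * (s' * 'X^(m.+1)) =
      s' * 'X^(m.+1) - q * 'X^(m.+1) * (s' * r').
    have qX' : ha y (q * 'X^(m.+1) * (s' * r')) = 0 by rewrite rmorphM /= qX mul0r.
    by rewrite /u -rmorphM E rmorphB /= qX' subr0.
  rewrite [X in _ * X](_ : _ = 1 - r' * q); last by rewrite -rs1 addrC addKr.
  rewrite mulrBr mulr1; congr (_ - _).
  by rewrite mulrACA mulrC [q * _]mulrC.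
by rewrite /u exprSr mulrA rmorphM /= horner_algX.
Qed.

Definition corner U f : {vspace B} := ((amull f \o amulr f)%VF @: U)%VS.

Lemma cornerP U f x :
  reflect (exists2 a, a \in U & x = f * a * f) (x \in corner U f).
Proof.
apply: (iffP memv_imgP) => -[a Ua ->]; exists a => //.
  by rewrite lfunE /= !lfunE /= mulrA.
by rewrite lfunE /= !lfunE /= mulrA.
Qed.

Definition orthogonal_idem (I : finType) (w : I -> B) :=
  forall i j, w i * w j = if i == j then w i else 0.

(** Primitivity in the form it takes over an algebraically closed field: the corner at [w] lies on
    the line of [w]. *)
Definition primitive_in U w := forall a, a \in U -> exists c : k, w * a * w = c *: w.

(** An element [a] of the corner off the line of [f] has an eigenvector [v] in f B. Then e = a - c f
    is nonzero and kills [v]; Fitting's lemma for a non-nilpotent f b e gives an idempotent that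
    also kills [v], so it differs from [f]. *)
Lemma idem_split U f : (forall u v, u \in U -> v \in U -> u * v \in U) ->
    (forall a, a \in U -> a != 0 -> exists2 b, b \in U & forall d, (b * a) ^+ d != 0) ->
    f \in U -> f * f = f -> ~~ (corner U f <= <[f]>)%VS ->
  exists u, [/\ u \in U, u * u = u, f * u = u, u * f = u & (u != 0) && (u != f)].
Proof.
move=> UM Unil Uf ff /subvPn[a' /cornerP[a0 Ua0 ->]].
set a := f * a0 * f => a_line.
have fa : f * a = a by rewrite /a !mulrA ff.
have af : a * f = a by rewrite /a -!mulrA ff.
have Ua : a \in U by rewrite !UM.
have f0 : f != 0 by apply: contraNneq a_line => f0; rewrite /a f0 !mul0r mem0v.
have [p p0 pa] := ann_poly a; have [s ps] := closed_field_poly_normal p.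
have [c [v [v0 fv av]]] : exists (c : k) v, [/\ v != 0, f * v = v & a * v = c *: v].
  apply: (@ha_eigen f a f s) => //.
  have -> : \prod_(z <- s) ('X - z%:P) = (lead_coef p)^-1 *: p.
    by rewrite {2}ps scalerA mulVf ?scale1r // lead_coef_eq0.
  by rewrite -mul_polyC rmorphM /= pa mulr0 mul0r.
pose e := a - c *: f.
have Ue : e \in U by rewrite memvB // memvZ.
have e0 : e != 0.
  by apply: contraNneq a_line => /eqP; rewrite subr_eq0 => /eqP ->; rewrite memvZ // memv_line.
have ef : e * f = e by rewrite mulrBl af -scalerAl ff.
have ev : e * v = 0 by rewrite mulrBl av -scalerAl fv subrr.
have [b Ub bnil] := Unil e Ue e0; pose y := f * b * e.
have bE d : (b * e) ^+ d.+1 = b * e * y ^+ d.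
  elim: d => [|d IH]; first by rewrite expr1 expr0 mulr1.
  rewrite exprS IH exprS /y !mulrA; congr (_ * _).
  by rewrite -[b * e * f]mulrA ef.
have Uy : y \in U by rewrite !UM.
have ynil d : y ^+ d != 0.
  by apply: contraNneq (bnil d.+1) => yd; rewrite bE yd mulr0.
have [u [w [Uu u0 uu uy uw]]] := nonnil_idem UM Uy ynil.
exists u; split=> //; first by rewrite uy /y !mulrA ff.
  by rewrite uw /y -!mulrA ef.
rewrite u0; apply: contraNneq v0 => uf; rewrite -fv -uf uw.
by rewrite /y -!mulrA ev !mulr0.
Qed.

(** Induction on the dimension of the corner: for f = u + (f - u) both smaller corners miss [f]. *)
Lemma idem_decomp U f : (forall u v, u \in U -> v \in U -> u * v \in U) ->
    (forall a, a \in U -> a != 0 -> exists2 b, b \in U & forall d, (b * a) ^+ d != 0) ->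
    f \in U -> f * f = f ->
  exists (I : finType) (w : I -> B),
    [/\ forall i, w i \in U, forall i, w i != 0, orthogonal_idem w,
        \sum_i w i = f & forall i, primitive_in U (w i)].
Proof.
move=> UM Unil; have [m] := ubnP (\dim (corner U f)).
elim: m f => // m IH f ltm Uf ff.
have [f0|f0] := eqVneq f 0.
  exists void, (fun _ => 0); split=> [||[]||]; try by case.
  by rewrite f0 big_pred0 // => -[].
have [/subvP sub|] := boolP (corner U f <= <[f]>)%VS.
  exists unit, (fun _ => f); split=> //.
    by rewrite big_const card_unit iterS addr0.
  move=> _ a Ua; have /sub/vlineP[c ->] : f * a * f \in corner U f.
    by apply/cornerP; exists a.
  by exists c.
case/(idem_split UM Unil Uf ff) => u [Uu uu fu uf /andP[u0 nuf]].
have fCf : f \in corner U f by apply/cornerP; exists f; rewrite ?ff.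
have ltc v : v \in U -> v * v = v -> f * v = v -> v * f = v -> v != f ->
    (\dim (corner U v) < m)%N.
  move=> Uv vv fv vf nvf; rewrite -ltnS; apply: leq_trans ltm; rewrite ltnS.
  have sub : (corner U v <= corner U f)%VS.
    apply/subvP=> _ /cornerP[a Ua ->]; apply/cornerP.
    exists (v * a * v); first by rewrite !UM.
    by rewrite !mulrA fv -!mulrA vf.
  rewrite ltn_neqAle dimvS // andbT; apply: contra nvf.
  rewrite (dimv_leqif_sup sub) => /subvP/(_ f fCf)/cornerP[a Ua fE].
  by rewrite -vf {1}fE !mulrA vv -fE.
pose v := f - u.
have uv : u * v = 0 by rewrite mulrBr uf uu subrr.
have vu : v * u = 0 by rewrite mulrBl fu uu subrr.
have [|I [w [wU w0 ow sw pw]]] := IH u _ Uu uu; first exact: ltc.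
have Uv : v \in U by rewrite memvB.
have vv : v * v = v by rewrite {1}/v mulrBl uv subr0 mulrBr ff fu.
have fv : f * v = v by rewrite mulrBr ff fu.
have vf : v * f = v by rewrite mulrBl ff uf.
have nvf : v != f by rewrite -subr_eq0 addrAC subrr add0r oppr_eq0.
have [|J [z [zU z0 oz sz pz]]] := IH v _ Uv vv; first exact: ltc.
have wu i : u * w i = w i /\ w i * u = w i.
  rewrite -sw mulr_suml mulr_sumr; split; rewrite (bigD1 i) //= ow eqxx big1 ?addr0 //.
    by move=> j /negPf nj; rewrite ow nj.
  by move=> j nj; rewrite ow eq_sym (negPf nj).
have zv j : v * z j = z j /\ z j * v = z j.
  rewrite -sz mulr_suml mulr_sumr; split; rewrite (bigD1 j) //= oz eqxx big1 ?addr0 //.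
    by move=> i /negPf ni; rewrite oz ni.
  by move=> i ni; rewrite oz eq_sym (negPf ni).
exists (I + J)%type, (fun x => match x with inl i => w i | inr j => z j end).
split.
- by case.
- by case.
- move=> [i|j] [i'|j'] /=; rewrite ?ow ?oz //.
    by rewrite -(wu i).2 -(zv j').1 mulrA -(mulrA _ u) uv mulr0 mul0r.
  by rewrite -(zv j).2 -(wu i').1 mulrA -(mulrA _ v) vu mulr0 mul0r.
- by rewrite big_sumType /= sw sz addrC subrK.
by case.
Qed.

End Idempotents.

(** * Peirce components of a regular algebra *)

Section Peirce.
Variables (k : closedFieldType) (B : falgType k).
Hypothesis char0 : [pchar k] =i pred0.
Hypothesis vnr : forall a : B, exists b, a * b * a = a.
Variables (I : finType) (w : I -> B).
Hypothesis wow : orthogonal_idem w.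
Hypothesis w0 : forall i, w i != 0.
Hypothesis w1 : \sum_i w i = 1.
Hypothesis wprim : forall i, primitive_in fullv (w i).

Lemma wK i : w i * w i = w i. Proof. by rewrite wow eqxx. Qed.

Definition peirce i j (y : B) := w i * y * w j.

Lemma peirce_linear i j : linear (peirce i j).
Proof. by move=> c x y; rewrite /peirce mulrDr mulrDl -scalerAr -scalerAl. Qed.

Lemma peirceK i j y : peirce i j (peirce i j y) = peirce i j y.
Proof. by rewrite /peirce !mulrA wK -!mulrA wK. Qed.

Lemma peirce_prim i a : exists c : k, w i * a * w i = c *: w i.
Proof. by apply: wprim; rewrite memvf. Qed.

(** A boolean test for a nonzero Peirce component, that is, for [w i] and [w j] to lie in one matrix
    block: the component has dimension at most 1, and the trace of the projection onto it is 0 or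
    1. *)
Definition linked i j := lintr (peirce i j) != 0.

(** With a quasi-inverse from [vnr], the two products are nonzero idempotents on the lines of [w i]
    and [w j], hence equal to these. *)
Lemma peirce_inv i j a : peirce i j a != 0 ->
  exists b, peirce i j a * peirce j i b = w i /\ peirce j i b * peirce i j a = w j.
Proof.
set u := peirce i j a => u0; have [b ub] := vnr u; exists b.
have uv : u * peirce j i b * u = u.
  have uj : u * w j = u by rewrite /u /peirce -mulrA wK.
  have iu : w i * u = u by rewrite /u /peirce !mulrA wK.
  by move: (u) uj iu ub => x uj iu ub; rewrite -[RHS]ub /peirce !mulrA uj -(mulrA _ (w i)) iu.
have idem_line l x : x = w l * x * w l -> x * x = x -> x != 0 -> x = w l.
  move=> xE xx x0; have [c xc] := peirce_prim l x.
  move: xE; rewrite xc => xE; move: xx; rewrite xE -scalerAl -scalerAr wK scalerA => /eqP.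
  rewrite -subr_eq0 -scalerBl scaler_eq0 (negPf (w0 l)) orbF -{3}[c]mulr1 -mulrBr.
  rewrite mulf_eq0 subr_eq0; case/orP=> /eqP c1; last by rewrite c1 scale1r.
  by rewrite xE c1 scale0r eqxx in x0.
split; apply: idem_line.
- by rewrite /u /peirce !mulrA wK -!mulrA wK.
- by rewrite mulrA uv.
- by apply: contraNneq u0 => v0; rewrite -uv v0 mul0r.
- by rewrite /u /peirce !mulrA wK -!mulrA wK.
- by rewrite mulrA -(mulrA (peirce j i b)) -mulrA mulrA -mulrA uv.
- by apply: contraNneq u0 => v0; rewrite -uv -mulrA v0 mulr0.
Qed.

Lemma peirce_line i j a y : peirce i j a != 0 ->
  exists c : k, peirce i j y = c *: peirce i j a.
Proof.
move=> /peirce_inv[b [_ bu]].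
have [c yE] := peirce_prim i (y * w j * b); exists c.
have -> : peirce i j y = peirce i j y * peirce j i b * peirce i j a.
  by rewrite -mulrA bu /peirce -!mulrA wK.
have -> : peirce i j y * peirce j i b = c *: w i.
  by rewrite -yE /peirce !mulrA -(mulrA _ (w j) (w j)) wK.
by rewrite -scalerAl /peirce !mulrA wK.
Qed.

Lemma peirce_tr1 i j a : peirce i j a != 0 -> lintr (peirce i j) = 1.
Proof.
move=> a0; set u := peirce i j a in a0.
have uK : peirce i j u = u by exact: peirceK.
have [m m0] : exists m, crd m u != 0.
  apply/existsP; apply: contraR a0; rewrite negb_exists => /forallP z.
  apply/eqP/crdP => m; rewrite (linear0' (@crd_linear _ _ m)).
  by apply/eqP; have := z m; rewrite negbK.
have E : peirce i j =1 fun y => (crd m (peirce i j y) / crd m u) *: u.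
  by move=> y; have [c ->] := peirce_line y a0; rewrite -/u crdZ mulfK.
rewrite (eq_lintr E) lintr_rank1 ?uK ?mulfV // => c x y.
by rewrite peirce_linear crd_linear mulrDl scalerAl.
Qed.

Lemma linkedP i j : linked i j <-> exists a, peirce i j a != 0.
Proof.
split=> [|[a /peirce_tr1]]; last by rewrite /linked => ->; rewrite oner_eq0.
have [/existsP[l l0] _|] := boolP [exists l, peirce i j (bas l) != 0].
  by exists (bas l).
rewrite negb_exists => /forallP z; rewrite /linked lintrE big1 ?eqxx // => l _.
by have /negPn/eqP -> := z l; exact: (linear0' (@crd_linear _ _ l)).
Qed.

Lemma peirce_tr i j : lintr (peirce i j) = (linked i j)%:R.
Proof.
have [/linkedP[a /peirce_tr1]|] := boolP (linked i j); first by [].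
by rewrite negbK => /eqP.
Qed.

Lemma linked_refl i : linked i i.
Proof. by apply/linkedP; exists (w i); rewrite /peirce !wK. Qed.

Lemma linked_sym i j : linked i j -> linked j i.
Proof.
move/linkedP=> [a /peirce_inv[b [ab _]]]; apply/linkedP; exists b.
by apply: contraNneq (w0 i) => b0; rewrite -ab b0 mulr0.
Qed.

Lemma linked_trans j i l : linked i j -> linked j l -> linked i l.
Proof.
move=> /linkedP[a /peirce_inv[a' [_ aa]]] /linkedP[b b0]; apply/linkedP.
exists (peirce i j a * peirce j l b); apply: contraNneq b0.
have -> : peirce i l (peirce i j a * peirce j l b) = peirce i j a * peirce j l b.
  by rewrite /peirce !mulrA wK -!mulrA wK.
move=> ab0; have <- : w j * peirce j l b = peirce j l b by rewrite /peirce !mulrA wK.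
by rewrite -aa -mulrA ab0 mulr0.
Qed.

(** [pick] depends only on the predicate [linked i], thus on the class of [i], so linked indices get
    the same representative. *)
Definition rep i := odflt i [pick j | linked i j].

Lemma linked_rep i : linked i (rep i).
Proof. by rewrite /rep; case: pickP => //= /(_ i); rewrite linked_refl. Qed.

Lemma linkedE i j : linked i j = (rep i == rep j).
Proof.
apply/idP/eqP=> [lij|rij].
  rewrite /rep -(@eq_pick _ (linked i) (linked j)) => [|l]; last first.
    by apply/idP/idP; apply: linked_trans => //; exact: linked_sym.
  by case: pickP => //= /(_ i); rewrite linked_refl.
by apply: linked_trans (linked_rep i) _; rewrite rij; apply/linked_sym/linked_rep.
Qed.

Lemma repK i : rep (rep i) = rep i.
Proof. by apply/esym/eqP; rewrite -linkedE linked_rep. Qed.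

Lemma trace_linked (f : B -> k) i j : (forall a b, f (a * b) = f (b * a)) ->
  linked i j -> f (w i) = f (w j).
Proof.
by move=> fC /linkedP[a /peirce_inv[b [<- <-]]]; rewrite fC.
Qed.

End Peirce.

(** * Roots of unity, and independence of group-like elements *)

Lemma intr_eq0_char0 (k : fieldType) (m : int) : [pchar k] =i pred0 ->
  (m%:~R == 0 :> k) = (m == 0).
Proof.
move/pcharf0P=> ch; case: m => m; first by rewrite -pmulrn ch.
by rewrite NegzE mulrNz oppr_eq0 -pmulrn ch oppr_eq0.
Qed.

(** A common root of [P] and ['X^M - 1] in [k] makes the integer resultant vanish in characteristic
    0, hence vanish. The gcd over the integers is then nonconstant and has a root in [algC]. *)
Lemma unity_transfer (k : fieldType) (M : nat) (z : k) (P : {poly int}) :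
    [pchar k] =i pred0 -> (0 < M)%N -> z ^+ M = 1 ->
    (map_poly intr P).[z] = 0 ->
  exists x : algC, x ^+ M = 1 /\ (map_poly intr P).[x] = 0.
Proof.
move=> ch M0 zM Pz; pose Q : {poly int} := 'X^M - 1.
have Qz (F : fieldType) (x : F) : (map_poly intr Q).[x] = x ^+ M - 1.
  by rewrite rmorphB rmorph1 /= map_polyXn !hornerE.
have sQ : size Q = M.+1 by rewrite size_XnsubC.
(* [resultant_in_ideal] asks for nonconstant polynomials; a constant [P] vanishing at [z] is 0, and
   x = 1 serves. *)
have [sP|sP] := leqP (size P) 1.
  have Pc := size1_polyC sP; have : P`_0 == 0.
    by rewrite -(intr_eq0_char0 _ ch) -[X in X == 0](hornerC _ z) -map_polyC -Pc /= Pz.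
  by move/eqP=> P0; exists 1; rewrite expr1n Pc P0 rmorph0 horner0.
have res0 : resultant P Q == 0.
  have [|[u v] /= _ E] := @resultant_in_ideal _ P Q sP; first by rewrite sQ.
  rewrite -(intr_eq0_char0 _ ch) -[X in X == 0](hornerC _ z) -map_polyC /= E.
  by rewrite rmorphD !rmorphM /= !hornerE Pz Qz zM subrr !mulr0 addr0.
have : (size (gcdp P Q) > 1)%N by rewrite -resultant_eq0.
have injC : injective (intr : int -> algC) by exact: intr_inj.
rewrite -(size_map_inj_poly injC) // => sg1.
have [x /rootP gx] : exists x, root (map_poly (intr : int -> algC) (gcdp P Q)) x.
  by apply/closed_rootP; rewrite neq_ltn sg1 orbT.
have dx (p : {poly int}) : gcdp P Q %| p -> (map_poly intr p).[x] = 0.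
  case/Pdiv.Idomain.dvdpP => -[c q] /= c0 /(congr1 (map_poly (intr : int -> algC))).
  rewrite -mul_polyC !rmorphM /= map_polyC => /(congr1 (fun r => r.[x])).
  rewrite !hornerM gx mulr0 hornerC => /eqP; rewrite mulf_eq0 intr_eq0 (negPf c0).
  by move/eqP.
exists x; split; last by apply: dx; exact: dvdp_gcdl.
by apply/eqP; rewrite -subr_eq0 -Qz dx // dvdp_gcdr.
Qed.

Lemma prim_root_exists (k : closedFieldType) (M : nat) : [pchar k] =i pred0 ->
  (0 < M)%N -> exists z : k, M.-primitive_root z.
Proof.
move=> /pcharf0P ch M0; have [r] := closed_field_poly_normal ('X^M - 1 : {poly k}).
rewrite (monicP (monicXnsubC 1 M0)) scale1r => rE.
have ur : uniq r.
  by rewrite -separable_prod_XsubC -rE separable_Xn_sub_1 // ch -lt0n.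
have : has M.-primitive_root r.
  apply: has_prim_root => //.
    by apply/allP=> x; rewrite -root_prod_XsubC -rE.
  by rewrite -ltnS -(size_prod_XsubC r id) -rE size_XnsubC.
by case/hasP=> z _ pz; exists z.
Qed.

(** If g = sum of c_i s_i, evaluating products of coordinate forms at the group-like [g] gives c_i
    c_j = 0 for distinct indices and c_i c_i = c_i. So a single coefficient is 1, and [g] is already
    in [s]. *)
Lemma glike_free (k : fieldType) (H : hopfType k) (s : seq H) :
  uniq s -> (forall g, g \in s -> glike g) -> free s.
Proof.
elim: s => [|g s IH] /=; first by rewrite nil_free.
case/andP=> gs us gls; have fs : free s.
  by apply: IH => // h hs; apply: gls; rewrite inE hs orbT.
rewrite free_cons fs andbT; apply/negP=> /(coord_span (X := in_tuple s)) gE.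
pose c i : k := coord (in_tuple s) i g; pose f i : hdual H := dualf (coord (in_tuple s) i).
have fE i h : ev (f i) h = coord (in_tuple s) i h by rewrite dualfE //; exact: linearP.
have fs' i (j : 'I_(size s)) : ev (f i) s`_j = (i == j)%:R by rewrite fE coord_free // eq_sym.
have gg : glike g by apply: gls; rewrite mem_head.
have gsl (l : 'I_(size s)) : glike (s`_l).
  by apply: gls; rewrite inE mem_nth ?orbT.
have cc i j : c i * c j = (i == j)%:R * c i.
  rewrite /c -!fE -ev_glikeM // {1}gE evl_sum (bigD1 i) //= evlZ.
  rewrite ev_glikeM // !fs' eqxx mul1r big1 ?addr0 => [|l nl].
    by rewrite mulrC eq_sym fE.
  by rewrite evlZ ev_glikeM // !fs' eq_sym (negPf nl) mul0r mulr0.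
have [i ci] : exists i, c i != 0.
  apply/existsP; apply: contraT; rewrite negb_exists => /forallP c0.
  case: gg => _; rewrite gE big1 => [|l _].
    by rewrite (linear0' (@eps_linear _ H)) => /eqP; rewrite eq_sym oner_eq0.
  by have /negPn/eqP := c0 l; rewrite /c => ->; rewrite scale0r.
have c1 : c i = 1 by have := cc i i; rewrite eqxx mul1r -[X in _ = X]mulr1 => /(mulfI ci).
case/negP: gs; rewrite gE (bigD1 i) //= -/(c i) c1 scale1r big1 ?addr0 ?mem_nth // => j nj.
have := cc i j; rewrite c1 mul1r eq_sym (negPf nj) mul0r /c => ->.
by rewrite scale0r.
Qed.

Lemma glikeX (k : fieldType) (H : hopfType k) (g : H) m : glike g -> glike (g ^+ m).
Proof.
move=> gg; elim: m => [|m IH]; first exact: glike1.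
by rewrite exprS; apply: glikeM.
Qed.

Lemma glike_order (k : fieldType) (H : hopfType k) (g : H) : glike g ->
  exists2 N, (0 < N)%N & g ^+ N = 1.
Proof.
move=> gg; pose s := mkseq (fun i => g ^+ i) (\dim {:H}).+1.
have [us|] := boolP (uniq s).
  have : free s by apply: glike_free => // h /mapP[i _ ->]; exact: glikeX.
  rewrite /free => /eqP d; have := dimvS (subvf <<s>>%VS).
  by rewrite d size_mkseq ltnn.
case/(uniqPn 0) => i [j [ij]]; rewrite size_mkseq => jn.
rewrite !nth_mkseq ?(ltn_trans ij) // => E; exists (j - i)%N; first by rewrite subn_gt0.
have gi := glikeX i gg; rewrite -(glike_Smul gi) {2}E -{2}(subnKC (ltnW ij)) exprD.
by rewrite mulrA glike_Smul // mul1r.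
Qed.

(** * The trace of the square of the antipode *)

Section TraceNonzero.
Variables (k : closedFieldType) (H : hopfType k) (Lam : H).
Hypothesis char0 : [pchar k] =i pred0.
Hypothesis vnr : forall a : H, exists b, a * b * a = a.
Hypothesis LamP : forall h, h * Lam = eps h *: Lam.
Hypothesis eps_Lam : eps Lam = 1.
Local Notation n := (\dim {:H}).
Implicit Types (a h y : H).

Lemma sg_finite_order : exists2 M, (0 < M)%N & forall a, iter M (@sg k H) a = a.
Proof.
have gg := g0_glike LamP eps_Lam; have [N N0 gN] := glike_order gg.
exists N.*2; first by rewrite double_gt0.
move=> a; have E m : iter m.*2 (@sg k H) a * g0 Lam ^+ m = g0 Lam ^+ m * a.
  elim: m => [|m IH]; first by rewrite expr0 mulr1 mul1r.
  rewrite doubleS !iterS exprS mulrA (sg_sg LamP eps_Lam) -mulrA IH.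
  by rewrite mulrA.
by have := E N; rewrite gN mulr1 mul1r.
Qed.

Lemma iter_sgM m a h : iter m (@sg k H) (a * h) = iter m (@sg k H) a * iter m (@sg k H) h.
Proof. by elim: m => //= m ->; rewrite sgM. Qed.

Definition tau a : k := lintr (fun y => y * a).

Lemma tau_linear : linear (tau : H -> k^o).
Proof.
move=> c x y; transitivity (lintr (fun z => c *: (z * x) + z * y)).
  by apply: (@eq_lintr _ H) => z; rewrite mulrDr scalerAr.
exact: (@lintr_linear _ H c (fun z => z * x) (fun z => z * y)).
Qed.

Let mulr_lin h : linear (fun y : H => y * h).
Proof. by move=> c x y; rewrite mulrDl scalerAl. Qed.

Lemma tauC a h : tau (a * h) = tau (h * a).
Proof.
have := @lintrC _ H H (fun y => y * h) (fun y => y * a) (mulr_lin h) (mulr_lin a).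
rewrite /tau (@eq_lintr _ H _ (fun y => y * (a * h))) => [->|y] /=; last first.
  by rewrite mulrA.
by apply: (@eq_lintr _ H) => y /=; rewrite mulrA.
Qed.

(** For [a * b * a = a], right multiplication by the idempotent [a * b] has its rank as trace; if
    that is 0, then [a * b] and [a] vanish. *)
Lemma tau_nondeg a : (forall h, tau (a * h) = 0) -> a = 0.
Proof.
move=> a0; have [b ab] := vnr a.
have l := @mulr_lin (a * b).
have i y : y * (a * b) * (a * b) = y * (a * b) by rewrite -mulrA [a * b * _]mulrA ab.
have : rk (fun y : H => y * (a * b)) = 0%N.
  by apply: (natr_inj0 char0); rewrite -(lintr_idem l i) -/(tau _) a0.
by move/(rk0 l)/(_ 1); rewrite mul1r -{2}ab => ->; rewrite mul0r.
Qed.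

(** [t] represents [lam] through the symmetric form [tau]; since [lam] has Nakayama automorphism
    [sg], conjugation by [t] is [sg]. Injectivity stands for the invertibility of [t]. *)
Lemma antipode_inner :
  exists2 t : H, (forall y, t * y = 0 -> y = 0) & forall a, a * t = t * sg a.
Proof.
have tl h : linear ((fun u => tau (u * h)) : H -> k^o).
  by move=> c x y; rewrite mulrDl -scalerAl tau_linear.
have tr h : linear ((fun u => tau (h * u)) : H -> k^o).
  by move=> c x y; rewrite mulrDr -scalerAr tau_linear.
have [_ /(_ _ (@lam_linear k H))[t tE]] := bil_rep tl tr tau_nondeg.
exists t => [y ty|a].
  by apply: (lam_nondegl LamP eps_Lam) => v; rewrite -tE mulrA ty mul0r (linear0' tau_linear).
apply/eqP; rewrite -subr_eq0; apply/eqP; apply: tau_nondeg => h.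
have E : tau (a * t * h) = tau (t * sg a * h).
  by rewrite -mulrA tauC -mulrA tE lam_cyc -tE mulrA.
by rewrite mulrBl -scaleN1r addrC tau_linear E scaleN1r addNr.
Qed.

(** A quasi-inverse of a fixed element, averaged over the powers of [sg], is a fixed quasi-inverse.
    So the fixed points of [sg] satisfy the hypothesis of [idem_decomp]. *)
Lemma fixed_idem_decomp : exists (I : finType) (w : I -> H),
  [/\ forall i, sg (w i) = w i, forall i, w i != 0, orthogonal_idem w,
      \sum_i w i = 1
    & forall i a, sg a = a -> exists c : k, w i * a * w i = c *: w i].
Proof.
pose F : {vspace H} := lker ((@antipode k H \o @antipode k H) - \1)%VF.
have FP a : (a \in F) = (sg a == a).
  by rewrite memv_ker add_lfunE opp_lfunE comp_lfunE id_lfunE subr_eq0.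
have [M M0 sgM1] := sg_finite_order.
have [||||I [w [wF w0 ow w1 pw]]] := @idem_decomp k H F 1.
- by move=> u v; rewrite !FP sgM => /eqP -> /eqP ->.
- move=> a; rewrite FP => /eqP sa a0; have [b ab] := vnr a.
  pose c := M%:R^-1 *: \sum_(i < M) iter i (@sg k H) b.
  have M0' : M%:R != 0 :> k by move/pcharf0P: char0 => ->; rewrite -lt0n.
  have sc : sg c = c.
    rewrite /c (linearZ' (@sg_linear _ H)) (linear_sum' (@sg_linear _ H)).
    congr (_ *: _); under eq_bigr => i _ do rewrite -iterS.
    case: (M) M0 sgM1 => // m _ E; rewrite big_ord_recr big_ord_recl /= addrC.
    by rewrite -[sg _]/(iter m.+1 _ b) E.
  have it i : iter i (@sg k H) a = a by elim: i => //= i ->.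
  have aca : a * c * a = a.
    rewrite /c -scalerAr -scalerAl mulr_sumr mulr_suml.
    have itb i : a * iter i (@sg k H) b * a = a.
      by rewrite -[RHS](it i) -[in RHS]ab !iter_sgM !it.
    under eq_bigr => i _ do rewrite itb.
    by rewrite sumr_const card_ord -scaler_nat scalerA mulVf // scale1r.
  exists c; first by rewrite FP sc.
  have ca0 : c * a != 0 by apply: contraNneq a0 => ca; rewrite -aca -mulrA ca mulr0.
  case=> [|d]; first by rewrite expr0 oner_eq0.
  elim: d => [|d IH]; first by rewrite expr1.
  by rewrite exprS exprS mulrA -[c * a * _]mulrA [a * _]mulrA aca -exprS.
- by rewrite FP sg1.
- by rewrite mulr1.
exists I, w; split=> // [i|i a sa]; first by apply/eqP; rewrite -FP.
by apply: pw; rewrite FP sa.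
Qed.

(** With idempotents [w i] fixed by [sg], the element [t] acts on [w i] by a scalar [T i], and [sg]
    is T j / T i on the component w_i H w_j. The index [i0] is that of the counit: [w i0] is a
    multiple of [Lam], so it is linked only to itself. *)
Lemma lintr_sg_roots : exists (I : finType) (e : rel I) (rep : I -> I) (i0 : I)
    (M : nat) (v : I -> k),
  [/\ (0 < M)%N, forall i, v i ^+ M = 1,
      forall i j, e i j = (rep i == rep j), forall j, rep i0 = rep j -> j = i0
    & lam (1 : H) = \sum_i \sum_j (e i j)%:R * (v j / v i)].
Proof.
have [t tinj tsg] := antipode_inner.
have [I [w [sw w0 ow w1 pw]]] := fixed_idem_decomp.
have [M M0 sgM1] := sg_finite_order.
have ww i : w i * w i = w i by rewrite ow eqxx.
have st : sg t = t.
  have /tinj/eqP : t * (t - sg t) = 0 by rewrite mulrBr -tsg subrr.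
  by rewrite subr_eq0 => /eqP.
have wt i : w i * t = t * w i by rewrite tsg sw.
have [T TE] : exists T : I -> k, forall i, t * w i = T i *: w i.
  have /fin_all_exists[T TE] i : exists c : k, t * w i = c *: w i.
    have [c cE] := pw i t st; exists c.
    by rewrite -cE wt -mulrA ww.
  by exists T.
have T0 i : T i != 0.
  by apply: contraNneq (w0 i) => Ti; rewrite (tinj (w i)) // TE Ti scale0r.
have sgp i j a : sg (w i * a * w j) = (T j / T i) *: (w i * a * w j).
  set x := w i * a * w j; apply: (scalerI (T0 i)).
  rewrite scalerA mulrC divfK //.
  have -> : T i *: sg x = t * sg x.
    by rewrite /x !sgM !sw !mulrA TE -!scalerAl.
  by rewrite -tsg /x -mulrA wt TE -scalerAr.
(* The scalar on w_i H w_i is T i / T i = 1, so this corner consists of fixed points and [pw]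
   applies. *)
have wprim i : primitive_in fullv (w i).
  move=> a _; have := pw i (w i * a * w i).
  rewrite sgp divff // scale1r => /(_ erefl)[c cE]; exists c; rewrite -cE.
  by rewrite !mulrA ww -[RHS]mulrA ww.
have lP := @linkedP k H vnr I w ow w0 wprim.
have lS := @linked_sym k H vnr I w ow w0 wprim.
have rep_eq := @linkedE k H vnr I w ow w0 wprim.
have l_rep := @linked_rep k H vnr I w ow w0 wprim.
have theta i j : linked w i j -> (T j / T i) ^+ M = 1.
  move/lP=> [a a0]; have E m : iter m (@sg k H) (peirce w i j a) =
      (T j / T i) ^+ m *: peirce w i j a.
    elim: m => [|m IH]; first by rewrite expr0 scale1r.
    by rewrite iterS IH (linearZ' (@sg_linear _ H)) sgp scalerA exprSr.
  have := E M; rewrite sgM1 => /eqP; rewrite -subr_eq0 -{1}[peirce _ _ _ _]scale1r.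
  rewrite -scalerBl scaler_eq0 (negPf a0) orbF subr_eq0 => /eqP ->.
  by [].
have Lw i : w i * Lam = eps (w i) *: Lam by [].
have L0 : Lam != 0 := Lam_neq0 eps_Lam.
have [i0 ei0] : exists i0, eps (w i0) != 0.
  apply/existsP; apply: contraT; rewrite negb_exists => /forallP z.
  have : eps (1 : H) == 0.
    rewrite -w1 (linear_sum' (@eps_linear _ H)) big1 // => i _.
    by have /negPn/eqP := z i.
  by rewrite [eps 1]counit1 oner_eq0.
have e0 j : j != i0 -> eps (w j) = 0.
  move=> nj; have : eps (w i0 * w j) = 0.
    by rewrite ow eq_sym (negPf nj) (linear0' (@eps_linear _ H)).
  by rewrite epsM => /eqP; rewrite mulf_eq0 (negPf ei0) => /eqP.
have [c0 w0E] : exists c : k, w i0 = c *: Lam.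
  have [|c cE] := wprim i0 Lam; first exact: memvf.
  move: cE; rewrite Lw -scalerAl (LamPr LamP eps_Lam) scalerA => cE.
  have c0 : c != 0.
    apply/eqP=> c0; move/eqP: cE; rewrite c0 scale0r scaler_eq0 (negPf L0) orbF.
    by rewrite mulf_eq0 (negPf ei0).
  exists (c^-1 * (eps (w i0) * eps (w i0))).
  by rewrite -scalerA cE scalerA mulVf ?scale1r.
(* Quotients of scalars [T] are known to be roots of unity only within a class, hence the division
   by the scalar of the representative. *)
exists I, (linked w), (rep w), i0, M, (fun i => T i / T (rep w i)); split=> //.
- by move=> i; apply: theta; apply: lS.
- move=> j /eqP; rewrite -rep_eq => /lP[a]; apply: contraNeq => nj.
  rewrite /peirce w0E -!scalerAl (LamPr LamP eps_Lam) -scalerAl.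
  by rewrite (LamPr LamP eps_Lam) e0 // scale0r !scaler0.
have -> : lam (1 : H) = lintr (fun y => \sum_i \sum_j (T j / T i) *: peirce w i j y).
  apply: (@eq_lintr _ H) => y; rewrite mulr1.
  under eq_bigr => i _ do under eq_bigr => j _ do rewrite -sgp.
  under eq_bigr => i _ do rewrite -(linear_sum' (@sg_linear _ H)) -mulr_sumr w1 mulr1.
  by rewrite -(linear_sum' (@sg_linear _ H)) -mulr_suml w1 mul1r.
rewrite (@lintr_sum _ H); apply: eq_bigr => i _.
rewrite (@lintr_sum _ H); apply: eq_bigr => j _.
rewrite (@lintrZ _ H) (@peirce_tr k H vnr I w ow w0 wprim) mulrC.
have [lij|_] := boolP (linked w i j); last by rewrite !mul0r.
have rij : rep w i = rep w j by apply/eqP; rewrite -rep_eq.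
by rewrite rij invf_div [in RHS](mulrA (_ / _)) divfK.
Qed.

(* Transferred to roots of unity of [algC], the double sum of [lintr_sg_roots] becomes
   the sum of the [`|S c| ^+ 2], in which the class of [i0] contributes [1]. *)
Lemma lam1_neq0 : lam (1 : H) != 0.
Proof.
have [I [e [rep [i0 [M [v [M0 vM eE i0E ->]]]]]]] := lintr_sg_roots.
have [z pz] := prim_root_exists char0 M0.
have /fin_all_exists[a aE] i : exists a : 'I_M, v i = z ^+ a.
  by have [a ->] := prim_rootP pz (vM i); exists a.
apply/eqP=> D0.
(* On [M]-th roots of unity the exponent [M.-1] is inversion, which keeps [P] a polynomial. *)
pose P : {poly int} := \sum_i \sum_j 'X^(a j + a i * M.-1) *+ e i j.
have PE (F : fieldType) (x : F) : (map_poly intr P).[x] =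
    \sum_i \sum_j (e i j)%:R * (x ^+ a j * x ^+ a i ^+ M.-1).
  rewrite rmorph_sum horner_sum; apply: eq_bigr => i _.
  rewrite rmorph_sum horner_sum; apply: eq_bigr => j _ /=.
  by rewrite rmorphMn /= map_polyXn hornerMn hornerXn exprD exprM mulr_natl.
have inv (F : fieldType) (x : F) i : x ^+ M = 1 -> x ^+ a i ^+ M.-1 = (x ^+ a i)^-1.
  move=> xM; have xi : x ^+ a i ^+ M.-1 * x ^+ a i = 1.
    by rewrite -exprSr prednK // -!exprM mulnC exprM xM expr1n.
  have x0 : x ^+ a i != 0.
    by apply: contraTneq (oner_neq0 F) => x0; rewrite -xi x0 mulr0 eqxx.
  by apply: (mulIf x0); rewrite xi mulVf.
have [x [xM Px]] : exists x : algC, x ^+ M = 1 /\ (map_poly intr P).[x] = 0.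
  apply: (unity_transfer char0 M0 (prim_expr_order pz)); rewrite PE -[RHS]D0.
  apply: eq_bigr => i _; apply: eq_bigr => j _.
  by rewrite !aE inv //; exact: prim_expr_order pz.
pose u i := x ^+ a i.
have u1 i : `|u i| = 1.
  have : `|u i| ^+ M == 1 by rewrite -normrX -exprM mulnC exprM xM expr1n normr1.
  by rewrite pexpr_eq1 // => /eqP.
have uV i : (u i)^-1 = (u i)^*.
  by rewrite invC_norm u1 expr1n invr1 mul1r.
pose S c := \sum_(i | rep i == c) u i.
have : \sum_c `|S c| ^+ 2 = 0.
  rewrite -[RHS]Px PE [RHS](partition_big rep xpredT) //=; apply: eq_bigr => c _.
  rewrite normCK mulrC [in LHS]/S rmorph_sum mulr_suml; apply: eq_bigr => i /eqP rc.
  rewrite mulr_sumr big_mkcond; apply: eq_bigr => j _ /=.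
  rewrite eE rc eq_sym; case: eqP => _; last by rewrite mul0r.
  by rewrite mul1r inv // -uV mulrC.
move/eqP; rewrite psumr_eq0 => [|c _]; last by rewrite exprn_ge0.
move/allP/(_ (rep i0)); rewrite mem_index_enum => /(_ isT) /=.
rewrite /S (big_pred1 i0) => [|j]; last first.
  apply/eqP/eqP=> [r|->] //; exact/i0E/esym.
by rewrite u1 expr1n oner_eq0.
Qed.

End TraceNonzero.

Lemma tr_idem_fin (k : fieldType) (J : finType) (P : J -> J -> k) :
  (forall i j, \sum_l P i l * P l j = P i j) -> exists m : nat, \sum_i P i i = m%:R.
Proof.
move=> PP; pose M : 'M[k]_#|J| := \matrix_(i, j) P (enum_val i) (enum_val j).
exists (\rank M); rewrite -mxtrace_idem.
  rewrite (reindex _ (onW_bij _ (@enum_val_bij J))) /=.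
  by apply: eq_bigr => i _; rewrite mxE.
apply/matrixP=> i j; rewrite !mxE -PP (reindex _ (onW_bij _ (@enum_val_bij J))) /=.
by apply: eq_bigr => l _; rewrite !mxE.
Qed.

(** The eigenvalue is n / m. The integer [K] is the characteristic polynomial at n / m with
    denominators cleared; it vanishes in [k], hence in [algC], where n / m is then a rational
    algebraic integer. *)
Lemma rational_eigenvalue_int (k : fieldType) (J : finType) (N : J -> J -> int) (x : J -> k)
    (mu : k) (m n : nat) : [pchar k] =i pred0 ->
    (exists i, x i != 0) -> (forall i, \sum_j (N i j)%:~R * x j = mu * x i) ->
    (0 < m)%N -> mu * m%:R = n%:R ->
  (m %| n)%N.
Proof.
move=> ch [i0 xi0] Nx m0 mun.
pose M : 'M[int]_#|J| := \matrix_(i, j) N (enum_val j) (enum_val i).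
pose p := char_poly M; pose v : 'rV[k]_#|J| := \row_i x (enum_val i).
have pmu : (map_poly intr p).[mu] = 0.
  apply/eqP; rewrite -[_ == 0]/(root _ _) /p map_char_poly -eigenvalue_root_char.
  apply/eigenvalueP; exists v; last first.
    by apply: contraNneq xi0 => /rowP/(_ (enum_rank i0)); rewrite !mxE enum_rankK => ->.
  apply/rowP=> j; rewrite !mxE -Nx (reindex _ (onW_bij _ (@enum_val_bij J))) /=.
  by apply: eq_bigr => i _; rewrite !mxE mulrC.
pose d := (size p).-1.
pose K : int := \sum_(i < size p) p`_i * (n%:Z ^+ i * m%:Z ^+ (d - i)).
have KE (F : fieldType) (y : F) : y * m%:R = n%:R -> K%:~R = m%:R ^+ d * (map_poly intr p).[y].
  move=> ymn; rewrite (@horner_coef_wide _ (size p)) ?size_poly // mulr_sumr rmorph_sum.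
  apply: eq_bigr => i _; rewrite coef_map /= !rmorphM /= !rmorphXn /= -!pmulrn.
  have /subnK id : (i <= d)%N by rewrite -ltnS /d prednK // (leq_ltn_trans _ (ltn_ord i)).
  rewrite -[in RHS]id exprD -ymn exprMn [RHS]mulrCA; congr (_ * _).
  by rewrite mulrC -mulrA [y ^+ i * _]mulrC.
have K0 : K = 0.
  by apply/eqP; rewrite -(intr_eq0_char0 _ ch) (KE _ mu) // pmu mulr0.
have m0C : m%:R != 0 :> algC by rewrite pnatr_eq0 -lt0n.
pose y : algC := n%:R / m%:R.
have ymn : y * m%:R = n%:R by rewrite divfK.
have py : (map_poly intr p).[y] = 0.
  have := KE _ y ymn; rewrite K0 => /esym/eqP; rewrite mulf_eq0 expf_eq0 (negPf m0C).
  by rewrite andbF => /eqP.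
have yA : y \in Aint.
  apply: (@root_monic_Aint (map_poly intr p)); first exact/eqP.
    by rewrite monic_map // char_poly_monic.
  by apply/polyOverP=> i; rewrite coef_map /= intr_int.
have : y \in Num.int by apply: Cint_rat_Aint => //; rewrite rpred_div ?rpred_nat.
case/intrP=> z yz; have : z * m%:Z == n%:Z.
  by rewrite -(eqr_int algC) intrM -yz -!pmulrn ymn.
move/eqP/(congr1 absz); rewrite abszM !absz_nat => <-.
exact: dvdn_mull.
Qed.

Lemma linear_sumP (k : fieldType) (U V : vectType k) (f : U -> V) : linear f ->
  forall (I : finType) (P : pred I) (F : I -> U),
  f (\sum_(i | P i) F i) = \sum_(i | P i) f (F i).
Proof.
move=> lf I P F; elim/big_rec2: _ => [|i u v _ <-]; first exact: linear0'.
exact: linearD'.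
Qed.

Lemma bilin_comp (k : fieldType) (U V U' V' W : vectType k) (F : U' -> V' -> W)
    (p : U -> U') (q : V -> V') :
  bilin F -> linear p -> linear q -> bilin (fun u v => F (p u) (q v)).
Proof.
by move=> [Fl Fr] lp lq; split=> [v|u] c s t; rewrite ?lp ?lq ?Fl ?Fr.
Qed.

(** * The class equation *)

Section ClassEquation.
Variables (k : closedFieldType) (H : hopfType k) (Lam : H).
Hypothesis char0 : [pchar k] =i pred0.
Hypothesis vnr : forall a : H, exists b, a * b * a = a.
Hypothesis LamP : forall h, h * Lam = eps h *: Lam.
Hypothesis eps_Lam : eps Lam = 1.
Local Notation n := (\dim {:H}).
Local Notation b := (@bas k H).
Local Notation A := (hdual H).
Implicit Types (a h y : H) (f g e : A).

Let D0 := lam1_neq0 char0 vnr LamP eps_Lam.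

Lemma antipodeK a : antipode (antipode a) = a.
Proof. exact: (sg_id LamP eps_Lam char0 D0). Qed.

Lemma dual_antipodeK f : antipode (antipode f) = f.
Proof. by apply: evP => h; rewrite !ev_antipode antipodeK. Qed.

Let n_neq0 : n%:R != 0 :> k.
Proof. by move/pcharf0P: char0 => ->; rewrite -lt0n; exact: (adim_gt0 {:H}%AS). Qed.

Lemma lintr_hit f : lintr (hitR f) = n%:R * ev f Lam.
Proof. exact: (lintr_hitR_Lam LamP eps_Lam char0 D0). Qed.

Lemma deltaC f g : ev (f * g) Lam = ev (g * f) Lam.
Proof.
apply: (mulfI n_neq0); rewrite -!lintr_hit.
rewrite (eq_lintr (hitRM f g)) (eq_lintr (hitRM g f)).
exact: (@lintrC _ H H (hitR f) (hitR g) (@hitR_linear _ _ f) (@hitR_linear _ _ g)).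
Qed.

(** These form the character algebra, spanned by the characters of simple modules
    ([class_fun_expand]). *)
Definition class_fun f := forall a h, ev f (a * h) = ev f (h * a).

Lemma class_funM f g : class_fun f -> class_fun g -> class_fun (f * g).
Proof.
move=> cf cg a h.
have E x y : ev (f * g) (x * y) = \sum_i \sum_j ev f (b i * b j) * ev g (cp x i * cp y j).
  rewrite -pr_comul comulM [comul x]comul_cp [comul y]comul_cp tmul_sum.
  rewrite (linear_sum' (@pr_linear _ _ f g)); apply: eq_bigr => i _.
  rewrite (linear_sum' (@pr_linear _ _ f g)); apply: eq_bigr => j _.
  by rewrite pr_tpure.
rewrite !E exchange_big; apply: eq_bigr => i _; apply: eq_bigr => j _ /=.
by rewrite cf cg.
Qed.

Lemma class_fun_antipode f : class_fun f -> class_fun (antipode f).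
Proof. by move=> cf a h; rewrite !ev_antipode !antipodeM cf. Qed.

Lemma class_fun_lin (c : k) f g : class_fun f -> class_fun g -> class_fun (c *: f + g).
Proof. by move=> cf cg a h; rewrite !evrD !evrZ cf cg. Qed.

Lemma class_fun_sum (I : finType) (P : pred I) (F : I -> A) :
  (forall i, class_fun (F i)) -> class_fun (\sum_(i | P i) F i).
Proof.
move=> cF; apply: big_rec => [a h|i f _ cf]; first by rewrite /ev !lfunE.
by rewrite -[F i]scale1r; apply: class_fun_lin.
Qed.

(** [Theta Lam f] represents [f] through [lam]; as both forms are symmetric, it is central. *)
Lemma ev_Theta_class f : class_fun f -> forall y, y * Theta Lam f = Theta Lam f * y.
Proof.
move=> cf; have [u uE] := lam_rep LamP eps_Lam (@evl _ _ f).
have -> : Theta Lam f = u.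
  have -> : f = dualf (fun y => lam (u * y)).
    apply: evP => y; rewrite dualfE // => c x z.
    by rewrite mulrDr -scalerAr lam_linear.
  exact: Theta_lam.
move=> y; apply/eqP; rewrite -subr_eq0; apply/eqP; apply: (lam_nondegl LamP eps_Lam) => h.
rewrite mulrBl -scaleN1r addrC lam_linear.
have lC := lamC LamP eps_Lam char0 D0.
by rewrite -mulrA uE cf -uE mulrA lC mulrA scaleN1r addNr.
Qed.

Lemma lam_Theta f y : lam (Theta Lam f * y) = ev f y.
Proof.
have [u uE] := lam_rep LamP eps_Lam (@evl _ _ f).
have -> : Theta Lam f = u.
  have -> : f = dualf (fun y => lam (u * y)).
    apply: evP => z; rewrite dualfE // => c x z'.
    by rewrite mulrDr -scalerAr lam_linear.
  exact: Theta_lam.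
exact: uE.
Qed.

Lemma delta_antipode f g : ev (f * antipode g) Lam = ev g (Theta Lam f).
Proof.
rewrite evM /Theta evl_sum; apply: eq_bigr => i _.
by rewrite ev_antipode evlZ.
Qed.

Section Characters.
Variables (I : finType) (w : I -> H).
Hypothesis wow : orthogonal_idem w.
Hypothesis w0 : forall i, w i != 0.
Hypothesis w1 : \sum_i w i = 1.
Hypothesis wprim : forall i, primitive_in fullv (w i).

Let ww i : w i * w i = w i. Proof. by rewrite wow eqxx. Qed.

Let chi_lin i : linear ((fun h => lintr (fun y => h * y * w i)) : H -> k^o).
Proof.
move=> c x y; rewrite -[RHS](@lintr_linear _ H c (fun z => x * z * w i) (fun z => y * z * w i)).
by apply: (@eq_lintr _ H) => z; rewrite !mulrDl -!scalerAl.
Qed.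

(** The character of the simple left module H w_i, cut out of [H] by right multiplication with
    [w i]. *)
Definition chi i : A := dualf (fun h => lintr (fun y => h * y * w i)).

Lemma chiE i h : ev (chi i) h = lintr (fun y => h * y * w i).
Proof. by rewrite dualfE. Qed.

Lemma chi_class i : class_fun (chi i).
Proof.
move=> a h; rewrite !chiE.
have := @lintrC _ H H (fun y => a * y) (fun y => h * y * w i).
rewrite (@eq_lintr _ H _ (fun y => a * h * y * w i)) => [->|y] /=; last first.
- by rewrite !mulrA.
- by move=> c x y; rewrite mulrDr mulrDl -scalerAr -scalerAl.
- by move=> c x y; rewrite mulrDr -scalerAr.
by apply: (@eq_lintr _ H) => y /=; rewrite !mulrA.
Qed.

Lemma chi_w i j : ev (chi i) (w j) = (linked w j i)%:R.
Proof. by rewrite chiE -(peirce_tr vnr wow w0 wprim). Qed.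

Lemma class_fun_w f i : class_fun f -> ev f (w i) = ev f (w (rep w i)).
Proof.
by move=> cf; apply: (trace_linked vnr wow w0 wprim cf);
  exact: (linked_rep vnr wow w0 wprim).
Qed.

Lemma class_fun0 f : class_fun f -> (forall i, ev f (w (rep w i)) = 0) -> f = 0.
Proof.
move=> cf f0; apply: evP => h; rewrite [RHS]/ev lfunE /= -[h]mulr1 -w1 mulr_sumr evl_sum.
rewrite big1 // => i _; rewrite -ww mulrA cf mulrA.
have [c ->] := wprim i (memvf h).
by rewrite evlZ class_fun_w // f0 mulr0.
Qed.

Local Notation reps := [pred c | rep w c == c].

Lemma class_fun_expand f : class_fun f -> f = \sum_(c in reps) ev f (w c) *: chi c.
Proof.
move=> cf; apply/eqP; rewrite -subr_eq0 -scaleN1r addrC; apply/eqP.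
apply: class_fun0.
  apply: class_fun_lin => //; apply: class_fun_sum => i.
  rewrite -[_ *: _]addr0; apply: class_fun_lin; first exact: chi_class.
  by move=> a h; rewrite /ev !lfunE.
move=> i; rewrite evrD evrZ big_mkcond evr_sum (bigD1 (rep w i)) //=.
rewrite inE (repK vnr wow w0 wprim) eqxx evrZ chi_w (linked_refl vnr wow w0 wprim) mulr1.
rewrite big1 ?addr0 ?mulN1r ?addNr // => c nc.
case: ifP => [|_]; last by rewrite /ev lfunE.
rewrite inE => /eqP rc; rewrite evrZ chi_w (linkedE vnr wow w0 wprim).
by rewrite (repK vnr wow w0 wprim) rc eq_sym (negPf nc) mulr0.
Qed.

(** The orthogonality relations: the central element [Theta Lam f] acts on H w_c by a scalar, and
    both sides are the trace of that action. *)
Lemma delta_chi f c : class_fun f -> ev (f * antipode (chi c)) Lam = ev f (w c).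
Proof.
move=> cf; rewrite delta_antipode chiE -[in RHS]lam_Theta.
set u := Theta Lam f; have uC : forall y, y * u = u * y by exact: ev_Theta_class.
have [x xE] := wprim c (memvf u).
have uw : u * w c = x *: w c by rewrite -xE uC -mulrA ww.
rewrite uw lamZ (lamE LamP eps_Lam char0 D0) -lintrZ.
by apply: (@eq_lintr _ H) => y; rewrite -uC -mulrA uw scalerAr.
Qed.

Lemma class_fun_expand' g : class_fun g ->
  g = \sum_(c in reps) ev (g * chi c) Lam *: antipode (chi c).
Proof.
move=> cg; have cS := class_fun_antipode cg.
rewrite -[LHS]dual_antipodeK [X in antipode X](class_fun_expand cS) linear_sum.
apply: eq_bigr => c _; rewrite linearZ; congr (_ *: _).
rewrite -delta_chi // -antipodeM ev_antipode (antipode_Lam LamP eps_Lam).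
by rewrite deltaC.
Qed.

(** The [chi c] and [antipode (chi c)] are dual bases of the character algebra for the symmetric
    form [ev (f * g) Lam], so class functions can be moved across their Casimir tensor. *)
Lemma Casimir_l (W : vectType k) (F : A -> A -> W) x : bilin F -> class_fun x ->
  \sum_(c in reps) F (x * chi c) (antipode (chi c)) =
  \sum_(c in reps) F (chi c) (antipode (chi c) * x).
Proof.
move=> [Fl Fr] cx; have cc c := chi_class c; have cS c := class_fun_antipode (cc c).
transitivity (\sum_(c in reps) \sum_(d in reps)
    ev (x * chi c * antipode (chi d)) Lam *: F (chi d) (antipode (chi c))).
  apply: eq_bigr => c _; have cx' := class_funM cx (cc c).
  rewrite {1}(class_fun_expand cx') (linear_sumP (Fl _)); apply: eq_bigr => d _.
  by rewrite (linearZ' (Fl _)) delta_chi.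
rewrite exchange_big; apply: eq_bigr => d _ /=.
rewrite {1}(class_fun_expand' (class_funM (cS d) cx)) (linear_sumP (Fr _)).
by apply: eq_bigr => c _; rewrite (linearZ' (Fr _)) deltaC mulrA.
Qed.

Lemma Casimir_r (W : vectType k) (F : A -> A -> W) x : bilin F -> class_fun x ->
  \sum_(c in reps) F (chi c * x) (antipode (chi c)) =
  \sum_(c in reps) F (chi c) (x * antipode (chi c)).
Proof.
move=> [Fl Fr] cx; have cc c := chi_class c; have cS c := class_fun_antipode (cc c).
transitivity (\sum_(c in reps) \sum_(d in reps)
    ev (chi c * x * antipode (chi d)) Lam *: F (chi d) (antipode (chi c))).
  apply: eq_bigr => c _; have cx' := class_funM (cc c) cx.
  rewrite {1}(class_fun_expand cx') (linear_sumP (Fl _)); apply: eq_bigr => d _.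
  by rewrite (linearZ' (Fl _)) delta_chi.
rewrite exchange_big; apply: eq_bigr => d _ /=.
rewrite {1}(class_fun_expand' (class_funM cx (cS d))) (linear_sumP (Fr _)).
by apply: eq_bigr => c _; rewrite (linearZ' (Fr _)) -mulrA deltaC.
Qed.

(** Some [f (w c)] is nonzero; by [delta_chi] it is, up to the factor n, the trace of [hitR] at
    [antipode (chi c) * f], and a nilpotent map has trace 0. *)
Lemma class_fun_nonnil f : class_fun f -> f != 0 ->
  exists2 g, class_fun g & forall d, (g * f) ^+ d != 0.
Proof.
move=> cf f0; have [i fi] : exists i, ev f (w (rep w i)) != 0.
  apply/existsP; apply: contraT; rewrite negb_exists => /forallP z.
  case/eqP: f0; apply: class_fun0 => // i.
  by have /negPn/eqP := z i.
exists (antipode (chi (rep w i))); first exact/class_fun_antipode/chi_class.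
move=> d; apply: contraNneq fi => gd.
rewrite -delta_chi // deltaC -[_ == 0](inj_eq (mulfI n_neq0)) mulr0 -lintr_hit.
apply/eqP; apply: (@lintr_nilp _ H _ d (@hitR_linear _ _ _)) => v.
set g := _ * f in gd *.
have -> : iter d (hitR g) v = hitR (g ^+ d) v.
  elim: d {gd} => [|d IH] /=; last by rewrite IH exprS hitRM.
  by rewrite expr0; apply: ev_sep => u; rewrite ev_hitR mulr1.
rewrite gd; apply: ev_sep => u; rewrite ev_hitR mulr0.
by rewrite /ev lfunE linear0.
Qed.

Section Integrality.
Variable e : A.
Hypothesis ce : class_fun e.
Hypothesis ee : e * e = e.
Hypothesis e0 : e != 0.
Hypothesis eprim : forall f, class_fun f -> exists c : k, e * f * e = c *: e.

(* The Casimir element of the character algebra acts on [e ⊗ e] by the scalar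
   [1 / delta e]. *)
Lemma Casimir_eigen : exists2 mu : k, mu * ev e Lam = 1 & forall x y,
  \sum_(c in reps) ev (chi c * e) x * ev (antipode (chi c) * e) y =
  mu * (ev e x * ev e y).
Proof.
have cS c := class_fun_antipode (chi_class c).
have [phi phiE] : exists phi : I -> k, forall c, e * chi c * e = phi c *: e.
  have /fin_all_exists[phi phiE] c : exists x : k, e * chi c * e = x *: e.
    exact/eprim/chi_class.
  by exists phi.
have [psi psiE] : exists psi : I -> k, forall c, e * antipode (chi c) * e = psi c *: e.
  have /fin_all_exists[psi psiE] c : exists x : k, e * antipode (chi c) * e = x *: e.
    exact: eprim.
  by exists psi.
have psid c : psi c * ev e Lam = ev e (w c).
  by rewrite -evrZ -psiE deltaC mulrA ee delta_chi.
exists (\sum_(c in reps) phi c * psi c) => [|x y].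
  rewrite mulr_suml; under eq_bigr => c _ do rewrite -mulrA psid mulrC.
  set S := \sum_(c | _) _; have SE : S *: e = e.
    rewrite /S scaler_suml; under eq_bigr => c _ do
      rewrite -scalerA -phiE scalerAl scalerAr.
    by rewrite -mulr_suml -mulr_sumr -class_fun_expand // ee ee.
  have /eqP : (S - 1) *: e = 0 by rewrite scalerBl SE scale1r subrr.
  by rewrite scaler_eq0 (negPf e0) orbF subr_eq0 => /eqP.
pose F u v : k^o := ev u x * ev v y.
have bF : bilin F.
  split=> [v|u] c s t; rewrite /F evrD evrZ; first by rewrite mulrDl scalerAl.
  by rewrite mulrDr scalerAr.
have l1 : linear (fun u : A => u) by [].
have le : linear (fun u : A => u * e) by move=> c s t; rewrite mulrDl scalerAl.
have el : linear (fun u : A => e * u * e).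
  by move=> c s t; rewrite mulrDr mulrDl -scalerAr -scalerAl.
transitivity (\sum_(c in reps) F (chi c) (e * antipode (chi c) * e)).
  exact: (Casimir_r (bilin_comp bF l1 le) ce).
transitivity (\sum_(c in reps) F (chi c * e) (e * antipode (chi c) * e)).
  rewrite (Casimir_r (bilin_comp bF l1 el) ce); apply: eq_bigr => c _.
  by rewrite !mulrA ee.
transitivity (\sum_(c in reps) F (e * chi c * e) (e * antipode (chi c) * e)).
  rewrite (Casimir_l (bilin_comp bF le el) ce); apply: eq_bigr => c _.
  by rewrite -!mulrA ee.
rewrite mulr_suml; apply: eq_bigr => c _.
by rewrite phiE psiE /F !evrZ mulrACA.
Qed.

(** The coefficient functions of a matrix representation of [H]; at an idempotent their trace is the
    rank of an idempotent matrix, a natural number ([mult_mx_nat]). *)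
Definition mult_mx (J : finType) (Z : J -> J -> A) :=
  forall i j a h, ev (Z i j) (a * h) = \sum_l ev (Z i l) a * ev (Z l j) h.

Lemma mult_mx_mul (J L : finType) (Z : J -> J -> A) (Y : L -> L -> A) :
  mult_mx Z -> mult_mx Y -> mult_mx (fun p q : J * L => Z p.1 q.1 * Y p.2 q.2).
Proof.
move=> mZ mY p q a h.
rewrite -pr_comul comulM [comul a]comul_cp [comul h]comul_cp tmul_sum.
transitivity (\sum_u \sum_v \sum_l \sum_m ev (Z p.1 l) (b u) * ev (Z l q.1) (b v) *
    (ev (Y p.2 m) (cp a u) * ev (Y m q.2) (cp h v))).
  rewrite (linear_sum' (@pr_linear _ _ _ _)); apply: eq_bigr => u _.
  rewrite (linear_sum' (@pr_linear _ _ _ _)); apply: eq_bigr => v _.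
  rewrite pr_tpure mZ mY mulr_suml; apply: eq_bigr => l _.
  by rewrite mulr_sumr.
rewrite -(pair_bigA _ (fun l m => ev (Z p.1 l * Y p.2 m) a * ev (Z l q.1 * Y m q.2) h)) /=.
under eq_bigr => u _ do rewrite exchange_big /=.
rewrite exchange_big; apply: eq_bigr => l _ /=.
under eq_bigr => u _ do rewrite exchange_big /=.
rewrite exchange_big; apply: eq_bigr => m _ /=.
rewrite !evM mulr_suml; apply: eq_bigr => u _.
by rewrite mulr_sumr; apply: eq_bigr => v _; rewrite mulrACA.
Qed.

Lemma mult_mx_nat (J : finType) (Z : J -> J -> A) u : mult_mx Z -> u * u = u ->
  exists m : nat, ev (\sum_i Z i i) u = m%:R.
Proof.
move=> mZ uu; rewrite evr_sum; apply: (@tr_idem_fin _ _ (fun i j => ev (Z i j) u)).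
by move=> i j; rewrite -mZ uu.
Qed.

Lemma chi_mx c : exists2 Z : 'I_n -> 'I_n -> A, mult_mx Z & chi c = \sum_i Z i i.
Proof.
have lZ i j : linear ((fun h => crd i (h * b j * w c)) : H -> k^o).
  by move=> x y z; rewrite !mulrDl -!scalerAl crd_linear.
exists (fun i j => dualf (fun h => crd i (h * b j * w c))).
  move=> i j a h; rewrite dualfE //.
  have -> : a * h * b j * w c = a * (h * b j * w c) * w c.
    by rewrite -!mulrA ww.
  rewrite [in LHS](basE (h * b j * w c)) mulr_sumr mulr_suml crd_sum.
  apply: eq_bigr => l _; rewrite -scalerAr -scalerAl crdZ mulrC.
  by rewrite !dualfE.
apply: evP => h; rewrite chiE lintrE evr_sum; apply: eq_bigr => i _.
by rewrite dualfE.
Qed.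

Lemma chi_mx_antipode c :
  exists2 Z : 'I_n -> 'I_n -> A, mult_mx Z & antipode (chi c) = \sum_i Z i i.
Proof.
have [Z mZ cE] := chi_mx c; exists (fun i j => antipode (Z j i)).
  move=> i j a h; rewrite ev_antipode antipodeM mZ; apply: eq_bigr => l _.
  by rewrite !ev_antipode mulrC.
by rewrite cE linear_sum.
Qed.

Lemma sum_mul_diag (J L : finType) (Z : J -> J -> A) (Y : L -> L -> A) :
  (\sum_i Z i i) * (\sum_i Y i i) = \sum_p Z p.1 p.1 * Y p.2 p.2.
Proof.
rewrite mulr_suml -(pair_bigA _ (fun i j => Z i i * Y j j)) /=.
by apply: eq_bigr => i _; rewrite mulr_sumr.
Qed.

Lemma chi_mul_nat c s u : exists m : nat, ev (chi c * chi s) (w u) = m%:R.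
Proof.
have [Z mZ ->] := chi_mx c; have [Y mY ->] := chi_mx s.
rewrite sum_mul_diag.
exact: (mult_mx_nat (mult_mx_mul mZ mY) (ww u)).
Qed.

Lemma chi_antipode_mul_nat c s u :
  exists m : nat, ev (antipode (chi c) * chi s) (w u) = m%:R.
Proof.
have [Z mZ ->] := chi_mx_antipode c; have [Y mY ->] := chi_mx s.
rewrite sum_mul_diag.
exact: (mult_mx_nat (mult_mx_mul mZ mY) (ww u)).
Qed.

(** By [Casimir_eigen] the values of [e] at pairs of idempotents form an eigenvector, with
    eigenvalue 1 / e(Lam), of a matrix whose entries come from the natural values of products of
    characters; and [rk (hitR e)] is n e(Lam). *)
Lemma class_equation_chi : (rk (hitR e) %| n)%N.
Proof.
have hl := @hitR_linear _ _ e.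
have hh v : hitR e (hitR e v) = hitR e v by rewrite -hitRM ee.
have tr := lintr_idem hl hh; rewrite lintr_hit in tr.
have [mu mud E] := Casimir_eigen.
have [N NE] : exists N : I -> I -> I -> nat, forall c s u,
    ev (chi c * chi s) (w u) = (N c s u)%:R.
  have /fin_all_exists[N NE] c : exists N : I -> I -> nat, forall s u,
      ev (chi c * chi s) (w u) = (N s u)%:R.
    have /fin_all_exists[N NE] s : exists N : I -> nat, forall u,
        ev (chi c * chi s) (w u) = (N u)%:R.
      by have /fin_all_exists[N NE] u := chi_mul_nat c s u; exists N.
    by exists N.
  by exists N.
have [N' NE'] : exists N : I -> I -> I -> nat, forall c s u,
    ev (antipode (chi c) * chi s) (w u) = (N c s u)%:R.
  have /fin_all_exists[N' NE'] c : exists N : I -> I -> nat, forall s u,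
      ev (antipode (chi c) * chi s) (w u) = (N s u)%:R.
    have /fin_all_exists[N' NE'] s : exists N : I -> nat, forall u,
        ev (antipode (chi c) * chi s) (w u) = (N u)%:R.
      by have /fin_all_exists[N' NE'] u := chi_antipode_mul_nat c s u; exists N'.
    by exists N'.
  by exists N'.
have rk0' : (0 < rk (hitR e))%N.
  rewrite lt0n; apply: contra_neq e0 => r0; apply: evP => h.
  have z := rk0 hl r0 h; have := congr1 (ev (1 : A)) z.
  by rewrite ev_hitR mul1r => ->; rewrite /ev lfunE linear0.
(* Multiplication by the Casimir tensor. Columns outside the representatives are 0, so that all of
   [I * I] can index the matrix. *)
pose Mx (p q : I * I) : int := if (rep w q.1 == q.1) && (rep w q.2 == q.2)
  then \sum_(c in reps) (N c q.1 p.1 * N' c q.2 p.2)%N%:Z else 0.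
apply: (@rational_eigenvalue_int k _ Mx (fun p => ev e (w p.1) * ev e (w p.2)) mu) => //.
- have [i ei] : exists i, ev e (w (rep w i)) != 0.
    apply/existsP; apply: contraT; rewrite negb_exists => /forallP z.
    case/eqP: e0; apply: class_fun0 => // i.
    by have /negPn/eqP := z i.
  by exists (rep w i, rep w i); rewrite mulf_neq0.
- move=> [u u']; rewrite -E.
  rewrite -(pair_bigA _ (fun s s' => (Mx (u, u') (s, s'))%:~R * (ev e (w s) * ev e (w s')))) /=.
  have eE (f : A) v : ev (f * e) v = \sum_(s in reps) ev e (w s) * ev (f * chi s) v.
    rewrite {1}(class_fun_expand ce) mulr_sumr big_mkcond evr_sum [RHS]big_mkcond.
    by apply: eq_bigr => s _; case: ifP => _; rewrite -?scalerAr ?evrZ // /ev lfunE.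
  transitivity (\sum_(s in reps) \sum_(s' in reps) \sum_(c in reps)
      (ev e (w s) * (N c s u)%:R) * (ev e (w s') * (N' c s' u')%:R)); last first.
    under [RHS]eq_bigr => c _ do rewrite !eE mulr_suml.
    rewrite [RHS]exchange_big; apply: eq_bigr => s _ /=.
    under [RHS]eq_bigr => c _ do rewrite mulr_sumr.
    rewrite [RHS]exchange_big; apply: eq_bigr => s' _ /=.
    by apply: eq_bigr => c _; rewrite NE NE'.
  rewrite [RHS]big_mkcond; apply: eq_bigr => s _; rewrite inE /Mx /=.
  have [_|_] := eqVneq (rep w s) s; last by rewrite big1 // => s' _; rewrite mul0r.
  rewrite [RHS]big_mkcond; apply: eq_bigr => s' _; rewrite inE /=.
  have [_|_] := eqVneq (rep w s') s'; last by rewrite mul0r.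
  rewrite rmorph_sum mulr_suml; apply: eq_bigr => c _ /=.
  by rewrite -pmulrn natrM mulrACA [(N _ _ _)%:R * _]mulrC [(N' _ _ _)%:R * _]mulrC.
by rewrite -tr mulrCA mud mulr1.
Qed.

End Integrality.
End Characters.
End ClassEquation.

(** * A central group-like element *)

Section CentralGrouplike.
Variables (k : closedFieldType) (H : hopfType k) (Lam : H).
Hypothesis char0 : [pchar k] =i pred0.
Hypothesis vnr : forall a : H, exists b, a * b * a = a.
Hypothesis LamP : forall h, h * Lam = eps h *: Lam.
Hypothesis eps_Lam : eps Lam = 1.
Local Notation n := (\dim {:H}).
Local Notation b := (@bas k H).
Local Notation A := (hdual H).
Implicit Types (a h y : H) (f g e : A).

Let D0 := lam1_neq0 char0 vnr LamP eps_Lam.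

Let n_neq0 : n%:R != 0 :> k.
Proof. by move/pcharf0P: char0 => ->; rewrite -lt0n; exact: (adim_gt0 {:H}%AS). Qed.

Lemma primitive_decomp : exists (I : finType) (w : I -> H),
  [/\ forall i, w i != 0, orthogonal_idem w,
      \sum_i w i = 1 & forall i, primitive_in fullv (w i)].
Proof.
have [||||I [w [_ w0 ow w1 pw]]] := @idem_decomp k H fullv 1.
- by move=> u v _ _; exact: memvf.
- move=> a _ a0; have [c ac] := vnr a; exists c; first exact: memvf.
  have ca0 : c * a != 0 by apply: contraNneq a0 => ca; rewrite -ac -mulrA ca mulr0.
  case=> [|d]; first by rewrite expr0 oner_eq0.
  elim: d => [|d IH]; first by rewrite expr1.
  by rewrite exprS exprS mulrA -[c * a * _]mulrA [a * _]mulrA ac -exprS.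
- exact: memvf.
- by rewrite mulr1.
by exists I, w.
Qed.

Lemma class_equation e : class_fun e -> e * e = e -> e != 0 ->
    (forall f, class_fun f -> exists c : k, e * f * e = c *: e) ->
  (rk (hitR e) %| n)%N.
Proof.
have [I [w [w0 ow w1 pw]]] := primitive_decomp.
exact: (class_equation_chi char0 vnr LamP eps_Lam ow w0 w1 pw).
Qed.

Lemma class_fun_decomp f : class_fun f -> f * f = f ->
  exists (J : finType) (e : J -> A),
  [/\ forall j, class_fun (e j), forall j, e j != 0, orthogonal_idem e,
      \sum_j e j = f
    & forall j g, class_fun g -> exists c : k, e j * g * e j = c *: e j].
Proof.
have [I [w [w0 ow w1 pw]]] := primitive_decomp; move=> cf ff.
pose X := [seq chi w i | i <- enum I]; pose U : {vspace A} := <<X>>%VS.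
have UP g : g \in U <-> class_fun g.
  split=> [/(coord_span (X := in_tuple X)) -> |cg].
    apply: class_fun_sum => i; rewrite -[_ *: _]addr0.
    apply: class_fun_lin => [|a h]; last by rewrite /ev !lfunE.
    have : (in_tuple X)`_i \in X by rewrite mem_nth.
    by case/mapP=> j _ ->; exact: chi_class.
  rewrite (class_fun_expand vnr ow w0 w1 pw cg); apply: memv_suml => c _.
  by apply: memvZ; apply: memv_span; apply: map_f; rewrite mem_enum.
have [||||J [e [eU e0 oe e1 pe]]] := @idem_decomp k A U f.
- by move=> u v /UP cu /UP cv; apply/UP/class_funM.
- move=> g /UP cg g0.
  have [g' cg' nil] := class_fun_nonnil char0 vnr LamP eps_Lam ow w0 w1 pw cg g0.
  by exists g' => //; apply/UP.
- exact/UP.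
- by [].
by exists J, e; split=> // [j|j g cg]; [apply/UP | apply: pe; apply/UP].
Qed.

Lemma glike_dual f : glike f <->
  ev f 1 = 1 /\ forall a h, ev f (a * h) = ev f a * ev f h.
Proof.
split=> [[fc f1]|[f1 fM]].
  split=> [|a h]; first by rewrite -f1 /eps /= lfunE.
  have fc' : dual_comul H f = tpure f f by exact: fc.
  have [ml mr] := @mul_bilin k k^o.
  have bB : bilin (fun u v : A => ev u a * ev v h : k^o).
    by split=> [v|u] c s t; rewrite ?(@evr _ _ a) ?(@evr _ _ h) ?ml ?mr.
  by rewrite -[RHS](tliftE bB) -fc' -[LHS]dual_comulE.
split; last by rewrite -f1 /eps /= lfunE.
apply: prP => F G; pose x := predual (ev F); pose y := predual (ev G).
have xE g : ev g x = ev F g by rewrite predualE //; exact: evl.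
have yE g : ev g y = ev G g by rewrite predualE //; exact: evl.
rewrite pr_tpure -xE -yE -fM; transitivity (ev f (x * y)) => //.
rewrite -[RHS](dual_comulE f x y).
have E u v : ev F u * ev G v = ev u x * ev v y by rewrite xE yE.
exact: (@eq_tlift _ A A k^o _ _ E (dual_comul H f)).
Qed.

Section Grouplikes.
Variable s : seq A.
Hypothesis us : uniq s.
Hypothesis sP : forall g, g \in s <-> glike g.
Local Notation N := (size s).

Let s1 : 1 \in s.
Proof. by apply/sP; exact: glike1. Qed.

Let N_gt0 : (0 < N)%N.
Proof. by rewrite lt0n size_eq0; apply: contraTneq s1 => ->. Qed.

Let N_neq0 : N%:R != 0 :> k.
Proof. by move/pcharf0P: char0 => ->; rewrite -lt0n. Qed.

Definition LamG : A := N%:R^-1 *: \sum_(g <- s) g.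

Let ev_bigr (r : seq A) a : ev (\sum_(g <- r) g) a = \sum_(g <- r) ev g a.
Proof. by elim: r => [|g r IH]; rewrite ?big_nil ?big_cons ?evrD ?IH // /ev lfunE. Qed.

Lemma glike_class g : glike g -> class_fun g.
Proof. by case/glike_dual=> _ gM a h; rewrite !gM mulrC. Qed.

Lemma LamG_class : class_fun LamG.
Proof.
move=> a h; rewrite !evrZ !ev_bigr; congr (_ * _); apply: eq_big_seq => g /sP /glike_class.
exact.
Qed.

Lemma mul_LamG g : glike g -> g * LamG = LamG.
Proof.
move=> gg; rewrite /LamG -scalerAr mulr_sumr; congr (_ *: _).
rewrite -(big_map (fun f => g * f) xpredT id); apply: perm_big.
have gI : injective (fun f => g * f).
  by move=> x y /(congr1 ( *%R (antipode g))); rewrite !mulrA glike_Smul // !mul1r.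
have um : uniq [seq g * f | f <- s] by rewrite map_inj_uniq.
apply: uniq_perm => //.
apply: (uniq_min_size um _ _).2; last by rewrite size_map.
by move=> _ /mapP[f /sP gf ->]; apply/sP/glikeM.
Qed.

Lemma LamG_idem : LamG * LamG = LamG.
Proof.
rewrite {1}/LamG -scalerAl mulr_suml.
rewrite (eq_big_seq (fun=> LamG)) => [|g /sP]; last exact: mul_LamG.
by rewrite big_const_seq count_predT iter_addr addr0 -scaler_nat scalerA mulVf // scale1r.
Qed.

Lemma ev_glike_Lam g : glike g -> ev g Lam = (g == 1)%:R.
Proof.
case/glike_dual=> _ gM; case: eqP => [->|g1]; first by rewrite ev1 -/(eps _) eps_Lam.
apply/eqP; apply: contraT => gL; case: g1; apply: evP => h.
by apply: (mulIf gL); rewrite -gM LamP evlZ.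
Qed.

Lemma delta_LamG : ev LamG Lam = N%:R^-1.
Proof.
rewrite evrZ ev_bigr (bigD1_seq 1) //= ev_glike_Lam; last exact: glike1.
rewrite eqxx big_seq_cond big1 ?addr0 ?mulr1 // => g /andP[/sP gg /negPf g1].
by rewrite ev_glike_Lam // g1.
Qed.

Lemma ev_LamG1 : ev LamG 1 = 1.
Proof.
rewrite evrZ ev_bigr (eq_big_seq (fun=> 1)) => [|g /sP/glike_dual[]//].
by rewrite big_const_seq count_predT iter_addr addr0 mulVf.
Qed.

Lemma lam_mul_dual f : f * (@lamA k H) = ev f 1 *: (@lamA k H).
Proof. by rewrite (mul_lamA LamP eps_Lam) (unimodular LamP eps_Lam D0). Qed.

Lemma lamA1 : ev (@lamA k H) 1 = n%:R.
Proof. by rewrite ev_lamA (lam1 LamP eps_Lam char0 D0). Qed.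

Lemma lamA_neq0 : (@lamA k H) != 0.
Proof. by apply: contra_neq n_neq0 => l0; rewrite -lamA1 l0 /ev lfunE. Qed.

Lemma lamA_class : class_fun (@lamA k H).
Proof. by move=> a h; rewrite !ev_lamA; exact: (lamC LamP eps_Lam char0 D0). Qed.

Lemma rk_idem e : e * e = e -> (rk (hitR e))%:R = n%:R * ev e Lam :> k.
Proof.
move=> ee; rewrite -(lintr_hit char0 vnr LamP eps_Lam) lintr_idem //.
  exact: hitR_linear.
by move=> v; rewrite -hitRM ee.
Qed.

(** [hitR e] is the transpose of right multiplication by [e], so A e is a line on which [A] acts by
    an algebra map to [k]; such a map is evaluation at a group-like element. *)
Lemma rank_one_grouplike e : e != 0 -> rk (hitR e) = 1%N ->
  exists2 x : H, glike x & forall f, f * e = ev f x *: e.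
Proof.
move=> e0 r1; have [phi [v [lphi hE]]] := rk1P (@hitR_linear _ _ e) r1.
have eE h : ev e h = phi h * eps v.
  by rewrite -[ev e h]mul1r -[in LHS](mul1r e) -ev_hitR hE evlZ ?mul1r.
have v0 : eps v != 0.
  by apply: contra_neq e0 => v0; apply: evP => h; rewrite eE v0 mulr0 /ev lfunE.
pose x := (eps v)^-1 *: v.
have xE f : f * e = ev f x *: e.
  by apply: evP => h; rewrite -ev_hitR hE evlZ evrZ eE /x evlZ [RHS]mulrC -mulrA mulVKf.
exists x => //; apply: glikeP => [f g|]; last first.
  by rewrite /x (linearZ' (@eps_linear _ H)) [LHS]mulVf.
have /eqP : (ev (f * g) x - ev f x * ev g x) *: e = 0.
  by rewrite scalerBl -xE -mulrA xE -scalerAr xE scalerA [ev g x * _]mulrC subrr.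
by rewrite scaler_eq0 (negPf e0) orbF subr_eq0 => /eqP.
Qed.

(** Translated by [x], [e] becomes a left integral, so [e] is a multiple of lam(_ y) with [y] the
    inverse of [x]. Both [e] and [lam] are symmetric, which forces [y] to be central. *)
Lemma central_grouplike_of_class e (x : H) : class_fun e -> e != 0 -> glike x ->
  (forall f, f * e = ev f x *: e) -> forall a, x * a = a * x.
Proof.
move=> ce e0 gx xE; set y := antipode x.
have xy : x * y = 1 := glike_mulS gx; have yx : y * x = 1 := glike_Smul gx.
pose e' := shift e x.
have e'int f : f * e' = ev f 1 *: e'.
  apply: evP => a; have -> : f = shift (shift f y) x.
    by apply: evP => z; rewrite !shiftE -mulrA xy mulr1.
  by rewrite -ev_shiftM // xE !evrZ !shiftE mul1r.
have [c cE] : exists c : k, forall a, ev e a = c * lam (a * y).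
  exists (n%:R^-1 * ev e' 1) => a; have := e'int (@lamA k H); rewrite lamA_mul lamA1.
  have E2 : ev e' (a * y) = ev e a by rewrite shiftE -mulrA yx mulr1.
  move/(congr1 (fun g => ev g (a * y))); rewrite /= !evrZ E2 ev_lamA.
  by move=> E; rewrite -mulrA E mulKf.
have c0 : c != 0.
  by apply: contra_neq e0 => c0; apply: evP => a; rewrite cE c0 mul0r /ev lfunE.
have lC := lamC LamP eps_Lam char0 D0.
have yC h : h * y = y * h.
  apply/eqP; rewrite -subr_eq0; apply/eqP; apply: (lam_nondegr LamP eps_Lam) => a.
  rewrite mulrBr -scaleN1r addrC lam_linear.
  have := ce a h; rewrite !cE => /(mulfI c0).
  rewrite -mulrA => ->; rewrite -[h * a * y]mulrA lC -mulrA.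
  by rewrite scaleN1r addNr.
move=> a; rewrite -[LHS]mulr1 -yx -mulrA [a * _]mulrA yC.
by rewrite !mulrA xy mul1r.
Qed.

(* The ranks of the primitive summands [e j] of [LamG] divide [n] and add up to
   [p ^ a < q]. One summand is the integral, of rank [1], so [p] does not divide all
   the other ranks, and a rank dividing [n] that is below [q] and prime to [p] is [1]. *)
Lemma central_grouplike (p q a : nat) : prime p -> prime q -> (0 < a)%N -> (p ^ a < q)%N ->
    forall c, n = (p ^ a * q ^ c)%N -> N = (q ^ c)%N ->
  exists x : H, [/\ glike x, x != 1, forall h, x * h = h * x
    & forall g, g \in s -> ev g x = 1].
Proof.
move=> pp pq a0 paq c nE NE.
have [J [e [ce e0 oe se pe]]] := class_fun_decomp LamG_class LamG_idem.
have ei j : e j * e j = e j by rewrite oe eqxx.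
have rE j := rk_idem (ei j).
have sr : (\sum_j rk (hitR (e j)) = p ^ a)%N.
  apply: (natr_inj0 char0); rewrite natr_sum; under eq_bigr => j _ do rewrite rE.
  rewrite -mulr_sumr -evr_sum se delta_LamG nE NE natrM mulfK //.
  by rewrite -NE.
have [j0 ej0] : exists j, ev (e j) 1 != 0.
  apply/existsP; apply: contraT; rewrite negb_exists => /forallP z.
  have := ev_LamG1; rewrite -se evr_sum big1 => [/eqP|j _].
    by rewrite eq_sym oner_eq0.
  by have /negPn/eqP := z j.
(* The product e_j0 lamA e_j0 is a multiple of [e j0] by primitivity, and a nonzero multiple of the
   integral [lamA] by the choice of [j0]. *)
have [c' c'E] : exists c' : k, e j0 = c' *: (@lamA k H).
  have [x] := pe j0 _ lamA_class; rewrite lam_mul_dual -scalerAl lamA_mul scalerA => E.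
  have x0 : x != 0.
    apply/eqP=> x0; move/eqP: E; rewrite x0 scale0r scaler_eq0 (negPf lamA_neq0) orbF.
    by rewrite mulf_eq0 (negPf ej0).
  by exists (x^-1 * (ev (e j0) 1 * ev (e j0) 1)); rewrite -scalerA E scalerA mulVf ?scale1r.
have c'0 : c' != 0 by apply: contraNneq (e0 j0) => z; rewrite c'E z scale0r.
have r0 : rk (hitR (e j0)) = 1%N.
  apply: (natr_inj0 char0); rewrite rE c'E evrZ ev_lamA (lam_Lam LamP eps_Lam) mulr1.
  have := ei j0; rewrite c'E -scalerAl -scalerAr lamA_mul lamA1 !scalerA => /eqP.
  rewrite -subr_eq0 -scalerBl scaler_eq0 (negPf lamA_neq0) orbF subr_eq0 -mulrA => /eqP E.
  by apply: (mulfI c'0); rewrite mulr1 [n%:R * _]mulrC.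
have [j1 nj pj] : exists2 j1, j1 != j0 & ~~ (p %| rk (hitR (e j1)))%N.
  have : ~~ [forall j, (j != j0) ==> (p %| rk (hitR (e j)))%N].
    apply/negP=> /forallP div.
    have : (p %| \sum_j rk (hitR (e j)))%N by rewrite sr dvdn_exp.
    rewrite (bigD1 j0) //= r0 dvdn_addl; first by rewrite dvdn1 gtn_eqF ?prime_gt1.
    by apply: dvdn_sum => j nj; move/implyP: (div j); apply.
  by rewrite negb_forall => /existsP[j]; rewrite negb_imply => /andP[]; exists j.
have dv : (rk (hitR (e j1)) %| n)%N by apply: class_equation => // f; exact: pe.
have r1 : rk (hitR (e j1)) = 1%N.
  have r_gt0 : (0 < rk (hitR (e j1)))%N.
    by rewrite lt0n; apply: contraNneq pj => ->; rewrite dvdn0.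
  have rlt : (rk (hitR (e j1)) < q)%N.
    by apply: leq_ltn_trans paq; rewrite -sr (bigD1 j1) //= leq_addr.
  have cp : coprime (rk (hitR (e j1))) (p ^ a).
    by rewrite coprimeXr // coprime_sym prime_coprime.
  move: dv; rewrite nE Gauss_dvdr // => dv.
  have cq : coprime (rk (hitR (e j1))) (q ^ c).
    rewrite coprimeXr // coprime_sym prime_coprime //; apply/negP=> /dvdn_leq.
    by rewrite r_gt0 leqNgt rlt => /(_ isT).
  by apply/eqP; rewrite -dvdn1 -(Gauss_dvdr _ cq) muln1.
have [x gx xE] := rank_one_grouplike (e0 j1) r1.
exists x; split=> //.
(* If x = 1, then [e j1] is an integral too, which its orthogonality to [e j0] excludes. *)
- apply: contra_neq (e0 j1) => x1.
  have := xE (@lamA k H); rewrite x1 lamA1 lamA_mul => E.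
  have : e j1 * e j0 = 0 by rewrite oe (negPf nj).
  rewrite c'E -scalerAr lam_mul_dual scalerA => /eqP.
  rewrite scaler_eq0 (negPf lamA_neq0) orbF mulf_eq0 (negPf c'0) => /eqP z.
  by apply: (scalerI n_neq0); rewrite -E z scale0r scaler0.
- exact: central_grouplike_of_class xE.
(* As [g] fixes [LamG], it fixes the summand [e j1], on which it acts by [ev g x]. *)
move=> g /sP gg; have Le : LamG * e j1 = e j1.
  rewrite -se mulr_suml (bigD1 j1) //= oe eqxx big1 ?addr0 // => j njj.
  by rewrite oe (negPf njj).
have /eqP : (ev g x - 1) *: e j1 = 0.
  by rewrite scalerBl -xE scale1r -{1}Le mulrA mul_LamG // Le subrr.
by rewrite scaler_eq0 (negPf (e0 j1)) orbF subr_eq0 => /eqP.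
Qed.

End Grouplikes.
End CentralGrouplike.

(** * Functoriality of the tensor product *)

Section TensorMaps.
Variable k : fieldType.
Implicit Types U V W : vectType k.

Lemma tmap_comp U V U' V' U'' V'' (f' : U' -> U'') (g' : V' -> V'')
    (f : U -> U') (g : V -> V') t :
  linear f -> linear g -> linear f' -> linear g' ->
  tmap f' g' (tmap f g t) = tmap (f' \o f) (g' \o g) t.
Proof.
move=> lf lg lf' lg'.
exact: (tlift_tmap f g t (bilin_comp (tpure_bilin _ _) lf' lg')).
Qed.

Lemma eq_tmap U V U' V' (f f' : U -> U') (g g' : V -> V') t :
  f =1 f' -> g =1 g' -> tmap f g t = tmap f' g' t.
Proof. by move=> ff gg; apply: eq_tlift => u v; rewrite ff gg. Qed.

Lemma tassoc_tmap U V W U' V' W' (f : U -> U') (g : V -> V') (h : W -> W') t :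
  linear f -> linear g -> linear h ->
  tassoc (tmap (tmap f g) h t) = tmap f (tmap g h) (tassoc t).
Proof.
move=> lf lg lh; move: t.
have lfg := tmap_linear f g; have lgh := tmap_linear g h.
apply: tens_ext => [c s t|c s t|t w].
- by rewrite tmap_linear tassoc_linear.
- by rewrite tassoc_linear tmap_linear.
move: t; apply: tens_ext => [c s t|c s t|u v].
- by rewrite (tpure_bilin _ _).1 tmap_linear tassoc_linear.
- by rewrite (tpure_bilin _ _).1 tassoc_linear tmap_linear.
by rewrite !(tmapE, tassocE).
Qed.

Lemma tmap_tmul (B C B' C' : falgType k) (f : B -> B') (g : C -> C') s t :
  linear f -> linear g -> {morph f : x y / x * y} -> {morph g : x y / x * y} ->
  tmap f g (tmul s t) = tmul (tmap f g s) (tmap f g t).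
Proof.
move=> lf lg fM gM; have [tl tr] := @tmul_bilin k B C; have [tl' tr'] := @tmul_bilin k B' C'.
move: s; apply: tens_ext => [c x y|c x y|b c]; rewrite ?tl ?tmap_linear ?tl' //.
move: t; apply: tens_ext => [d x y|d x y|b' c']; rewrite ?tr ?tmap_linear ?tr' //.
by rewrite tmulE !tmapE // tmulE fM gM.
Qed.

End TensorMaps.

Section MkAhom.
Variables (k : fieldType) (A B : falgType k) (f : A -> B) (lf : linear f).
Hypotheses (fM : {morph f : x y / x * y}) (f1 : f 1 = 1).

Fact mkahom_subproof : ahom_in fullv (mkhom lf).
Proof. by apply/ahom_inP; split=> [u v _ _|]; rewrite !mkhomE; [exact: fM|]. Qed.

Definition mkahom : 'AHom(A, B) := AHom mkahom_subproof.

Lemma mkahomE x : mkahom x = f x. Proof. exact: mkhomE. Qed.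

End MkAhom.

(** * The quotient by a central group-like element *)

(** Bundled so that the quotient type and its Hopf structure depend on a single term. [cgl_order] is
    any invertible exponent; where the exact order matters, it is the hypothesis [xmin]. *)
Record cglike (k : fieldType) (H : hopfType k) := CGlike {
  cgl :> H;
  cgl_order : nat;
  cgl_glike : glike cgl;
  cgl_central : forall h, cgl * h = h * cgl;
  cgl_exp : cgl ^+ cgl_order = 1;
  cgl_order_neq0 : cgl_order%:R != 0 :> k }.

Section Quotient.
Variables (k : fieldType) (H : hopfType k) (x : cglike H).
Local Notation N := (cgl_order x).
Implicit Types (h g : H).

Definition cidem : H := N%:R^-1 *: \sum_(i < N) (x : H) ^+ i.

Let N0 := cgl_order_neq0 x.

Lemma mul_cidem : (x : H) * cidem = cidem.
Proof.
rewrite /cidem -scalerAr mulr_sumr; congr (_ *: _).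
have := cgl_exp x; case: (N) => [|m] xN; first by rewrite !big_ord0.
under eq_bigr => i _ do rewrite -exprS.
by rewrite big_ord_recr big_ord_recl /= xN expr0 addrC.
Qed.

Lemma expr_cidem i : (x : H) ^+ i * cidem = cidem.
Proof. by elim: i => [|i IH]; rewrite ?mul1r // exprS -mulrA IH mul_cidem. Qed.

Lemma cidem_idem : cidem * cidem = cidem.
Proof.
rewrite {1}/cidem -scalerAl mulr_suml; under eq_bigr => i _ do rewrite expr_cidem.
by rewrite sumr_const card_ord -scaler_nat scalerA mulVf // scale1r.
Qed.

Lemma cidem_central h : cidem * h = h * cidem.
Proof.
rewrite /cidem -scalerAl -scalerAr mulr_suml mulr_sumr; congr (_ *: _).
apply: eq_bigr => i _; elim: (nat_of_ord i) => [|m IH]; first by rewrite mul1r mulr1.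
by rewrite exprS -mulrA IH !mulrA (cgl_central x).
Qed.

Lemma eps_cidem : eps cidem = 1.
Proof.
rewrite /cidem (linearZ' (@eps_linear _ H)) (linear_sum' (@eps_linear _ H)).
under eq_bigr => i _ do rewrite (glikeX i (cgl_glike x)).2.
by rewrite sumr_const card_ord [LHS]mulVf.
Qed.

Lemma cidem_neq0 : cidem != 0.
Proof.
apply: contra_eq_neq eps_cidem => ->.
by rewrite (linear0' (@eps_linear _ H)) eq_sym oner_eq0.
Qed.

Definition cspace : {vspace H} := limg (amulr cidem).

Lemma cspaceP h : (h \in cspace) = (h * cidem == h).
Proof.
apply/memv_imgP/eqP=> [[y _ ->]|hu]; first by rewrite lfunE /= -mulrA cidem_idem.
by exists h; rewrite ?memvf // lfunE /= hu.
Qed.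

Fact cspace_aspace : is_aspace cspace.
Proof.
apply/andP; split.
  apply/has_algidP; exists cidem; split; first by rewrite cspaceP cidem_idem.
    exact: cidem_neq0.
  by move=> u; rewrite cspaceP => /eqP uE; rewrite cidem_central.
apply/prodvP=> u v; rewrite !cspaceP => /eqP uE /eqP vE.
by rewrite -mulrA vE.
Qed.

Definition casp : {aspace H} := ASpace cspace_aspace.

(** The quotient by the ideal generated by x - 1, realised as the ideal generated by the central
    idempotent [cidem], with unit [cidem] and projection h -> h cidem. *)
Definition hquot : Type := subvs_of casp.
HB.instance Definition _ := Falgebra.on hquot.

Lemma algid_casp : algid casp = cidem.
Proof.
have uU : cidem \in casp by rewrite [_ \in _]cspaceP cidem_idem.
have := memv_algid casp; rewrite [_ \in _]cspaceP => /eqP <-.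
by rewrite algidl.
Qed.

Definition hval (y : hquot) : H := vsval y.
Definition hproj h : hquot := vsproj casp (h * cidem).

Lemma hval_linear : linear hval. Proof. by move=> c y z. Qed.
Lemma hvalM (y z : hquot) : hval (y * z) = hval y * hval z. Proof. by []. Qed.
Lemma hval1 : hval 1 = cidem. Proof. exact: algid_casp. Qed.
Lemma hval_inj : injective hval. Proof. exact: val_inj. Qed.

Lemma hprojK h : hval (hproj h) = h * cidem.
Proof. by rewrite /hval /hproj vsprojK // [_ \in _]cspaceP -mulrA cidem_idem. Qed.

Lemma hvalK y : hproj (hval y) = y.
Proof.
apply: hval_inj; rewrite hprojK; apply/eqP; rewrite -cspaceP.
exact: (subvsP y).
Qed.

Lemma hproj_linear : linear hproj.
Proof.
move=> c g h; apply: hval_inj; rewrite hprojK mulrDl -scalerAl.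
by rewrite hval_linear !hprojK.
Qed.

Lemma hprojM g h : hproj (g * h) = hproj g * hproj h.
Proof.
apply: hval_inj; rewrite hvalM !hprojK -[in RHS]mulrA [cidem * _]mulrA.
by rewrite cidem_central -!mulrA cidem_idem.
Qed.

Lemma hproj1 : hproj 1 = 1.
Proof. by apply: hval_inj; rewrite hval1 hprojK mul1r. Qed.

Lemma hproj_expr i : hproj ((x : H) ^+ i) = 1.
Proof. by apply: hval_inj; rewrite hval1 hprojK expr_cidem. Qed.

Definition qcomul_fun (y : hquot) : tens hquot hquot :=
  tmap hproj hproj (comul (hval y)).

Fact qcomul_linear : linear qcomul_fun.
Proof. by move=> c y z; rewrite /qcomul_fun hval_linear linearP tmap_linear. Qed.

Fact qcounit_linear : linear (fun y : hquot => counit (hval y)).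
Proof. by move=> c y z; rewrite hval_linear linearP. Qed.

Fact qantipode_linear : linear (fun y : hquot => hproj (antipode (hval y))).
Proof. by move=> c y z; rewrite hval_linear linearP hproj_linear. Qed.

Definition qcomul := mkhom qcomul_linear.
Definition qcounit : 'Hom(hquot, k^o) := mkhom qcounit_linear.
Definition qantipode := mkhom qantipode_linear.

Let pp := tmap_linear hproj hproj.

Lemma qcomulE h : qcomul (hproj h) = tmap hproj hproj (comul h).
Proof.
rewrite mkhomE /qcomul_fun hprojK comulM tmap_tmul;
  try exact: hproj_linear; try exact: hprojM.
have -> : tmap hproj hproj (comul cidem) = tpure 1 1.
  have E i : tmap hproj hproj (comul ((x : H) ^+ i)) = tpure 1 1.
    by rewrite (glikeX i (cgl_glike x)).1 (tmapE _ _ hproj_linear hproj_linear) hproj_expr.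
  rewrite /cidem linearZ linear_sum /= (linearZ' pp) (linear_sum' pp).
  under eq_bigr => i _ do rewrite E.
  by rewrite sumr_const card_ord -scaler_nat scalerA mulVf // scale1r.
have [tl tr] := @tmul_bilin k hquot hquot; move: (tmap _ _ _); apply: tens_ext => //.
by move=> u v; rewrite tmulE !mulr1.
Qed.

Lemma qcounitE h : qcounit (hproj h) = counit h.
Proof. by rewrite mkhomE hprojK [LHS]epsM eps_cidem mulr1. Qed.

Lemma hproj_antipode_cidem : hproj (antipode cidem) = 1.
Proof.
rewrite /cidem linearZ linear_sum /= (linearZ' hproj_linear) (linear_sum' hproj_linear).
under eq_bigr => i _.
  rewrite -[hproj _]mulr1 -(hproj_expr i) -hprojM.
  rewrite (glike_Smul (glikeX i (cgl_glike x))) hproj1; over.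
by rewrite sumr_const card_ord -scaler_nat scalerA mulVf // scale1r.
Qed.

Lemma qantipodeE h : qantipode (hproj h) = hproj (antipode h).
Proof.
by rewrite mkhomE hprojK antipodeM hprojM hproj_antipode_cidem mul1r.
Qed.

Let lp := hproj_linear.
Let hprojP (y : hquot) : exists h, y = hproj h.
Proof. by exists (hval y); rewrite hvalK. Qed.

Fact qcomulA (y : hquot) :
  tassoc (tmap qcomul idfun (qcomul y)) = tmap idfun qcomul (qcomul y).
Proof.
have lq : linear qcomul by exact: linearP.
have lc : linear (@comul k H) by exact: linearP.
have li (V : vectType k) : linear (@idfun V) by [].
have [h ->] := hprojP y; rewrite !qcomulE !tmap_comp //.
pose c2 := tmap hproj hproj \o @comul k H.
rewrite (@eq_tmap _ _ _ _ _ _ c2 _ (hproj \o idfun)) //; last exact: qcomulE.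
rewrite [RHS](@eq_tmap _ _ _ _ _ _ (hproj \o idfun) _ c2) //; last exact: qcomulE.
rewrite -[RHS](tmap_comp _ (li H) lc lp pp) -[X in tassoc X](tmap_comp _ lc (li H) pp lp).
by rewrite tassoc_tmap // comulA.
Qed.

Let tlift_qcomul (W : vectType k) (F : hquot -> hquot -> W) h : bilin F ->
  tlift F (qcomul (hproj h)) = tlift (fun u v => F (hproj u) (hproj v)) (comul h).
Proof. by move=> bF; rewrite qcomulE tlift_tmap. Qed.

Fact qcounitl (y : hquot) : tlift (fun a b : hquot => qcounit a *: b) (qcomul y) = y.
Proof.
have [h ->] := hprojP y; rewrite tlift_qcomul; last first.
  by split=> [v|u] c s t; rewrite ?linearP ?scalerDl ?scalerA // scalerDr !scalerA mulrC.
under eq_tlift => u v do rewrite qcounitE -(linearZ' lp).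
by rewrite -(tlift_comp _ lp) counitl.
Qed.

Fact qcounitr (y : hquot) : tlift (fun a b : hquot => qcounit b *: a) (qcomul y) = y.
Proof.
have [h ->] := hprojP y; rewrite tlift_qcomul; last first.
  by split=> [v|u] c s t; rewrite ?linearP ?scalerDl ?scalerA // scalerDr !scalerA mulrC.
under eq_tlift => u v do rewrite qcounitE -(linearZ' lp).
by rewrite -(tlift_comp _ lp) counitr.
Qed.

Fact qcomul1 : qcomul 1 = tpure (1 : hquot) (1 : hquot).
Proof. by rewrite -hproj1 qcomulE comul1 tmapE. Qed.

Fact qcomulM (y z : hquot) : qcomul (y * z) = tmul (qcomul y) (qcomul z).
Proof.
have [h ->] := hprojP y; have [g ->] := hprojP z.
by rewrite -hprojM !qcomulE comulM tmap_tmul //; exact: hprojM.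
Qed.

Fact qcounit1 : qcounit 1 = 1.
Proof. by rewrite -hproj1 qcounitE counit1. Qed.

Fact qcounitM (y z : hquot) : qcounit (y * z) = qcounit y * qcounit z.
Proof.
have [h ->] := hprojP y; have [g ->] := hprojP z.
by rewrite -hprojM !qcounitE counitM.
Qed.

Fact qantipodel (y : hquot) :
  tlift (fun a b : hquot => qantipode a * b) (qcomul y) = qcounit y *: 1.
Proof.
have [ml mr] := @mul_bilin k hquot.
have [h ->] := hprojP y; rewrite tlift_qcomul; last first.
  by split=> [v|u] c s t; rewrite ?linearP ?ml ?mr.
under eq_tlift => u v do rewrite qantipodeE -hprojM.
by rewrite -(tlift_comp _ lp) antipodel qcounitE (linearZ' lp) hproj1.
Qed.

Fact qantipoder (y : hquot) :
  tlift (fun a b : hquot => a * qantipode b) (qcomul y) = qcounit y *: 1.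
Proof.
have [ml mr] := @mul_bilin k hquot.
have [h ->] := hprojP y; rewrite tlift_qcomul; last first.
  by split=> [v|u] c s t; rewrite ?linearP ?ml ?mr.
under eq_tlift => u v do rewrite qantipodeE -hprojM.
by rewrite -(tlift_comp _ lp) antipoder qcounitE (linearZ' lp) hproj1.
Qed.

HB.instance Definition _ := Falgebra_isHopf.Build k hquot
  qcomulA qcounitl qcounitr qcomul1 qcomulM qcounit1 qcounitM qantipodel qantipoder.

Definition hpi : 'AHom(H, hquot) := mkahom hproj_linear hprojM hproj1.

Lemma hpiE h : hpi h = hproj h. Proof. exact: mkahomE. Qed.

Lemma hpi_hopf : hopf_hom hpi.
Proof.
split=> h; rewrite !hpiE; [rewrite [LHS]qcomulE|exact: qcounitE|exact: qantipodeE].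
by apply: eq_tmap => u; rewrite hpiE.
Qed.

Lemma hpi_full : limg hpi = fullv.
Proof.
apply/eqP; rewrite eqEsubv subvf; apply/subvP=> y _.
by have [h ->] := hprojP y; rewrite -hpiE memv_img ?memvf.
Qed.

Lemma eps_hproj h : eps (hproj h) = eps h.
Proof. exact: qcounitE. Qed.

End Quotient.

Section QuotientIntegral.
Variables (k : closedFieldType) (H : hopfType k) (Lam : H).
Hypothesis char0 : [pchar k] =i pred0.
Hypothesis vnr : forall a : H, exists b, a * b * a = a.
Hypothesis LamP : forall h, h * Lam = eps h *: Lam.
Hypothesis eps_Lam : eps Lam = 1.
Variable x : cglike H.
Local Notation N := (cgl_order x).
Local Notation n := (\dim {:H}).
Local Notation b := (@bas k H).
Hypothesis xmin : forall i, (0 < i < N)%N -> (x : H) ^+ i != 1.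

Let D0 := lam1_neq0 char0 vnr LamP eps_Lam.

Lemma hquot_vnr (a : hquot x) : exists c, a * c * a = a.
Proof.
have [c cE] := vnr (hval a); exists (hproj x c).
by rewrite -[X in X * _ * X](hvalK a) -!hprojM cE hvalK.
Qed.

Lemma hquot_integral (y : hquot x) : y * hproj x Lam = eps y *: hproj x Lam.
Proof.
by rewrite -{1}(hvalK y) -hprojM LamP (linearZ' (@hproj_linear _ _ x)) -[in RHS](hvalK y) eps_hproj.
Qed.

(** At a group-like [g] the integral property reads lam(g) g = lam(g) 1. *)
Lemma lam_glike (g : H) : glike g -> lam g = if g == 1 then n%:R else 0.
Proof.
move=> gg; case: eqP => [->|g1]; first exact: (lam1 LamP eps_Lam char0 D0).
apply/eqP; apply: contraT => lg; case: g1.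
have := lam_int g.
have -> : \sum_i lam (b i) *: cp g i = lam g *: g.
  apply: ev_sep => f; rewrite evl_sum evlZ -ev_lamA -(ev_glikeM _ _ gg) evM.
  by apply: eq_bigr => i _; rewrite evlZ ev_lamA.
by move/(scalerI lg).
Qed.

Lemma lam_cidem : lam (cidem x) = n%:R / N%:R.
Proof.
rewrite /cidem lamZ lam_sum mulrC; congr (_ * _).
have := cgl_order_neq0 x; have := xmin; case: (N) => [_|m xm _]; first by rewrite eqxx.
rewrite big_ord_recl big1 => [|i _].
  by rewrite expr0 lam_glike ?eqxx ?addr0 //; exact: glike1.
rewrite lam_glike; last exact/glikeX/cgl_glike.
by rewrite (negPf (xm _ _)) // /bump /= ltnS ltn_ord.
Qed.

(** By cyclicity of the trace, the dimension of the quotient is the trace of right multiplication by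
    [cidem] on [H], which is n / N. *)
Lemma dim_hquot : (\dim {:hquot x} * N = n)%N.
Proof.
apply: (natr_inj0 char0); rewrite natrM -(@lintr_id _ (hquot x)).
have C := @lintrC _ H (hquot x) (hproj x) (@hval _ _ x) (@hproj_linear _ _ x) (@hval_linear _ _ x).
have -> : lintr (@id (hquot x)) = lintr (hproj x \o @hval _ _ x).
  by apply: eq_lintr => y /=; rewrite hvalK.
rewrite C (@eq_lintr _ H _ (fun y => y * cidem x)); last exact: hprojK.
rewrite -(lamE LamP eps_Lam char0 D0) lam_cidem divfK //.
exact: cgl_order_neq0.
Qed.

Definition in_cyclic (h : H) := exists c : 'I_N -> k, h = \sum_i c i *: (x : H) ^+ i.

(** For g = 1 this is the left integral property of [lamA]; the general case is its translate by
    [g]. *)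
Lemma hitR_shift (g : H) h : glike g ->
  hitR (shift (@lamA k H) g) h = lam (h * g) *: antipode g.
Proof.
move=> gg; apply: ev_sep => f; rewrite ev_hitR evlZ.
have -> : f = shift (shift f (antipode g)) g.
  by apply: evP => y; rewrite !shiftE -mulrA glike_mulS // mulr1.
rewrite -ev_shiftM // (lam_mul_dual char0 vnr LamP eps_Lam) evrZ ev_lamA !shiftE.
by rewrite mul1r glike_Smul // mul1r mulrC.
Qed.

Lemma lam_shift_l (g : H) h : glike g ->
  \sum_i lam (b i * g) *: cp h i = lam (h * g) *: antipode g.
Proof.
move=> gg; apply: ev_sep => f; rewrite evl_sum evlZ.
transitivity (ev (shift (@lamA k H) g * f) h).
  by rewrite evM; apply: eq_bigr => i _; rewrite evlZ shiftE ev_lamA.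
have {1}-> : f = shift (shift f (antipode g)) g.
  by apply: evP => y; rewrite !shiftE -mulrA glike_mulS // mulr1.
by rewrite -ev_shiftM // lamA_mul evrZ ev_lamA shiftE mul1r mulrC.
Qed.

Lemma antipode_expr i : (i <= N)%N -> antipode ((x : H) ^+ i) = (x : H) ^+ (N - i).
Proof.
move=> iN; rewrite -[RHS]mul1r -(glike_Smul (glikeX i (cgl_glike x))) -mulrA.
by rewrite -exprD subnKC // cgl_exp mulr1.
Qed.

Lemma in_cyclic_expr m : in_cyclic ((x : H) ^+ m).
Proof.
have N0 : (0 < N)%N.
  by rewrite lt0n; apply: contraTneq (cgl_order_neq0 x) => ->; rewrite eqxx.
have mN : (m %% N < N)%N by rewrite ltn_mod.
exists (fun i => (i == Ordinal mN)%:R); rewrite (bigD1 (Ordinal mN)) //= eqxx scale1r.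
rewrite big1 ?addr0 => [|i /negPf ->]; last by rewrite scale0r.
by rewrite expr_mod // cgl_exp.
Qed.

Lemma in_cyclic_lin (c : k) g h : in_cyclic g -> in_cyclic h -> in_cyclic (c *: g + h).
Proof.
move=> [c1 ->] [c2 ->]; exists (fun i => c * c1 i + c2 i).
rewrite scaler_sumr -big_split; apply: eq_bigr => i _ /=.
by rewrite scalerDl scalerA.
Qed.

Lemma in_cyclic_sum (I : finType) (F : I -> H) :
  (forall i, in_cyclic (F i)) -> in_cyclic (\sum_i F i).
Proof.
move=> cF; apply: big_rec => [|i h _ ch].
  by exists (fun=> 0); rewrite big1 // => i _; rewrite scale0r.
by rewrite -[F i]scale1r; apply: in_cyclic_lin.
Qed.

Lemma in_cyclicZ (c : k) h : in_cyclic h -> in_cyclic (c *: h).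
Proof.
by move=> ch; rewrite -[_ *: _]addr0; apply: in_cyclic_lin => //;
  exists (fun=> 0); rewrite big1 // => i _; rewrite scale0r.
Qed.

Let lam_cidem_neq0 : lam (cidem x) != 0.
Proof.
rewrite lam_cidem mulf_neq0 ?invr_eq0 ?cgl_order_neq0 //.
by move/pcharf0P: char0 => ->; rewrite -lt0n; exact: (adim_gt0 {:H}%AS).
Qed.

Let lam_hval_linear : linear ((fun y : hquot x => lam (hval y)) : hquot x -> k^o).
Proof. by move=> c y z; rewrite hval_linear lam_linear. Qed.

Let lam_hpi (y : H) :
  lam (hval (hpi x y)) = N%:R^-1 * \sum_(j < N) lam (y * (x : H) ^+ j).
Proof. by rewrite hpiE hprojK /cidem -scalerAr lamZ [y * _]mulr_sumr lam_sum. Qed.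

Let lam_hpi_sum (I : finType) (u v : I -> H) :
  \sum_i lam (hval (hpi x (u i))) *: v i =
  N%:R^-1 *: \sum_(j < N) \sum_i lam (u i * (x : H) ^+ j) *: v i.
Proof.
rewrite exchange_big scaler_sumr; apply: eq_bigr => i _ /=.
by rewrite lam_hpi -scalerA scaler_suml.
Qed.

(* Applying the integral [lam] to the factor in the quotient recovers [h] up to a
   nonzero scalar. *)
Lemma rcoinvE h : rcoinv (hpi x) h <-> in_cyclic h.
Proof.
have lp : linear (hpi x) by exact: linearP.
have li : linear (@idfun H) by [].
split=> [rh|[c ->]]; last first.
  rewrite /rcoinv linear_sum (linear_sum' (tmap_linear _ _)).
  rewrite (linear_sum' ((@tpure_bilin _ _ _).1 _)); apply: eq_bigr => i _.
  rewrite linearZ (linearZ' (tmap_linear _ _)) (linearZ' ((@tpure_bilin _ _ _).1 _)) /=.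
  by rewrite (glikeX i (cgl_glike x)).1 tmapE // hpiE hproj_expr.
pose F (a : H) (y : hquot x) := lam (hval y) *: a.
have bF : bilin F.
  split=> [v|u] c s t; rewrite /F; first by rewrite scalerDr !scalerA mulrC.
  by rewrite lam_hval_linear scalerDl scalerA.
have := congr1 (tlift F) rh; rewrite tlift_tmap // tliftE // /F hval1 => E.
have : h = (lam (cidem x))^-1 *: (lam (cidem x) *: h) by rewrite scalerA mulVf ?scale1r.
rewrite -E => ->; apply: in_cyclicZ.
rewrite tlift_cp; last exact: (bilin_comp bF).
rewrite lam_hpi_sum; apply/in_cyclicZ/in_cyclic_sum => j.
have -> : \sum_i lam (cp h i * (x : H) ^+ j) *: idfun (b i) =
    hitR (shift (@lamA k H) ((x : H) ^+ j)) h.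
  by apply: eq_bigr => i _; rewrite shiftE ev_lamA.
rewrite hitR_shift ?antipode_expr; [|exact: ltnW|exact/glikeX/cgl_glike].
exact/in_cyclicZ/in_cyclic_expr.
Qed.

(** The mirror image of [rcoinvE], using [lamA] as a right integral instead of a left one. *)
Lemma lcoinvE h : lcoinv (hpi x) h <-> in_cyclic h.
Proof.
have lp : linear (hpi x) by exact: linearP.
have li : linear (@idfun H) by [].
split=> [rh|[c ->]]; last first.
  rewrite /lcoinv linear_sum (linear_sum' (tmap_linear _ _)).
  rewrite (linear_sum' ((@tpure_bilin _ _ _).2 _)); apply: eq_bigr => i _.
  rewrite linearZ (linearZ' (tmap_linear _ _)) (linearZ' ((@tpure_bilin _ _ _).2 _)) /=.
  by rewrite (glikeX i (cgl_glike x)).1 tmapE // hpiE hproj_expr.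
pose F (y : hquot x) (a : H) := lam (hval y) *: a.
have bF : bilin F.
  split=> [v|u] c s t; rewrite /F; last by rewrite scalerDr !scalerA mulrC.
  by rewrite lam_hval_linear scalerDl scalerA.
have := congr1 (tlift F) rh; rewrite tlift_tmap // tliftE // /F hval1 => E.
have : h = (lam (cidem x))^-1 *: (lam (cidem x) *: h) by rewrite scalerA mulVf ?scale1r.
rewrite -E => ->; apply: in_cyclicZ.
rewrite tlift_cp; last exact: (bilin_comp bF).
rewrite lam_hpi_sum; apply/in_cyclicZ/in_cyclic_sum => j.
have gj := glikeX j (cgl_glike x).
rewrite /= lam_shift_l // antipode_expr; last exact: ltnW.
exact/in_cyclicZ/in_cyclic_expr.
Qed.

Lemma hpi_normal : hopf_normal (hpi x).
Proof. by move=> h; split=> [/rcoinvE/lcoinvE|/lcoinvE/rcoinvE]. Qed.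

End QuotientIntegral.

(** * Group algebras and their duals *)

Section Morphisms.
Variable k : fieldType.
Implicit Types H B C : hopfType k.

Lemma tmap_id (U V : vectType k) (t : tens U V) : tmap idfun idfun t = t.
Proof. exact: tens_basisE. Qed.

Lemma hopf_iso_refl H : hopf_iso H H.
Proof.
exists \1%AF; split; last by exists id => h; rewrite lfunE.
split=> h; rewrite !lfunE //=.
by rewrite (@eq_tmap _ _ _ _ _ _ idfun _ idfun) ?tmap_id // => u; rewrite lfunE.
Qed.

Lemma hopf_hom_comp H B C (f : 'AHom(H, B)) (g : 'AHom(B, C)) :
  hopf_hom f -> hopf_hom g -> hopf_hom (comp_ahom g f).
Proof.
move=> [fc fe fS] [gc ge gS]; split=> h; rewrite !comp_lfunE ?ge ?gS ?fS //.
rewrite gc fc tmap_comp; try exact: linearP.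
by apply: eq_tmap => u; rewrite comp_lfunE.
Qed.

End Morphisms.

Section GroupAlgebraLift.
Variables (k : fieldType) (gT : finGroupType) (H : hopfType k) (phi : gT -> H).
Local Notation kG := (galg k gT).
Hypothesis phi_glike : forall g, glike (phi g).
Hypothesis phiM : forall g h, phi (g * h)%g = phi g * phi h.
Hypothesis phi_inj : injective phi.

Definition gcoef (a : kG) (g : gT) : k := (a : {ffun gT -> k^o}) g.

Lemma gcoef_linear g : linear (gcoef^~ g : kG -> k^o).
Proof. by move=> c a b; rewrite /gcoef !ffunE. Qed.

Lemma gcoef_delta g h : gcoef (gdelta k g) h = (h == g)%:R.
Proof. by rewrite /gcoef ffunE. Qed.

Lemma gcoefP (a b : kG) : gcoef a =1 gcoef b -> a = b.
Proof. by move=> ab; apply/ffunP. Qed.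

Lemma galgE (a : kG) : a = \sum_g gcoef a g *: gdelta k g.
Proof.
apply: gcoefP => h; rewrite (linear_sum' (gcoef_linear h)) (bigD1 h) //=.
rewrite (linearZ' (gcoef_linear h)) gcoef_delta eqxx [_ *: _]mulr1.
rewrite big1 ?addr0 // => g ng.
by rewrite (linearZ' (gcoef_linear h)) gcoef_delta eq_sym (negPf ng) scaler0.
Qed.

Lemma galg_ext (W : vectType k) (f1 f2 : kG -> W) :
  linear f1 -> linear f2 -> (forall g, f1 (gdelta k g) = f2 (gdelta k g)) ->
  f1 =1 f2.
Proof.
move=> l1 l2 e a; rewrite (galgE a) (linear_sum' l1) (linear_sum' l2).
by apply: eq_bigr => g _; rewrite (linearZ' l1) (linearZ' l2) e.
Qed.

Definition glift_fun (a : kG) : H := \sum_g gcoef a g *: phi g.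

Lemma glift_linear : linear glift_fun.
Proof.
move=> c a b; rewrite /glift_fun scaler_sumr -big_split; apply: eq_bigr => g _ /=.
by rewrite gcoef_linear scalerDl scalerA.
Qed.

Lemma glift_delta g : glift_fun (gdelta k g) = phi g.
Proof.
rewrite /glift_fun (bigD1 g) //= gcoef_delta eqxx scale1r big1 ?addr0 // => h /negPf nh.
by rewrite gcoef_delta nh scale0r.
Qed.

Lemma phi1 : phi 1%g = 1.
Proof.
have gS := glike_Smul (phi_glike 1%g).
by rewrite -[LHS]mul1r -gS -mulrA -phiM mulg1.
Qed.

Lemma glift1 : glift_fun 1 = 1.
Proof. by rewrite [glift_fun 1]glift_delta phi1. Qed.

Lemma gliftM : {morph glift_fun : a b / a * b}.
Proof.
move=> a b; have [ml mr] := @mul_bilin k kG; have [nl nr] := @mul_bilin k H.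
move: a; apply: galg_ext => [c s t|c s t|g]; rewrite ?ml ?glift_linear ?nl //.
move: b; apply: galg_ext => [c s t|c s t|h]; rewrite ?mr ?glift_linear ?nr //.
rewrite [gdelta k g * _]galg_mul_delta !glift_delta; exact: phiM.
Qed.

Definition glift : 'AHom(kG, H) := mkahom glift_linear gliftM glift1.

Lemma gliftE a : glift a = \sum_g gcoef a g *: phi g.
Proof. exact: mkahomE. Qed.

Lemma glift_hopf : hopf_hom glift.
Proof.
have gE g : glift (gdelta k g) = phi g by rewrite mkahomE glift_delta.
have lg : linear glift by exact: linearP.
split; apply: galg_ext.
- by move=> c a b; rewrite !linearP.
- by move=> c a b; rewrite linearP tmap_linear.
- by move=> g; rewrite gE (phi_glike g).1 [comul _]galg_comul_delta tmapE // gE.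
- by move=> c a b; rewrite !linearP.
- by move=> c a b; rewrite !linearP.
- by move=> g; rewrite gE [RHS]galg_counit_delta; exact: (phi_glike g).2.
- by move=> c a b; rewrite !linearP.
- by move=> c a b; rewrite !linearP.
move=> g; rewrite gE [antipode (gdelta k g)]galg_antipode_delta gE.
have gS := glike_mulS (phi_glike g).
by rewrite -[LHS]mul1r -phi1 -(mulVg g) phiM -mulrA gS mulr1.
Qed.

Let t := codom_tuple phi.

Let tE (i : 'I_#|gT|) : t`_i = phi (enum_val i). Proof. exact: nth_codom. Qed.

Lemma phi_free : free t.
Proof.
apply: glike_free => [|h /codomP[g ->] //].
by rewrite map_inj_uniq ?enum_uniq.
Qed.

Lemma glift_inj : injective glift.
Proof.
move=> a' a'' aE; apply/eqP; rewrite -subr_eq0; apply/eqP; set a := a' - a''.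
have : glift a = 0 by rewrite linearB /= aE subrr.
rewrite gliftE => a0; apply: gcoefP => g.
rewrite (linear0' (gcoef_linear g)) -(enum_rankK g).
move/freeP: phi_free => /(_ (fun i => gcoef a (enum_val i))); apply.
rewrite -[RHS]a0 [RHS](reindex (@enum_val _ gT)) /=; last exact: onW_bij (enum_val_bij _).
by apply: eq_bigr => i _; rewrite tE.
Qed.

Lemma glift_bij : #|gT| = \dim {:H} -> bijective glift.
Proof.
move=> cE; have bt : basis_of fullv t.
  by rewrite basisEfree phi_free subvf size_tuple cE leqnn.
pose r h : kG := [ffun g => coord t (enum_rank g) h : k^o].
have rK : cancel r glift.
  move=> h; rewrite gliftE [RHS](coord_basis bt) ?memvf //.
  rewrite (reindex (@enum_val _ gT)) /=; last exact: onW_bij (enum_val_bij _).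
  by apply: eq_bigr => i _; rewrite tE /gcoef ffunE enum_valK.
by exists r => //; apply: inj_can_sym rK glift_inj.
Qed.

End GroupAlgebraLift.

Section Transpose.
Variables (k : fieldType) (H K : hopfType k) (L : 'AHom(K, hdual H)).
Hypothesis hL : hopf_hom L.

(** The transpose of [L], restricted to [H] inside its double dual. *)
Definition transp_fun (h : H) : hdual K := dualf (fun a => ev (L a) h).

Lemma ev_transp h a : ev (transp_fun h) a = ev (L a) h.
Proof. by rewrite dualfE // => c u v; rewrite linearP evr. Qed.

Lemma transp_linear : linear transp_fun.
Proof. by move=> c g h; apply: evP => a; rewrite evr !ev_transp evl. Qed.

Lemma transp1 : transp_fun 1 = 1.
Proof.
apply: evP => a; rewrite ev_transp ev1; have [_ <- _] := hL.
by rewrite [RHS]lfunE.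
Qed.

Let lL : linear L. Proof. exact: linearP. Qed.

Lemma transpM : {morph transp_fun : g h / g * h}.
Proof.
move=> g h; apply: evP => a; rewrite evM ev_transp.
have [ml mr] := @mul_bilin k k^o; have [Lc _ _] := hL.
have bA : bilin (fun u v : hdual H => ev u g * ev v h : k^o).
  by split=> [v|u] c s t; rewrite ?(@evr _ _ g) ?(@evr _ _ h) ?ml ?mr.
have <- : tlift (fun u v : hdual H => ev u g * ev v h : k^o) (comul (L a)) = ev (L a) (g * h).
  exact: dual_comulE.
rewrite Lc tlift_tmap // tlift_cp; last exact: (bilin_comp bA).
by apply: eq_bigr => i _; rewrite !ev_transp.
Qed.

Definition transp : 'AHom(H, hdual K) := mkahom transp_linear transpM transp1.

Lemma transpE h a : ev (transp h) a = ev (L a) h.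
Proof. by rewrite mkahomE ev_transp. Qed.

Lemma transp_hopf : hopf_hom transp.
Proof.
have [_ _ LS] := hL; have lt : linear transp by exact: linearP.
have [ml mr] := @mul_bilin k k^o.
split=> h; last first.
- apply: evP => a; rewrite ev_antipode !transpE -ev_antipode.
  by rewrite -LS.
- rewrite [LHS]lfunE /= /dual_counit_fun -/(ev _ _) transpE.
  by rewrite (rmorph1 L).
apply: prP => F G; pose x := predual (ev F); pose y := predual (ev G).
have xE g : ev g x = ev F g by rewrite predualE //; exact: evl.
have yE g : ev g y = ev G g by rewrite predualE //; exact: evl.
have E u v : ev F u * ev G v = ev u x * ev v y by rewrite xE yE.
have bA : bilin (fun u v : hdual K => ev u x * ev v y : k^o).
  by split=> [v|u] c s t; rewrite ?(@evr _ _ x) ?(@evr _ _ y) ?ml ?mr.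
rewrite /pr !(@eq_tlift _ _ _ k^o _ _ E) [LHS](dual_comulE (transp h) x y).
rewrite -/(ev _ _) transpE rmorphM evM tlift_tmap // tlift_cp; last exact: (bilin_comp bA).
by apply: eq_bigr => i _; rewrite !transpE.
Qed.

Lemma transp_bij : bijective L -> bijective transp.
Proof.
move=> [M ML LM]; have lM : linear M.
  by move=> c f g; apply: (can_inj ML); rewrite lL !LM.
pose r (u : hdual K) : H := predual (fun f => ev u (M f)).
have rE u f : ev f (r u) = ev u (M f).
  by rewrite predualE // => c g h; rewrite lM evl.
exists r => [h|u].
  by apply: ev_sep => f; rewrite rE transpE LM.
by apply: evP => a; rewrite transpE rE ML.
Qed.

Lemma hopf_iso_transpose : bijective L -> hopf_iso H (hdual K).
Proof. by move=> bL; exists transp; split; [exact: transp_hopf|exact: transp_bij]. Qed.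

End Transpose.

(** * Semisimple algebras and chains of quotients *)

Section SemisimpleAlgebra.
Variable k : fieldType.

(** Decompose 1 = c a + j along A a and a complementary left ideal; then a j = a - a c a lies in
    both, so it is 0. *)
Lemma semisimple_vnr (A : falgType k) : semisimple_alg A ->
  forall a : A, exists b, a * b * a = a.
Proof.
move=> ssA a; have [|J [JA IJ I0]] := ssA (limg (amulr a)).
  apply/prodvP=> u _ _ /memv_imgP[h _ ->]; apply/memv_imgP; exists (u * h).
    exact: memvf.
  by rewrite !lfunE /= mulrA.
have /memv_addP[i /memv_imgP[c _ iE] [j jJ jE]] : 1 \in (limg (amulr a) + J)%VS.
  by rewrite IJ memvf.
rewrite lfunE /= in iE; exists c; apply/esym/eqP; rewrite -subr_eq0 -memv0 -I0 memv_cap.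
apply/andP; split.
  apply/memv_imgP; exists (1 - a * c); first exact: memvf.
  by rewrite lfunE /= mulrBl mul1r.
suff -> : a - a * c * a = a * j by apply: (subvP JA); apply: memv_mul => //; exact: memvf.
by rewrite -{1}[a]mulr1 jE iE mulrDr mulrA addrAC subrr add0r.
Qed.

(** The component [j] of 1 in a left ideal complementary to the kernel of the counit: h j - eps(h) j
    lies in both. *)
Lemma semisimple_integral (H : hopfType k) : semisimple_alg H ->
  exists2 Lam : H, forall h, h * Lam = eps h *: Lam & eps Lam = 1.
Proof.
move=> ssH; have [|J [JA IJ I0]] := ssH (lker (@counit k H)).
  apply/prodvP=> u v _; rewrite !memv_ker => /eqP v0.
  by rewrite counitM v0 mulr0.
have /memv_addP[i iI [j jJ jE]] : 1 \in (lker (@counit k H) + J)%VS.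
  by rewrite IJ memvf.
have ej : eps j = 1.
  have := counit1 (s := H); rewrite jE linearD /=.
  by move: iI; rewrite memv_ker => /eqP->; rewrite add0r.
exists j => // h; apply/eqP; rewrite -subr_eq0 -memv0 -I0 memv_cap.
apply/andP; split.
  by rewrite memv_ker linearB linearZ /= counitM [counit j]ej [_ *: 1]mulr1 mulr1 subrr.
apply: memvB; last exact: memvZ.
by apply: (subvP JA); apply: memv_mul => //; exact: memvf.
Qed.

End SemisimpleAlgebra.

Section Chains.
Variable k : fieldType.
Implicit Types H B C : hopfType k.

Section PostIso.
Variables (H B C : hopfType k) (pi : 'AHom(H, B)) (phi : 'AHom(B, C)).
Hypothesis phi_bij : bijective phi.

Lemma tmap_bijr (U : vectType k) : injective (@tmap k U B U C idfun phi).
Proof.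
case: phi_bij => psi K1 K2; have lp : linear phi by exact: linearP.
have lpsi : linear psi by move=> c u v; apply: (can_inj K1); rewrite lp !K2.
apply: (can_inj (g := tmap idfun psi)) => t; rewrite tmap_comp //.
by rewrite (@eq_tmap _ _ _ _ _ _ idfun _ idfun) ?tmap_id.
Qed.

Lemma tmap_bijl (U : vectType k) : injective (@tmap k B U C U phi idfun).
Proof.
case: phi_bij => psi K1 K2; have lp : linear phi by exact: linearP.
have lpsi : linear psi by move=> c u v; apply: (can_inj K1); rewrite lp !K2.
apply: (can_inj (g := tmap psi idfun)) => t; rewrite tmap_comp //.
by rewrite (@eq_tmap _ _ _ _ _ _ idfun _ idfun) ?tmap_id.
Qed.

Let lpi : linear pi. Proof. exact: linearP. Qed.
Let lphi : linear phi. Proof. exact: linearP. Qed.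

Lemma rcoinv_comp h : rcoinv (comp_ahom phi pi) h <-> rcoinv pi h.
Proof.
rewrite /rcoinv (@eq_tmap _ _ _ _ _ _ (idfun \o idfun) _ (phi \o pi)) //; last first.
  by move=> u; rewrite comp_lfunE.
rewrite -tmap_comp // -(rmorph1 phi) -[tpure h _](tmapE h 1 (fun _ _ _ => erefl) lphi).
by split=> [/tmap_bijr|->].
Qed.

Lemma lcoinv_comp h : lcoinv (comp_ahom phi pi) h <-> lcoinv pi h.
Proof.
rewrite /lcoinv (@eq_tmap _ _ _ _ _ _ (phi \o pi) _ (idfun \o idfun)) //; last first.
  by move=> u; rewrite comp_lfunE.
rewrite -tmap_comp // -(rmorph1 phi) -[tpure _ h](tmapE 1 h lphi (fun _ _ _ => erefl)).
by split=> [/tmap_bijl|->].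
Qed.

Lemma limg_comp_bij : limg pi = fullv -> limg (comp_ahom phi pi) = fullv.
Proof.
case: phi_bij => psi K1 K2 pf; apply/eqP; rewrite eqEsubv subvf /=.
apply/subvP=> c _; have /memv_imgP[h _ hE] : psi c \in limg pi by rewrite pf memvf.
by apply/memv_imgP; exists h; rewrite ?memvf // comp_lfunE -hE K2.
Qed.

End PostIso.

(** The chain of [B] starts at an isomorphic copy of [B], so [pi] is first composed with the
    isomorphism, which leaves the coinvariants unchanged. *)
Lemma upper_semisolvable_step H B (pi : 'AHom(H, B)) :
  hopf_hom pi -> limg pi = fullv -> hopf_normal pi -> trivial_coinv pi ->
  upper_semisolvable B -> upper_semisolvable H.
Proof.
move=> hp fp np tp [n [C [p [[phi [hphi bphi]] iC steps]]]].
pose C' i := if i is i'.+1 then C i' else H.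
pose p' i : 'AHom(C' i, C' i.+1) :=
  match i return 'AHom(C' i, C' i.+1) with
  | 0 => comp_ahom phi pi
  | i'.+1 => p i'
  end.
exists n.+1, C', p'; split=> [|//|[_|i]]; [exact: hopf_iso_refl| |exact: steps].
split; first exact: hopf_hom_comp.
- exact: limg_comp_bij.
- move=> h; apply: iff_trans (rcoinv_comp _ bphi h) _.
  by apply: iff_trans (np h) _; apply: iff_sym; exact: lcoinv_comp.
have [K [iota [h1 h2 h3 h4]]] := tp; exists K, iota; split=> // h.
by apply: iff_trans (rcoinv_comp _ bphi h) _.
Qed.

Lemma upper_semisolvable_ground : upper_semisolvable (k^o : hopfType k).
Proof.
exists 0%N, (fun _ => k^o : hopfType k), (fun _ => \1%AF).
by split=> //; exact: hopf_iso_refl.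
Qed.

Section Counit.
Variable H : hopfType k.

Definition counit_ahom : 'AHom(H, k^o) :=
  @mkahom k H k^o _ (@eps_linear k H) (@epsM k H) (@counit1 k H).

Let cE h : counit_ahom h = eps h. Proof. exact: mkahomE. Qed.
Let lc : linear counit_ahom. Proof. exact: linearP. Qed.

Lemma counit_ahom_hopf : hopf_hom counit_ahom.
Proof.
split=> h; rewrite !cE; last first.
- by rewrite eps_antipode [LHS]lfunE.
- by rewrite [LHS]lfunE.
have [pl pr] := @tpure_bilin k k^o k^o.
rewrite [LHS]lfunE /= /ground_comul -[in LHS](counitl h).
have lf : linear (fun u : H => eps u *: tpure (1 : k^o) (1 : k^o)).
  by move=> c u v; rewrite eps_linear scalerDl scalerA.
rewrite (tlift_comp _ lf); apply: eq_tlift => u v; rewrite !cE.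
rewrite (linearZ' (@eps_linear _ H)) -[in RHS](mulr1 (eps u)) -[in RHS](mulr1 (eps v)).
by rewrite (linearZ' (pl _)) (linearZ' (pr _)) scalerA.
Qed.

Lemma counit_full : limg counit_ahom = fullv.
Proof.
apply/eqP; rewrite eqEsubv subvf /=; apply/subvP=> c _; apply/memv_imgP.
exists (c *: 1); first exact: memvf.
by rewrite (linearZ' lc) cE /eps counit1; apply/esym/mulr1.
Qed.

Lemma rcoinv_counit h : rcoinv counit_ahom h.
Proof.
have [pl pr] := @tpure_bilin k H k^o.
rewrite /rcoinv -[h in RHS]counitr (tlift_comp _ (pl _)).
apply: eq_tlift => u v; rewrite cE (linearZ' (pl _)) -(linearZ' (pr _)).
by rewrite [_ *: 1]mulr1.
Qed.

Lemma lcoinv_counit h : lcoinv counit_ahom h.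
Proof.
have [pl pr] := @tpure_bilin k k^o H.
rewrite /lcoinv -[h in RHS]counitl (tlift_comp _ (pr _)).
apply: eq_tlift => u v; rewrite cE (linearZ' (pr _)) -(linearZ' (pl _)).
by rewrite [_ *: 1]mulr1.
Qed.

(** One step suffices: the coinvariants of the counit are all of [H]. *)
Lemma upper_semisolvable_trivial : trivial_hopf H -> upper_semisolvable H.
Proof.
move=> tH; apply: (upper_semisolvable_step counit_ahom_hopf counit_full).
- by move=> h; split=> _; [exact: lcoinv_counit|exact: rcoinv_counit].
- exists H, \1%AF; split=> // [|u v|h].
  + split=> h; rewrite !lfunE //=.
    by rewrite (@eq_tmap _ _ _ _ _ _ idfun _ idfun) ?tmap_id // => u; rewrite lfunE.
  + by rewrite !lfunE.
  split=> _; last exact: rcoinv_counit.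
  by exists h; rewrite lfunE.
exact: upper_semisolvable_ground.
Qed.

End Counit.

End Chains.

(** * The induction on the exponent of [p] *)

Lemma cyclic_trivial_coinv (k : closedFieldType) (H : hopfType k) (Lam : H) (x : cglike H) :
    [pchar k] =i pred0 -> (forall a : H, exists b, a * b * a = a) ->
    (forall h, h * Lam = eps h *: Lam) -> eps Lam = 1 ->
    (forall i, (0 < i < cgl_order x)%N -> (x : H) ^+ i != 1) ->
  trivial_coinv (hpi x).
Proof.
move=> char0 vnr LamP eps_Lam xmin.
have [m mE] : exists m, cgl_order x = m.+1.
  exists (cgl_order x).-1; rewrite prednK // lt0n.
  by apply: contraTneq (cgl_order_neq0 x) => ->; rewrite eqxx.
have xm : (x : H) ^+ m.+1 = 1 by rewrite -mE cgl_exp.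
pose phi (i : 'I_m.+1) : H := (x : H) ^+ i.
have phi_gl i : glike (phi i) by exact/glikeX/cgl_glike.
have phiM i j : phi (i * j)%g = phi i * phi j.
  by rewrite /phi -exprD /= expr_mod.
have inj_le (i j : 'I_m.+1) : (i <= j)%N -> phi i = phi j -> i = j.
  move=> ij ijE; apply/val_inj/eqP => /=; rewrite eqn_leq ij leqNgt; apply/negP=> ltij.
  have /xmin/eqP[] : (0 < j - i < cgl_order x)%N.
    by rewrite subn_gt0 ltij mE ltnS (leq_trans (leq_subr _ _)) // -ltnS.
  have gS := glike_Smul (phi_gl i).
  by rewrite -[_ ^+ _]mul1r -gS -mulrA -exprD subnKC // -/(phi j) -ijE gS.
have phi_inj : injective phi.
  move=> i j ijE; have [ij|/ltnW ij] := leqP i j; first exact: inj_le.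
  by apply/esym/inj_le.
exists (galg k 'I_m.+1), (glift phi_gl phiM); split.
- exact: glift_hopf.
- exact: glift_inj.
- move=> h; apply: iff_trans (rcoinvE char0 vnr LamP eps_Lam xmin h) _.
  rewrite /in_cyclic mE; split=> [[c ->]|[a <-]].
    exists ([ffun i => c i : k^o] : galg k 'I_m.+1); rewrite gliftE.
    by apply: eq_bigr => i _; rewrite /gcoef ffunE.
  by exists (gcoef a); rewrite gliftE.
by exists 'I_m.+1; left; exact: hopf_iso_refl.
Qed.

Section QuotientGrouplikes.
Variables (k : closedFieldType) (H : hopfType k) (x : cglike H).
Local Notation A := (hdual H).
Local Notation B := (hquot x).
Implicit Types (f g : A) (u : hdual B).

Definition inflate u : A := dualf (fun h => ev u (hproj x h)).
Definition deflate f : hdual B := dualf (fun y : B => ev f (hval y)).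

Lemma ev_inflate u h : ev (inflate u) h = ev u (hproj x h).
Proof. by rewrite dualfE // => c a b; rewrite hproj_linear evl. Qed.

Lemma ev_deflate f y : ev (deflate f) y = ev f (hval y).
Proof. by rewrite dualfE // => c a b; rewrite hval_linear evl. Qed.

Lemma inflateK : cancel inflate deflate.
Proof. by move=> u; apply: evP => y; rewrite ev_deflate ev_inflate hvalK. Qed.

Lemma glike_inflate u : glike u -> glike (inflate u).
Proof.
case/glike_dual=> u1 uM; apply/glike_dual; split=> [|a h]; rewrite !ev_inflate.
  by rewrite hproj1.
by rewrite hprojM uM.
Qed.

Section Trivial.
Variable g : A.
Hypotheses (gg : glike g) (gx : ev g x = 1).

Lemma ev_cidem : ev g (cidem x) = 1.
Proof.
have [g1 gM] := (glike_dual g).1 gg.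
have gX i : ev g ((x : H) ^+ i) = 1.
  by elim: i => [|i IH]; rewrite ?exprS ?gM ?IH ?gx ?mulr1.
rewrite /cidem evlZ evl_sum; under eq_bigr => i _ do rewrite gX.
by rewrite sumr_const card_ord mulVf // cgl_order_neq0.
Qed.

Lemma ev_deflate_hproj h : ev (deflate g) (hproj x h) = ev g h.
Proof.
have [g1 gM] := (glike_dual g).1 gg.
by rewrite ev_deflate hprojK gM ev_cidem mulr1.
Qed.

Lemma glike_deflate : glike (deflate g).
Proof.
have [g1 gM] := (glike_dual g).1 gg.
apply/glike_dual; split=> [|y z]; rewrite !ev_deflate.
  by rewrite hval1 ev_cidem.
by rewrite hvalM gM.
Qed.

End Trivial.

(** Group-likes of the dual are algebra maps to [k]: those of the quotient inflate to [H], and those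
    that are 1 on [x] descend. *)
Lemma quotient_grouplikes (s : seq A) : uniq s ->
    (forall g, g \in s <-> glike g) -> (forall g, g \in s -> ev g x = 1) ->
  uniq (map deflate s) /\ forall u, u \in map deflate s <-> glike u.
Proof.
move=> us sP sx; split=> [|u].
  rewrite map_inj_in_uniq // => f g fs gs fg; apply: evP => h.
  by rewrite -(ev_deflate_hproj ((sP f).1 fs) (sx f fs)) fg ev_deflate_hproj ?sx //; apply/sP.
split=> [/mapP[g gs ->]|gu]; first by apply: glike_deflate; [apply/sP|apply: sx].
by rewrite -(inflateK u) map_f //; apply/sP/glike_inflate.
Qed.

End QuotientGrouplikes.

Lemma grouplikes_dvd (k : closedFieldType) (H : hopfType k) (Lam : H) (s : seq (hdual H)) :
    [pchar k] =i pred0 -> (forall a : H, exists b, a * b * a = a) ->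
    (forall h, h * Lam = eps h *: Lam) -> eps Lam = 1 ->
    uniq s -> (forall g, g \in s <-> glike g) ->
  (size s %| \dim {:H})%N.
Proof.
move=> char0 vnr LamP eps_Lam us sP.
have N0 : (size s)%:R != 0 :> k.
  move/pcharf0P: (char0) => ->; rewrite size_eq0.
  by have : 1 \in s by [apply/sP; exact: glike1]; apply: contraTneq => ->.
have := rk_idem char0 vnr LamP eps_Lam (LamG_idem char0 us sP).
rewrite (delta_LamG LamP eps_Lam us sP) => rE; apply/dvdnP; exists (rk (hitR (LamG s))).
by apply: (natr_inj0 char0); rewrite natrM rE divfK.
Qed.

(** Being independent, the group-likes form a basis of the dual, which is thus their group algebra;
    transposing gives [H]. *)
Lemma trivial_of_grouplikes (k : closedFieldType) (H : hopfType k) (s : seq (hdual H)) :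
  uniq s -> (forall g, g \in s <-> glike g) -> size s = \dim {:H} -> trivial_hopf H.
Proof.
move=> us sP sn; pose T := seq_sub s.
have Tgl (u : T) : glike (ssval u) by apply/sP; exact: ssvalP.
have mP (u v : T) : ssval u * ssval v \in s by apply/sP; exact: glikeM.
have oP : 1 \in s by apply/sP; exact: glike1.
have iP (u : T) : antipode (ssval u) \in s.
  apply/sP/glike_dual; have [u1 uM] := (glike_dual _).1 (Tgl u).
  split=> [|a h]; rewrite !ev_antipode; first by rewrite antipode1.
  by rewrite antipodeM uM mulrC.
pose mulT u v : T := SeqSub (mP u v); pose oneT : T := SeqSub oP.
pose invT u : T := SeqSub (iP u).
have mulTA : associative mulT by move=> u v w; apply: val_inj; rewrite /= mulrA.
have mul1T : left_id oneT mulT by move=> u; apply: val_inj; rewrite /= mul1r.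
have mulVT : left_inverse oneT invT mulT.
  by move=> u; apply: val_inj; rewrite /= glike_Smul.
pose gT : finGroupType := HB.pack T (Finite_isGroup.Build T mulTA mul1T mulVT).
pose phi (u : gT) : hdual H := ssval (u : T).
have phiM u v : phi (u * v)%g = phi u * phi v by [].
have phi_inj : injective phi by exact: val_inj.
exists gT; right; apply: (@hopf_iso_transpose k H _ (@glift k gT _ phi Tgl phiM)).
  exact: glift_hopf.
apply: glift_bij => //.
by rewrite [LHS]card_seq_sub // sn !dimvf; apply/esym/muln1.
Qed.

Theorem upper_semisolvable_pq (k : closedFieldType) (p q c : nat) :
    [pchar k] =i pred0 -> prime p -> prime q ->
  forall a, (p ^ a < q)%N -> forall (H : hopfType k) (Lam : H) (s : seq (hdual H)),
    (forall a : H, exists b, a * b * a = a) ->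
    (forall h, h * Lam = eps h *: Lam) -> eps Lam = 1 ->
    uniq s -> (forall g, g \in s <-> glike g) ->
    size s = (q ^ c)%N -> \dim {:H} = (p ^ a * q ^ c)%N ->
  upper_semisolvable H.
Proof.
move=> char0 pp pq; elim/ltn_ind=> a IH paq H Lam s vnr LamP eps_Lam us sP sq dH.
have [a0|a_gt0] := posnP a.
  apply/upper_semisolvable_trivial/(trivial_of_grouplikes us sP).
  by rewrite sq dH a0 mul1n.
have [x0 [gx x1 cx sx]] :=
  central_grouplike char0 vnr LamP eps_Lam us sP pp pq a_gt0 paq dH sq.
have exN : exists N, (0 < N)%N && (x0 ^+ N == 1).
  by have [N N0 /eqP xN] := glike_order gx; exists N; rewrite N0.
pose N := ex_minn exN.
have [N0 xN Nmin] : [/\ (0 < N)%N, x0 ^+ N = 1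
    & forall m, (0 < m)%N && (x0 ^+ m == 1) -> (N <= m)%N].
  by rewrite /N; case: ex_minnP => m /andP[m0 /eqP xm] mm.
have N0' : N%:R != 0 :> k by move/pcharf0P: (char0) => ->; rewrite -lt0n.
pose x := CGlike gx cx xN N0'.
have xmin i : (0 < i < cgl_order x)%N -> (x : H) ^+ i != 1.
  case/andP=> i0 iN; apply/negP=> xi.
  by have := Nmin i; rewrite i0 xi => /(_ isT); rewrite leqNgt [(_ < _)%N]iN.
have N1 : (1 < N)%N.
  by rewrite ltn_neqAle N0 andbT; apply: contra_neq x1 => NE; rewrite -[x0]expr1 NE.
have [us' sP'] := quotient_grouplikes (x := x) us sP sx.
have ss' : size (map (@deflate _ _ x) s) = (q ^ c)%N by rewrite size_map.
have vnr' := @hquot_vnr _ _ vnr x.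
have LamP' := hquot_integral LamP (x := x).
have eps' := etrans (eps_hproj x Lam) eps_Lam.
have dB : (\dim {:hquot x} * N = p ^ a * q ^ c)%N.
  by rewrite -dH; exact: (dim_hquot char0 vnr LamP eps_Lam xmin).
(* The q ^ c descended group-likes divide the dimension of the quotient; the cofactor [d] satisfies
   d N = p ^ a with N > 1, so it is a smaller power of [p]. *)
have := grouplikes_dvd char0 vnr' LamP' eps' us' sP'.
rewrite ss' => /dvdnP[d dE].
have qc0 : (0 < q ^ c)%N by rewrite expn_gt0 prime_gt0.
have dN : (d * N = p ^ a)%N.
  by apply/eqP; rewrite -(eqn_pmul2r qc0) -dB dE mulnAC.
have /(dvdn_pfactor _ _ pp)[a' a'a dp] : (d %| p ^ a)%N by rewrite -dN dvdn_mulr.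
have a'lt : (a' < a)%N.
  rewrite ltn_neqAle a'a andbT; apply: contraTneq N1 => a'E.
  have pa0 : (0 < p ^ a)%N by rewrite expn_gt0 prime_gt0.
  move/eqP: dN; rewrite dp a'E -[X in _ == X]muln1 eqn_pmul2l // => /eqP->.
  by rewrite ltnn.
apply: (upper_semisolvable_step (hpi_hopf x) (hpi_full x)).
- exact: (hpi_normal char0 vnr LamP eps_Lam xmin).
- exact: (cyclic_trivial_coinv char0 vnr LamP eps_Lam xmin).
apply: (IH a' a'lt _ _ _ _ vnr' LamP' eps' us' sP' ss'); last by rewrite dE dp.
by apply: leq_ltn_trans paq; rewrite leq_pexp2l ?prime_gt0.
Qed.

Theorem lemma3p4 (k : closedFieldType) (p q : nat) (H : hopfType k) :
  [pchar k] =i pred0 ->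
  prime p -> prime q -> (p ^ 4 < q)%N ->
  semisimple_alg H ->
  \dim {:H} = (p ^ 2 * q ^ 2)%N ->
  card_grouplike (hdual H) (q ^ 2) ->
  upper_semisolvable H.
Proof.
move=> char0 pp pq p4q ssH dH [s [us sE sq]].
have [Lam LamP eps_Lam] := semisimple_integral ssH.
have sP g : g \in s <-> glike g.
  rewrite sE; split=> [/andP[/eqP gc /eqP g1]|[gc g1]]; first by split.
  by apply/andP; split; apply/eqP.
(* The case a = c = 2, with p ^ 2 <= p ^ 4 < q. *)
apply: (upper_semisolvable_pq char0 pp pq _ (semisimple_vnr ssH) LamP eps_Lam us sP sq dH).
by apply: leq_ltn_trans p4q; rewrite leq_pexp2l ?prime_gt0.
Qed.
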